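(* Let $\lambda>1$, $L=\ln\lambda$, $\alpha$ Diophantine, and $\varepsilon>0$ small. Let $\theta\in\mathbb{R}$ and let $\phi_{\theta;s}$ be an $\ell^2$ eigenfunction of $H_\theta$, with $n=n_{\theta;s}$ the position of its leftmost maximum of $|\phi_{\theta;s}|$. Let $\ell\in\mathbb{Z}$, $\ell'=|\ell-n|$, and let $x_0\in[-2\ell',2\ell']$ be such that $$|\sin\pi(2\theta+\alpha(2n+x_0))|=\min_{|x|\le 2\ell'}|\sin\pi(2\theta+\alpha(2n+x))|.$$ Then for $\ell'$ sufficiently large (depending on $\varepsilon$): (i) if $(\ell-n)x_0<0$, then $|\phi_{\theta;s}(\ell)|\le e^{-(L-\varepsilon)|\ell-n|}|\phi_{\theta;s}(n)|$; (ii) if $(\ell-n)x_0\ge 0$ and $|\sin\pi(2\theta+\alpha(2n+x_0))|\ge e^{-\eta|\ell-n|}$ for some $\eta\in(0,L-\varepsilon)$, then $|\phi_{\theta;s}(\ell)|\le e^{-(L-\varepsilon-\eta)|\ell-n|}|\phi_{\theta;s}(n)|$.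
   Context: For $\theta\in\mathbb{R}$, the almost Mathieu operator $H_\theta$ acts on $u\in\ell^2(\mathbb{Z})$ by $(H_\theta u)(m)=u(m+1)+u(m-1)+2\lambda\cos(2\pi(\theta+m\alpha))u(m)$. The frequency $\alpha$ is Diophantine if there exist $\kappa>0,\tau>0$ such that $\|k\alpha\|_{\mathbb{R}/\mathbb{Z}}\ge \tau/|k|^{\kappa}$ for all integers $k\neq 0$. For an eigenfunction $\phi_{\theta;s}$, $n_{\theta;s}$ is the leftmost integer $n$ with $|\phi_{\theta;s}(n)|=\|\phi_{\theta;s}\|_{\ell^\infty(\mathbb{Z})}$. *)

(* Defs.v *)
From Stdlib Require Import Reals ZArith.
From Coquelicot Require Import Coquelicot.
Open Scope R_scope.

Definition distZ (x : R) : R := Rmin (frac_part x) (1 - frac_part x).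

Definition diophantine (alpha : R) : Prop :=
  exists kappa tau : R, 0 < kappa /\ 0 < tau /\
    forall k : Z, k <> 0%Z ->
      distZ (IZR k * alpha) >= tau / Rpower (IZR (Z.abs k)) kappa.

Definition amo_pot (lambda alpha theta : R) (m : Z) : R :=
  2 * lambda * cos (2 * PI * (theta + IZR m * alpha)).

Definition amo_apply (lambda alpha theta : R) (u : Z -> C) (m : Z) : C :=
  Cplus (Cplus (u (m + 1)%Z) (u (m - 1)%Z))
        (Cmult (RtoC (amo_pot lambda alpha theta m)) (u m)).

Definition in_l2 (u : Z -> C) : Prop :=
  ex_series (fun k : nat => (Cmod (u (Z.of_nat k)))^2) /\
  ex_series (fun k : nat => (Cmod (u (- Z.of_nat k)%Z))^2).

Definition is_l2_eigenfunction (lambda alpha theta : R) (phi : Z -> C) : Prop :=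
  in_l2 phi /\ (exists m, phi m <> RtoC 0) /\
  exists E : C, forall m : Z, amo_apply lambda alpha theta phi m = Cmult E (phi m).

Definition leftmost_max (phi : Z -> C) (n : Z) : Prop :=
  (forall m : Z, Cmod (phi m) <= Cmod (phi n)) /\
  (forall m : Z, (m < n)%Z -> Cmod (phi m) < Cmod (phi n)).

Definition amo_sin (alpha theta : R) (n x : Z) : R :=
  Rabs (sin (PI * (2 * theta + alpha * (2 * IZR n + IZR x)))).

(* Main.v *)
(* Divide the eigenfunction by its value at the maximum and shift the maximum to 0: the current
   Im (phi (m + 1) conj (phi m)) is monotone and vanishes at infinity, so the energy is real and the
   state is a real solution psi bounded by psi 0 = 1.  The determinant of H - E on k consecutive sites
   is, up to the phase of its midpoint, a polynomial of degree k with leading coefficient (2 lambda)^k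
   in cos (2 pi phi).

   Lower bound: Lagrange interpolation at nodes theta + j alpha together with Diophantine bounds for
   sine products produces a node whose box has a determinant of size at least lambda^k up to a
   subexponential factor, the only loss being the possible resonance |sin pi (2 theta + x1 alpha)|.

   Upper bound lambda^k e^(eps k), uniform in the phase: the boxes around the maximum of psi have
   small determinants, since otherwise psi 0 would be small; interpolating through these and through
   few nodes far outside [-1, 1] contradicts faster growth at a well chosen scale.  As the phase of psi
   may be resonant, the interpolation is done for a periodic approximant of the operator with a
   phase far from all reflections, whose state near energy E comes from the spectral theorem.

   Both bounds in the Green formula make psi decay at rate L away from 0 and from the reflected point
   x1.  When the resonance at x1 is at least e^(-eta l), one box of length about 2 x1 bounds psi near x1 by
   e^(eta l - L x1), which the decay then propagates to l. *)

From mathcomp Require all_boot all_order all_algebra complex Rstruct.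
Require Import Defs.
From Stdlib Require Import Reals ZArith Lra Lia List Permutation Classical.
From Coquelicot Require Import Coquelicot.
Import ListNotations.
Open Scope R_scope.

(** The growth rate of box determinants at energy [E] is the Lyapunov exponent, which equals
    [ln lambda] on the spectrum; here only the upper half is used, and the bounded state itself
    forces it. A polynomial of degree [k] asks for [k + 1] nodes, but the determinants known to be
    small belong to the boxes that hold the maximum at distance at least [d] from both ends, and
    these are [k - 2 d]. The other [2 d + 1] nodes lie in [[B, 2 B]], where the leading term
    dominates. They cost [(72 B^2) ^ (2 d + 1)], so [d] must be a small fraction of the scale [K];
    the deep boxes gain [exp (- d L)], and this gain must beat the loss at a resonance. No bound on
    that loss holds for an arbitrary phase, but in an approximant of period [q] the reflections met
    stay above [1 / (2 q)], and [q] can be kept below about [exp (c K)] with [c] well under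
    [d L / K]. The approximant moves the energy by about [exp (- 3 e2 K)]; the determinants survive
    this because, at the chosen scale, their logarithms exceed a linear bound in the length by at
    most [e2 K]. *)

(** * Finite sums and products over lists *)

Definition sumL {A : Type} (f : A -> R) (l : list A) : R :=
  fold_right (fun a r => f a + r) 0 l.

Definition prodL {A : Type} (f : A -> R) (l : list A) : R :=
  fold_right (fun a r => f a * r) 1 l.

Lemma sumL_ext {A} (f g : A -> R) l :
  (forall a, In a l -> f a = g a) -> sumL f l = sumL g l.
Proof.
  induction l as [|a l IH]; simpl; intros H; [easy|].
  rewrite H; [|now left]. rewrite IH; [easy|]. intros; apply H; now right.
Qed.

Lemma prodL_ext {A} (f g : A -> R) l :
  (forall a, In a l -> f a = g a) -> prodL f l = prodL g l.
Proof.
  induction l as [|a l IH]; simpl; intros H; [easy|].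
  rewrite H; [|now left]. rewrite IH; [easy|]. intros; apply H; now right.
Qed.

Lemma sumL_one {A} (f : A -> R) a : sumL f [a] = f a.
Proof. simpl. lra. Qed.

Lemma sumL_app {A} (f : A -> R) l1 l2 : sumL f (l1 ++ l2) = sumL f l1 + sumL f l2.
Proof. induction l1; simpl; [lra|]. rewrite IHl1; lra. Qed.

Lemma prodL_app {A} (f : A -> R) l1 l2 : prodL f (l1 ++ l2) = prodL f l1 * prodL f l2.
Proof. induction l1; simpl; [lra|]. rewrite IHl1; lra. Qed.

Lemma sumL_map {A B} (g : A -> B) (f : B -> R) l :
  sumL f (map g l) = sumL (fun a => f (g a)) l.
Proof. induction l; simpl; [easy|]. now rewrite IHl. Qed.

Lemma prodL_map {A B} (g : A -> B) (f : B -> R) l :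
  prodL f (map g l) = prodL (fun a => f (g a)) l.
Proof. induction l; simpl; [easy|]. now rewrite IHl. Qed.

Lemma sumL_perm {A} (f : A -> R) l1 l2 : Permutation l1 l2 -> sumL f l1 = sumL f l2.
Proof. induction 1; simpl; lra. Qed.

Lemma prodL_perm {A} (f : A -> R) l1 l2 : Permutation l1 l2 -> prodL f l1 = prodL f l2.
Proof. induction 1; simpl; try lra. now rewrite IHPermutation. Qed.

Lemma sumL_plus {A} (f g : A -> R) l :
  sumL (fun a => f a + g a) l = sumL f l + sumL g l.
Proof. induction l; simpl; [lra|]. rewrite IHl; lra. Qed.

Lemma sumL_scal {A} c (f : A -> R) l : sumL (fun a => c * f a) l = c * sumL f l.
Proof. induction l; simpl; [lra|]. rewrite IHl; lra. Qed.

Lemma prodL_mult {A} (f g : A -> R) l :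
  prodL (fun a => f a * g a) l = prodL f l * prodL g l.
Proof. induction l; simpl; [lra|]. rewrite IHl; lra. Qed.

Lemma prodL_const {A} c (l : list A) : prodL (fun _ => c) l = c ^ length l.
Proof. induction l; simpl; [lra|]. now rewrite IHl. Qed.

Lemma sumL_le {A} (f g : A -> R) l :
  (forall a, In a l -> f a <= g a) -> sumL f l <= sumL g l.
Proof.
  induction l as [|a l IH]; simpl; intros H; [lra|].
  assert (f a <= g a) by (apply H; now left).
  assert (sumL f l <= sumL g l) by (apply IH; intros; apply H; now right). lra.
Qed.

Lemma sumL_le_const {A} (f : A -> R) c l :
  (forall a, In a l -> f a <= c) -> sumL f l <= INR (length l) * c.
Proof.
  induction l as [|a l IH]; intros H; [simpl; lra|].
  change (length (a :: l)) with (S (length l)). rewrite S_INR; simpl.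
  assert (f a <= c) by (apply H; now left).
  assert (sumL f l <= INR (length l) * c) by (apply IH; intros; apply H; now right). lra.
Qed.

Lemma sumL_abs {A} (f : A -> R) l : Rabs (sumL f l) <= sumL (fun a => Rabs (f a)) l.
Proof.
  induction l; simpl; [rewrite Rabs_R0; lra|].
  eapply Rle_trans; [apply Rabs_triang|]. lra.
Qed.

Lemma prodL_abs {A} (f : A -> R) l : Rabs (prodL f l) = prodL (fun a => Rabs (f a)) l.
Proof. induction l; simpl; [apply Rabs_R1|]. now rewrite Rabs_mult, IHl. Qed.

Lemma prodL_pos {A} (f : A -> R) l : (forall a, In a l -> 0 < f a) -> 0 < prodL f l.
Proof.
  induction l as [|a l IH]; simpl; intros H; [lra|].
  apply Rmult_lt_0_compat; [apply H; now left | apply IH; intros; apply H; now right].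
Qed.

Lemma prodL_nonneg {A} (f : A -> R) l : (forall a, In a l -> 0 <= f a) -> 0 <= prodL f l.
Proof.
  induction l as [|a l IH]; simpl; intros H; [lra|].
  apply Rmult_le_pos; [apply H; now left | apply IH; intros; apply H; now right].
Qed.

Lemma prodL_le {A} (f g : A -> R) l :
  (forall a, In a l -> 0 <= f a <= g a) -> prodL f l <= prodL g l.
Proof.
  induction l as [|a l IH]; simpl; intros H; [lra|].
  apply Rmult_le_compat.
  - apply H; now left.
  - apply prodL_nonneg. intros; apply H; now right.
  - apply H; now left.
  - apply IH. intros; apply H; now right.
Qed.

Lemma prodL_neq0 {A} (f : A -> R) l : (forall a, In a l -> f a <> 0) -> prodL f l <> 0.
Proof.
  induction l as [|a l IH]; simpl; intros H; [lra|].
  apply Rmult_integral_contrapositive_currified;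
    [apply H; now left | apply IH; intros; apply H; now right].
Qed.

Lemma ln_prodL {A} (f : A -> R) l :
  (forall a, In a l -> 0 < f a) -> ln (prodL f l) = sumL (fun a => ln (f a)) l.
Proof.
  induction l as [|a l IH]; simpl; intros H; [apply ln_1|].
  rewrite ln_mult, IH; [easy| |apply H; now left|apply prodL_pos].
  all: intros; apply H; now right.
Qed.

Lemma sumL_exists_ge {A} (f : A -> R) c l :
  l <> [] -> INR (length l) * c <= sumL f l -> exists a, In a l /\ c <= f a.
Proof.
  induction l as [|a l IH]; [easy|]. intros _ H.
  change (length (a :: l)) with (S (length l)) in H. rewrite S_INR in H; simpl in H.
  destruct (Rle_dec c (f a)) as [h|h]; [exists a; split; [now left|easy]|].
  destruct l as [|b l].
  - simpl in H. lra.
  - destruct IH as [x [hx hx']]; [easy| |exists x; split; [now right|easy]]. lra.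
Qed.

(** * Divided differences *)

(** The denominator of Lagrange interpolation at [x]. The test makes it nonzero for every [x] and
    [l], so divisions by it carry no side condition. *)
Definition others (x : R) (l : list R) : R :=
  prodL (fun d => if Req_dec_T d x then 1 else x - d) l.

Arguments others : simpl never.

Definition dd (f : R -> R) (l : list R) : R := sumL (fun c => f c / others c l) l.

(* [f] behaves as a polynomial of degree at most [k] whose coefficient of degree [k] is [a]. *)
Definition isP (k : nat) (a : R) (f : R -> R) : Prop :=
  forall l, NoDup l -> length l = S k -> dd f l = a.

Lemma others_neq0 x l : others x l <> 0.
Proof.
  apply prodL_neq0. intros d _. destruct (Req_dec_T d x); lra.
Qed.

Lemma others_cons x d l : d <> x -> others x (d :: l) = (x - d) * others x l.
Proof. intros h. unfold others; simpl. now destruct (Req_dec_T d x). Qed.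

Lemma others_self x l : others x (x :: l) = others x l.
Proof. unfold others; simpl. destruct (Req_dec_T x x); [lra|easy]. Qed.

Lemma dd_perm f l1 l2 : Permutation l1 l2 -> dd f l1 = dd f l2.
Proof.
  intros H. unfold dd. rewrite (sumL_perm _ _ _ H). apply sumL_ext. intros a _.
  unfold others. now rewrite (prodL_perm _ _ _ H).
Qed.

Lemma dd_ext f g l : (forall x, f x = g x) -> dd f l = dd g l.
Proof. intros H. apply sumL_ext. intros; now rewrite H. Qed.

Lemma dd_lin a b f g l : dd (fun x => a * f x + b * g x) l = a * dd f l + b * dd g l.
Proof.
  unfold dd. rewrite <- !sumL_scal, <- sumL_plus. apply sumL_ext. intros c _.
  unfold Rdiv. ring.
Qed.

(** The factor [x - c] kills the term of the node [c] and cancels the factor that [c] puts into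
    every other denominator. *)
Lemma dd_factor f c l : NoDup (c :: l) -> dd (fun x => (x - c) * f x) (c :: l) = dd f l.
Proof.
  intros H. inversion H as [|? ? H1 H2]; subst. unfold dd; simpl.
  rewrite Rminus_diag, Rmult_0_l. unfold Rdiv at 1. rewrite Rmult_0_l, Rplus_0_l.
  apply sumL_ext. intros x hx.
  assert (c <> x) by (intros ->; easy).
  rewrite others_cons by easy. field. split; [apply others_neq0|lra].
Qed.

(** The difference of two instances of [dd_factor], since [(x - c1) - (x - c2) = c2 - c1]; this is
    the recursion of divided differences. *)
Lemma dd_two f c1 c2 l : NoDup (c1 :: c2 :: l) ->
  dd f (c1 :: c2 :: l) * (c2 - c1) = dd f (c2 :: l) - dd f (c1 :: l).
Proof.
  intros H.
  rewrite <- (dd_factor f c1 (c2 :: l)) by easy.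
  rewrite <- (dd_factor f c2 (c1 :: l)) by (eapply Permutation_NoDup; [apply perm_swap|easy]).
  rewrite (dd_perm _ (c2 :: c1 :: l) (c1 :: c2 :: l)) by apply perm_swap.
  rewrite Rmult_comm, <- (Rplus_0_r (_ * _)).
  transitivity (1 * dd (fun x => (x - c1) * f x) (c1 :: c2 :: l)
                + (-1) * dd (fun x => (x - c2) * f x) (c1 :: c2 :: l)); [|ring].
  rewrite <- dd_lin.
  transitivity ((c2 - c1) * dd f (c1 :: c2 :: l) + 0 * dd f (c1 :: c2 :: l)); [ring|].
  rewrite <- dd_lin. apply dd_ext. intros; ring.
Qed.

Lemma isP_ext k a f g : (forall x, f x = g x) -> isP k a f -> isP k a g.
Proof. intros H Hf l h1 h2. rewrite <- (dd_ext f g) by easy. now apply Hf. Qed.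

Lemma isP_const a : isP 0 a (fun _ => a).
Proof.
  intros [|c [|d l]] _ Hl; try easy. unfold dd, others; simpl.
  destruct (Req_dec_T c c); [field|easy].
Qed.

Lemma isP_weaken k a f : isP k a f -> isP (S k) 0 f.
Proof.
  intros H [|c1 [|c2 l]] Hn Hl; try easy.
  assert (h : dd f (c1 :: c2 :: l) * (c2 - c1) = 0).
  { rewrite dd_two by easy. inversion Hn as [|? ? h1 h2]; subst.
    rewrite (H (c2 :: l)); [|easy|simpl in *; lia].
    rewrite (H (c1 :: l)); [ring| |simpl in *; lia].
    inversion h2; subst. constructor; [|easy]. intros h; apply h1; now right. }
  inversion Hn as [|? ? h1 h2]; subst.
  assert (c1 <> c2) by (intros ->; apply h1; now left).
  apply Rmult_integral in h. destruct h; [easy|lra].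
Qed.

Lemma isP_X k a f : isP k a f -> isP (S k) a (fun x => x * f x).
Proof.
  intros H l Hn Hl. pose proof (isP_weaken _ _ _ H l Hn Hl) as h0.
  destruct l as [|c l]; [easy|].
  transitivity (1 * dd (fun x => (x - c) * f x) (c :: l) + c * dd f (c :: l)).
  - rewrite <- dd_lin. apply dd_ext. intros; ring.
  - rewrite h0, dd_factor by easy. rewrite (H l); [ring| |simpl in *; lia].
    now inversion Hn.
Qed.

Lemma isP_lin k a b f g u v :
  isP k a f -> isP k b g -> isP k (u * a + v * b) (fun x => u * f x + v * g x).
Proof. intros H1 H2 l h1 h2. rewrite dd_lin, H1, H2; easy. Qed.

Lemma others_notin x l : ~ In x l -> others x l = prodL (fun d => x - d) l.
Proof.
  intros h. apply prodL_ext. intros d hd. destruct (Req_dec_T d x); [subst; easy|easy].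
Qed.

(** Adjoin [x] to the [k] roots: only its own term survives in the divided difference, which equals
    [a]. *)
Lemma isP_roots k a f l x : isP k a f -> NoDup l -> length l = k ->
  (forall c, In c l -> f c = 0) -> f x = a * prodL (fun c => x - c) l.
Proof.
  intros H Hn Hl H0. destruct (in_dec Req_dec_T x l) as [hx|hx].
  - rewrite H0 by easy. symmetry.
    apply in_split in hx. destruct hx as [l1 [l2 ->]].
    rewrite prodL_app; simpl. ring.
  - rewrite <- (H (x :: l)); [|now constructor|simpl; lia].
    unfold dd; simpl. rewrite others_self.
    rewrite (sumL_ext _ (fun _ => 0 * 0)) by (intros c hc; rewrite H0 by easy; unfold Rdiv; ring).
    rewrite sumL_scal, others_notin by easy. field.
    rewrite <- others_notin by easy. apply others_neq0.
Qed.

(** * Sine products on a grid *)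

(** With the factor 2 the logarithm of [msin] has mean zero over a period, so products along an
    orbit neither grow nor decay exponentially. *)
Definition msin (x : R) : R := Rabs (2 * sin (PI * x)).

Lemma msin_nonneg x : 0 <= msin x.
Proof. apply Rabs_pos. Qed.

Lemma msin_le2 x : msin x <= 2.
Proof. unfold msin. pose proof (SIN_bound (PI * x)). apply Rabs_le. lra. Qed.

Lemma sin_IZR_PI n : sin (PI * IZR n) = 0.
Proof. apply sin_eq_0_1. exists n. ring. Qed.

Lemma cos_IZR_PI n : Rabs (cos (PI * IZR n)) = 1.
Proof.
  pose proof (sin2_cos2 (PI * IZR n)) as h. rewrite sin_IZR_PI in h.
  unfold Rsqr in h. assert (h' : (cos (PI * IZR n))² = 1²) by (unfold Rsqr; lra).
  apply Rsqr_eq_abs_0 in h'. rewrite h'. apply Rabs_R1.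
Qed.

Lemma msin_int x n : msin (x + IZR n) = msin x.
Proof.
  unfold msin. rewrite Rmult_plus_distr_l, sin_plus, sin_IZR_PI, Rmult_0_r, Rplus_0_r.
  rewrite !Rabs_mult, cos_IZR_PI. ring.
Qed.

Lemma msin_opp x : msin (- x) = msin x.
Proof.
  unfold msin. replace (PI * - x) with (- (PI * x)) by ring. rewrite sin_neg.
  replace (2 * - sin (PI * x)) with (- (2 * sin (PI * x))) by ring. apply Rabs_Ropp.
Qed.

Lemma msin_0 : msin 0 = 0.
Proof. unfold msin. rewrite Rmult_0_r, sin_0, Rmult_0_r. apply Rabs_R0. Qed.

Lemma msin_plus_le x y : msin (x + y) <= msin x + msin y.
Proof.
  unfold msin. rewrite Rmult_plus_distr_l, sin_plus, !Rabs_mult.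
  rewrite (Rabs_right 2) by lra.
  assert (h : forall a b, Rabs (sin a * cos b) <= Rabs (sin a)).
  { intros a b. rewrite Rabs_mult. rewrite <- (Rmult_1_r (Rabs (sin a))) at 2.
    apply Rmult_le_compat_l; [apply Rabs_pos|]. apply Rabs_le, COS_bound. }
  pose proof (Rabs_triang (sin (PI * x) * cos (PI * y)) (cos (PI * x) * sin (PI * y))).
  pose proof (h (PI * x) (PI * y)). pose proof (h (PI * y) (PI * x)).
  rewrite (Rmult_comm (cos (PI * x))) in *. lra.
Qed.

Lemma msin_minus_le x y : msin (x - y) <= msin x + msin y.
Proof. rewrite <- (msin_opp y). apply msin_plus_le. Qed.

Lemma sin_le_id x : 0 <= x -> sin x <= x.
Proof.
  intros [h|<-]; [|rewrite sin_0; lra]. left. now apply sin_lt_x.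
Qed.

Lemma Rabs_sin_le x : Rabs (sin x) <= Rabs x.
Proof.
  assert (h : forall y, 0 <= y -> Rabs (sin y) <= y).
  { intros y hy. destruct (Rle_dec 1 y) as [h|h].
    - pose proof (SIN_bound y). apply Rabs_le. lra.
    - rewrite Rabs_right; [now apply sin_le_id|].
      apply Rle_ge, sin_ge_0; [easy|]. pose proof PI2_1; pose proof PI_RGT_0. lra. }
  destruct (Rle_dec 0 x) as [hx|hx].
  - rewrite (Rabs_right x) by lra. now apply h.
  - rewrite <- Rabs_Ropp, <- sin_neg, (Rabs_left x) by lra. apply h; lra.
Qed.

Lemma msin_lip0 x : msin x <= 2 * PI * Rabs x.
Proof.
  unfold msin. rewrite Rabs_mult, Rabs_right by lra.
  pose proof (Rabs_sin_le (PI * x)) as h. rewrite Rabs_mult in h.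
  rewrite (Rabs_right PI) in h by (pose proof PI_RGT_0; lra). lra.
Qed.

Lemma msin_lip x y : Rabs (msin x - msin y) <= 2 * PI * Rabs (x - y).
Proof.
  pose proof (msin_lip0 (x - y)) as h1.
  pose proof (msin_plus_le (x - y) y) as h2. replace (x - y + y) with x in h2 by ring.
  pose proof (msin_plus_le (- (x - y)) x) as h3. replace (- (x - y) + x) with y in h3 by ring.
  rewrite msin_opp in h3. apply Rabs_le. lra.
Qed.

Lemma sin_ge_third x : 0 <= x <= PI / 2 -> x / 3 <= sin x.
Proof.
  intros [h1 h2]. pose proof PI_4 as hp.
  destruct (SIN x) as [h _]; [easy|lra|].
  unfold sin_lb, sin_approx in h. simpl in h. unfold sin_term in h; simpl in h.
  assert (x * x <= 4) by nra.
  assert (0 <= x * (x * x)) by (repeat apply Rmult_le_pos; lra).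
  assert (h5 : 0 <= x * (x * x) * (x * x)) by (repeat apply Rmult_le_pos; nra).
  assert (x * (x * x) <= 4 * x) by nra.
  assert (x * (x * x) * (x * x) * (x * x) <= 4 * (x * (x * x) * (x * x))) by nra.
  assert (x * (x * x) * (x * x) * (x * x) = x * (x * (x * (x * (x * (x * x)))))) by ring.
  lra.
Qed.

Lemma msin_lower x : 0 <= x <= 1 -> 2 * Rmin x (1 - x) <= msin x.
Proof.
  assert (h : forall y, 0 <= y <= 1/2 -> 2 * y <= msin y).
  { intros y hy. pose proof PI2_3_2. pose proof PI_RGT_0.
    assert (h : PI * y / 3 <= sin (PI * y)) by (apply sin_ge_third; nra).
    unfold msin. rewrite Rabs_right; [nra|]. nra. }
  intros hx. destruct (Rle_dec x (1/2)).
  - rewrite Rmin_left by lra. apply h; lra.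
  - rewrite Rmin_right by lra.
    rewrite <- msin_opp, <- (msin_int _ 1). replace (- x + 1) with (1 - x) by ring.
    apply h; lra.
Qed.

Lemma msin_distZ x : 2 * distZ x <= msin x.
Proof.
  unfold distZ. destruct (base_fp x) as [h1 h2].
  assert (h : msin x = msin (frac_part x)).
  { rewrite <- (msin_int (frac_part x) (Int_part x)). f_equal.
    unfold frac_part. ring. }
  rewrite h. apply msin_lower. lra.
Qed.

Lemma msin_eq0 x : msin x = 0 -> exists k : Z, x = IZR k.
Proof.
  unfold msin. intros h. apply Rabs_eq_0 in h.
  destruct (sin_eq_0_0 (PI * x)) as [k hk]; [lra|]. exists k.
  pose proof PI_RGT_0. apply (Rmult_eq_reg_l PI); lra.
Qed.

(** Interpolation nodes are cosines; this formula turns their distance into a sine of the difference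
    times a sine of the reflection [a + b]. The latter is where resonances enter. *)
Lemma cos_diff_msin a b :
  Rabs (cos (2 * PI * a) - cos (2 * PI * b)) = msin (a + b) * msin (a - b) / 2.
Proof.
  unfold msin. rewrite <- Rabs_mult.
  replace (cos (2 * PI * a) - cos (2 * PI * b))
    with (- (2 * sin (PI * (a + b)) * (2 * sin (PI * (a - b)))) / 2).
  - unfold Rdiv. rewrite Rabs_mult, Rabs_Ropp, (Rabs_right (/ 2)) by lra. easy.
  - replace (2 * PI * a) with (PI * (a + b) + PI * (a - b)) by ring.
    replace (2 * PI * b) with (PI * (a + b) - PI * (a - b)) by ring.
    rewrite cos_plus, cos_minus. lra.
Qed.

(** The Chebyshev polynomials [T_n] and [T_(n+1)] of the first kind, paired to run their
    recursion. *)
Fixpoint cheb (n : nat) (x : R) : R * R :=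
  match n with
  | O => (1, x)
  | S n => let (a, b) := cheb n x in (b, 2 * x * b - a)
  end.

Lemma cheb_isP n : isP (S n) (2 ^ n) (fun x => snd (cheb n x)) /\
  exists a, isP n a (fun x => fst (cheb n x)).
Proof.
  induction n as [|n [IH1 [a IH2]]].
  - split; [|exists 1; exact (isP_const 1)].
    apply (isP_ext _ _ (fun x => x * 1)); [intros; simpl; ring|].
    apply isP_X, isP_const.
  - split.
    + apply (isP_ext _ _ (fun x => 2 * (x * snd (cheb n x)) + (-1) * fst (cheb n x))).
      { intros x; simpl. destruct (cheb n x); simpl; ring. }
      replace (2 ^ S n) with (2 * 2 ^ n + (-1) * 0) by (simpl; ring).
      apply isP_lin; [now apply isP_X|]. apply isP_weaken with (a := 0).
      now apply isP_weaken with (a := a).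
    + exists (2 ^ n). apply (isP_ext _ _ (fun x => snd (cheb n x))); [|easy].
      intros x; simpl. now destruct (cheb n x).
Qed.

Lemma cheb_cos n t : cheb n (cos t) = (cos (INR n * t), cos (INR (S n) * t)).
Proof.
  induction n as [|n IH].
  - simpl. rewrite Rmult_0_l, Rmult_1_l, cos_0. easy.
  - simpl cheb. rewrite IH. f_equal.
    rewrite !S_INR. replace ((INR n + 1 + 1) * t) with ((INR n + 1) * t + t) by ring.
    replace (cos (INR n * t)) with (cos ((INR n + 1) * t - t)) by (f_equal; ring).
    rewrite cos_plus, cos_minus. ring.
Qed.

Lemma NoDup_map_inj {A B} (f : A -> B) l :
  (forall x y, In x l -> In y l -> f x = f y -> x = y) -> NoDup l -> NoDup (map f l).
Proof.
  induction l as [|a l IH]; intros H Hn; simpl; [constructor|].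
  inversion Hn; subst. constructor.
  - intros h. apply in_map_iff in h. destruct h as [b [h1 h2]].
    rewrite (H b a) in h2; [easy|now right|now left|easy].
  - apply IH; [|easy]. intros; apply H; try now right. easy.
Qed.

(* These are the values at [1] of the factors of the Chebyshev polynomial [T_q]. *)
Lemma prod_msin_grid q : (1 <= q)%nat ->
  prodL (fun i => (msin ((INR i + 1/4) / INR q))^2) (seq 0 q) = 2.
Proof.
  intros hq. destruct q as [|q]; [lia|].
  assert (hq0 : 0 < INR (S q)) by (apply lt_0_INR; lia).
  set (ang := fun i : nat => (INR i + 1/4) / INR (S q)).
  set (r := fun i : nat => cos (2 * PI * ang i)).
  destruct (cheb_isP q) as [HP _].
  (* The offset [1/4] makes the cosines zeros of the Chebyshev polynomial and keeps them distinct: a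
     coincidence would make the odd number [2 (i + j) + 1] even, or force [i = j]. *)
  assert (Hinj : forall i j, In i (seq 0 (S q)) -> In j (seq 0 (S q)) -> r i = r j -> i = j).
  { intros i j hi hj hr. apply in_seq in hi, hj.
    assert (h : msin (ang i + ang j) * msin (ang i - ang j) / 2 = 0).
    { rewrite <- cos_diff_msin. unfold r in hr. rewrite hr, Rminus_diag. apply Rabs_R0. }
    assert (h' : msin (ang i + ang j) * msin (ang i - ang j) = 0) by lra.
    apply Rmult_integral in h'. destruct h' as [h'|h']; apply msin_eq0 in h';
      destruct h' as [k hk]; unfold ang in hk.
    - assert (he : 2 * (INR i + INR j) + 1 = 2 * (IZR k * INR (S q))).
      { rewrite <- hk. field. lra. }
      rewrite !INR_IZR_INZ, <- !plus_IZR, <- !mult_IZR, <- plus_IZR in he.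
      apply eq_IZR in he. lia.
    - assert (he : INR i - INR j = IZR k * INR (S q)).
      { rewrite <- hk. field. lra. }
      rewrite !INR_IZR_INZ, <- !minus_IZR, <- !mult_IZR in he.
      apply eq_IZR in he. assert (k = 0)%Z by nia. nia. }
  assert (H1 : snd (cheb q 1) = 2 ^ q * prodL (fun c => 1 - c) (map r (seq 0 (S q)))).
  { apply (isP_roots (S q) _ (fun x => snd (cheb q x))).
    - easy.
    - apply NoDup_map_inj; [easy|apply seq_NoDup].
    - now rewrite length_map, length_seq.
    - intros c hc. apply in_map_iff in hc. destruct hc as [i [<- hi]].
      unfold r. rewrite cheb_cos. cbn [snd].
      replace (INR (S q) * (2 * PI * ang i)) with (PI / 2 + 2 * INR i * PI)
        by (unfold ang; field; lra).
      rewrite cos_period. apply cos_PI2. }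
  rewrite <- cos_0 in H1 at 1. rewrite cheb_cos in H1. cbn [snd] in H1.
  rewrite Rmult_0_r, cos_0, prodL_map in H1.
  assert (H2 : prodL (fun i => (msin (ang i))^2) (seq 0 (S q))
               = 2 ^ S q * prodL (fun i => 1 - r i) (seq 0 (S q))).
  { rewrite <- (length_seq (S q) 0) at 2. rewrite <- prodL_const, <- prodL_mult.
    apply prodL_ext. intros i _.
    pose proof (cos_diff_msin 0 (ang i)) as h.
    rewrite Rmult_0_r, cos_0, Rplus_0_l, Rminus_0_l, msin_opp in h.
    fold (r i) in h. rewrite Rabs_right in h.
    - rewrite h. field.
    - pose proof (COS_bound (2 * PI * ang i)). unfold r. lra. }
  unfold ang in H2. rewrite H2. simpl pow at 1. rewrite Rmult_assoc, <- H1. ring.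
Qed.

(** * Rational approximation and logarithmic sine sums *)

Lemma Int_part_bounds x : IZR (Int_part x) <= x < IZR (Int_part x) + 1.
Proof. destruct (base_Int_part x). lra. Qed.

(** Pigeonhole: the [Q + 1] fractional parts of [i alpha], [0 <= i <= Q], fall into [Q] intervals of
    length [1 / Q]. *)
Lemma dirichlet_pair alpha (Q : nat) : (1 <= Q)%nat ->
  exists (q : nat) (P : Z), (1 <= q <= Q)%nat /\ Rabs (INR q * alpha - IZR P) <= / INR Q.
Proof.
  intros hQ. assert (hQ0 : 0 < INR Q) by (apply lt_0_INR; lia).
  set (f := fun i : nat => Z.to_nat (Int_part (INR Q * frac_part (INR i * alpha)))).
  assert (Hf : forall i, INR (f i) <= INR Q * frac_part (INR i * alpha) < INR (f i) + 1).
  { intros i. unfold f. destruct (base_fp (INR i * alpha)) as [h1 h2].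
    pose proof (Int_part_bounds (INR Q * frac_part (INR i * alpha))) as h.
    rewrite INR_IZR_INZ, Z2Nat.id; [easy|].
    assert (-1 < Int_part (INR Q * frac_part (INR i * alpha)))%Z; [|lia].
    apply lt_IZR. assert (0 <= INR Q * frac_part (INR i * alpha)) by nra. simpl. lra. }
  assert (Hlt : forall i, (f i < Q)%nat).
  { intros i. apply INR_lt. destruct (base_fp (INR i * alpha)). destruct (Hf i). nra. }
  destruct (classic (exists i j, (i < j <= Q)%nat /\ f i = f j)) as [[i [j [hij he]]]|hn].
  - exists (j - i)%nat, (Int_part (INR j * alpha) - Int_part (INR i * alpha))%Z.
    split; [lia|]. rewrite minus_INR, minus_IZR by lia.
    destruct (Hf i) as [a1 a2]. destruct (Hf j) as [b1 b2]. rewrite he in a1, a2.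
    unfold frac_part in a1, a2, b1, b2.
    apply Rabs_le. split; apply (Rmult_le_reg_l (INR Q)); try easy.
    + rewrite Ropp_mult_distr_r_reverse, Rinv_r by lra. lra.
    + rewrite Rinv_r by lra. lra.
  - exfalso. assert (h : (length (map f (seq 0 (S Q))) <= length (seq 0 Q))%nat).
    { apply NoDup_incl_length.
      - apply NoDup_map_inj; [|apply seq_NoDup]. intros i j hi hj he.
        apply in_seq in hi, hj. destruct (Nat.lt_trichotomy i j) as [h|[h|h]]; [|easy|];
        exfalso; apply hn; [exists i, j|exists j, i]; split; [lia|easy|lia|easy].
      - intros y hy. apply in_map_iff in hy. destruct hy as [i [<- _]].
        apply in_seq. specialize (Hlt i). lia. }
    rewrite length_map, !length_seq in h. lia.
Qed.

(** Division by the gcd does not increase the error. Coprimality is wanted because it makes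
    [j -> a + j P] a permutation modulo [q]. *)
Lemma dirichlet alpha (Q : nat) : (1 <= Q)%nat ->
  exists (q : nat) (P : Z), (1 <= q <= Q)%nat /\ Z.gcd P (Z.of_nat q) = 1%Z /\
    Rabs (INR q * alpha - IZR P) <= / INR Q.
Proof.
  intros hQ. destruct (dirichlet_pair alpha Q hQ) as [q [P [hq h]]].
  set (d := Z.gcd P (Z.of_nat q)).
  assert (hd : (0 < d)%Z).
  { pose proof (Z.gcd_nonneg P (Z.of_nat q)).
    assert (d <> 0)%Z by (intros e; apply Z.gcd_eq_0_r in e; lia). unfold d in *; lia. }
  destruct (Z.gcd_divide_l P (Z.of_nat q)) as [P' hP'].
  destruct (Z.gcd_divide_r P (Z.of_nat q)) as [q' hq'].
  fold d in hP', hq'.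
  assert (hq'0 : (1 <= q')%Z) by nia.
  exists (Z.to_nat q'), P'. split; [split; [lia|nia]|]. split.
  - rewrite Z2Nat.id by lia.
    assert (e : Z.gcd (P' * d) (q' * d) = d) by (rewrite <- hP', <- hq'; easy).
    rewrite Z.gcd_mul_mono_r_nonneg in e by lia.
    apply (Z.mul_reg_r _ _ d); lia.
  - eapply Rle_trans; [|apply h].
    rewrite INR_IZR_INZ, Z2Nat.id by lia.
    rewrite (INR_IZR_INZ q), hq', hP', !mult_IZR.
    replace (IZR q' * IZR d * alpha - IZR P' * IZR d) with (IZR d * (IZR q' * alpha - IZR P')) by ring.
    rewrite Rabs_mult. assert (1 <= IZR d) by (apply IZR_le; lia).
    rewrite (Rabs_right (IZR d)) by lra. pose proof (Rabs_pos (IZR q' * alpha - IZR P')). nra.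
Qed.

Lemma seq_perm_inj (f : nat -> nat) q :
  (forall i, (i < q)%nat -> (f i < q)%nat) ->
  (forall i j, (i < q)%nat -> (j < q)%nat -> f i = f j -> i = j) ->
  Permutation (map f (seq 0 q)) (seq 0 q).
Proof.
  intros h1 h2. apply NoDup_Permutation_bis.
  - apply NoDup_map_inj; [|apply seq_NoDup].
    intros i j hi hj. apply in_seq in hi, hj. apply h2; lia.
  - now rewrite length_map.
  - intros y hy. apply in_map_iff in hy. destruct hy as [i [<- hi]].
    apply in_seq in hi. apply in_seq. specialize (h1 i). lia.
Qed.

Lemma ln_le_sub1 x : 0 < x -> ln x <= x - 1.
Proof.
  intros h. pose proof (exp_ineq1_le (ln x)) as h1. rewrite exp_ln in h1 by easy. lra.
Qed.

Lemma ln_near_one r y : 0 <= y <= 1/2 -> 1 - y <= r <= 1 + y -> Rabs (ln r) <= 2 * y.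
Proof.
  intros hy hr. assert (hr0 : 0 < r) by lra.
  pose proof (ln_le_sub1 r hr0). pose proof (ln_le_sub1 (/ r) (Rinv_0_lt_compat _ hr0)) as h.
  rewrite ln_Rinv in h by easy.
  assert (/ r - 1 <= 2 * y).
  { apply (Rmult_le_reg_l r); [easy|]. rewrite Rmult_minus_distr_l, Rinv_r by lra. nra. }
  apply Rabs_le. lra.
Qed.

Lemma ln2_le1 : ln 2 <= 1.
Proof. pose proof (ln_le_sub1 2). lra. Qed.

Lemma ln_le_compat x y : 0 < x -> x <= y -> ln x <= ln y.
Proof. intros h [h'|<-]; [left; now apply ln_increasing|lra]. Qed.

Lemma exp_mono x y : x <= y -> exp x <= exp y.
Proof. intros [h|<-]; [left; now apply exp_increasing|lra]. Qed.

Lemma ln_trunc_bound v s : 0 < s <= 1 -> v <= 2 -> Rabs (ln (Rmax v s)) <= 1 + - ln s.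
Proof.
  intros hs hv. pose proof ln2_le1.
  assert (h1 : ln s <= 0) by (rewrite <- ln_1; apply ln_le_compat; lra).
  assert (ln s <= ln (Rmax v s)) by (apply ln_le_compat; [easy|apply Rmax_r]).
  assert (ln (Rmax v s) <= ln 2).
  { apply ln_le_compat; [|apply Rmax_lub; lra]. eapply Rlt_le_trans; [|apply Rmax_r]. easy. }
  apply Rabs_le. lra.
Qed.

(** A displacement of [2 / q] changes the logarithm by about the inverse of the distance, counted in
    grid steps, to the nearest zero of the sine. The two terms of the bound measure the distance to
    either end of the period. *)
Lemma compare_grid (q i : nat) v s : (i < q)%nat -> 0 < s <= / INR q ->
  Rabs (v - (INR i + 1/4) / INR q) <= 2 / INR q ->
  Rabs (ln (Rmax (msin v) s) - ln (msin ((INR i + 1/4) / INR q)))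
    <= 32 * (1 + - ln s) * (/ (1 + INR i) + / (1 + INR (q - 1 - i))).
Proof.
  intros hi hs hv. assert (hq : 1 <= INR q) by (apply (le_INR 1); lia).
  assert (hq1 : / INR q <= 1) by (rewrite <- Rinv_1; apply Rinv_le_contravar; lra).
  set (u := (INR i + 1/4) / INR q) in *.
  set (mu := Rmin (INR i) (INR (q - 1 - i))).
  pose proof (pos_INR i) as hi0. pose proof (pos_INR (q - 1 - i)) as hi1.
  assert (hiq : INR (q - 1 - i) = INR q - 1 - INR i) by (rewrite !minus_INR by lia; simpl; lra).
  assert (hmu : 0 <= mu) by (apply Rmin_glb; easy).
  assert (hsum : / (1 + mu) <= / (1 + INR i) + / (1 + INR (q - 1 - i))).
  { assert (0 < / (1 + INR i)) by (apply Rinv_0_lt_compat; lra).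
    assert (0 < / (1 + INR (q - 1 - i))) by (apply Rinv_0_lt_compat; lra).
    unfold mu. destruct (Rle_dec (INR i) (INR (q - 1 - i))).
    - rewrite Rmin_left by easy. lra.
    - rewrite Rmin_right by lra. lra. }
  assert (hls : ln s <= 0) by (rewrite <- ln_1; apply ln_le_compat; lra).
  apply Rle_trans with (32 * (1 + - ln s) * / (1 + mu));
    [|apply Rmult_le_compat_l; [lra|easy]].
  assert (hu : 2 * (mu + 1/4) / INR q <= msin u).
  { eapply Rle_trans; [|apply msin_lower].
    - unfold Rdiv. rewrite Rmult_assoc. apply Rmult_le_compat_l; [lra|].
      assert (0 < / INR q) by (apply Rinv_0_lt_compat; lra).
      apply Rmin_glb.
      + unfold u, Rdiv. apply Rmult_le_compat_r; [lra|]. pose proof (Rmin_l (INR i) (INR (q - 1 - i))).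
        unfold mu; lra.
      + replace (1 - u) with ((INR q - (INR i + 1/4)) * / INR q) by (unfold u; field; lra).
        apply Rmult_le_compat_r; [lra|]. pose proof (Rmin_r (INR i) (INR (q - 1 - i))).
        unfold mu; lra.
    - unfold u. split.
      + apply Rdiv_le_0_compat; lra.
      + apply (Rmult_le_reg_r (INR q)); [lra|]. unfold Rdiv. rewrite Rmult_assoc, Rinv_l by lra. lra. }
  assert (hd : Rabs (msin v - msin u) <= 16 / INR q).
  { eapply Rle_trans; [apply msin_lip|]. pose proof PI_4. pose proof PI_RGT_0.
    apply Rle_trans with (2 * 4 * Rabs (v - u)).
    - apply Rmult_le_compat_r; [apply Rabs_pos|lra].
    - unfold Rdiv in *. lra. }
  assert (hq0 : 0 < / INR q) by (apply Rinv_0_lt_compat; lra).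
  assert (hu0 : 0 < msin u).
  { eapply Rlt_le_trans; [|apply hu]. apply Rdiv_lt_0_compat; lra. }
  (* At 16 or more steps from a zero the relative error is at most [8 / (mu + 1/4) <= 1/2]. Nearer,
     each logarithm is at most [1 - ln s] in absolute value, and [16 / (1 + mu) >= 1] covers the
     sum. *)
  destruct (Rle_dec 16 mu) as [h16|h16].
  - set (y := 8 / (mu + 1/4)).
    assert (hy : 0 <= y <= 1/2).
    { unfold y. split; [apply Rdiv_le_0_compat; lra|].
      apply (Rmult_le_reg_r (mu + 1/4)); [lra|]. unfold Rdiv. rewrite Rmult_assoc, Rinv_l by lra. lra. }
    assert (hyu : 16 / INR q <= y * msin u).
    { apply Rle_trans with (y * (2 * (mu + 1/4) / INR q)).
      - right. unfold y. field. lra.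
      - apply Rmult_le_compat_l; [lra|easy]. }
    apply Rabs_le_between in hd.
    assert (hmv : s <= msin v).
    { apply Rle_trans with (/ INR q); [easy|].
      assert (y * msin u <= 1/2 * msin u) by (apply Rmult_le_compat_r; lra).
      assert (2 * (16 + 1/4) / INR q <= 2 * (mu + 1/4) / INR q).
      { apply Rmult_le_compat_r; lra. }
      unfold Rdiv in *. lra. }
    rewrite Rmax_left by easy. rewrite <- ln_div by lra.
    eapply Rle_trans; [apply (ln_near_one _ y); [easy|]|].
    + split; apply (Rmult_le_reg_r (msin u)); try easy; unfold Rdiv;
        rewrite (Rmult_assoc (msin v)), Rinv_l by lra; lra.
    + apply Rle_trans with (32 * 1 * / (1 + mu)).
      * unfold y. apply (Rmult_le_reg_r ((1 + mu) * (mu + 1/4))); [nra|].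
        replace (2 * (8 / (mu + 1/4)) * ((1 + mu) * (mu + 1/4))) with (16 * (1 + mu)) by (field; lra).
        replace (32 * 1 * / (1 + mu) * ((1 + mu) * (mu + 1/4))) with (32 * (mu + 1/4)) by (field; lra).
        lra.
      * apply Rmult_le_compat_r; [left; apply Rinv_0_lt_compat; lra|]. lra.
  - assert (Rabs (ln (Rmax (msin v) s)) <= 1 + - ln s) by (apply ln_trunc_bound; [lra|apply msin_le2]).
    assert (Rabs (ln (msin u)) <= 1 + - ln s).
    { assert (ln (msin u) <= ln 2) by (apply ln_le_compat; [easy|apply msin_le2]).
      assert (ln (s / 2) <= ln (msin u)).
      { apply ln_le_compat; [lra|]. eapply Rle_trans; [|apply hu].
        unfold Rdiv. nra. }
      unfold Rdiv in *. rewrite ln_mult, ln_Rinv in * by lra. pose proof ln2_le1. apply Rabs_le. lra. }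
    assert (1 <= 16 * / (1 + mu)).
    { apply (Rmult_le_reg_r (1 + mu)); [lra|]. rewrite Rmult_assoc, Rinv_l by lra.
      destruct (Rle_dec (INR i) (INR (q - 1 - i))) as [c|c].
      - assert (e : mu = INR i) by (unfold mu; now rewrite Rmin_left).
        rewrite e in *. assert (i < 16)%nat by (apply INR_lt; simpl; lra).
        assert (INR i <= 15) by (replace 15 with (INR 15) by (simpl; lra); apply le_INR; lia). lra.
      - assert (e : mu = INR (q - 1 - i)) by (unfold mu; rewrite Rmin_right; lra).
        rewrite e in *. assert (q - 1 - i < 16)%nat by (apply INR_lt; simpl; lra).
        assert (INR (q - 1 - i) <= 15) by (replace 15 with (INR 15) by (simpl; lra); apply le_INR; lia). lra. }
    unfold Rminus. eapply Rle_trans; [apply Rabs_triang|]. rewrite Rabs_Ropp. nra.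
Qed.

Lemma harmonic_sqrt q : sumL (fun i => / (1 + INR i)) (seq 0 q) <= 2 * sqrt (INR q).
Proof.
  induction q as [|q IH].
  - simpl. rewrite sqrt_0. lra.
  - rewrite seq_S, sumL_app. simpl sumL at 2. simpl plus.
    rewrite S_INR. pose proof (pos_INR q) as hq.
    assert (h1 : sqrt (INR q) * sqrt (INR q) = INR q) by (now apply sqrt_sqrt).
    assert (h2 : sqrt (INR q + 1) * sqrt (INR q + 1) = INR q + 1) by (apply sqrt_sqrt; lra).
    pose proof (sqrt_pos (INR q)). assert (h3 : 0 < sqrt (INR q + 1)) by (apply sqrt_lt_R0; lra).
    set (a := sqrt (INR q)) in *. set (b := sqrt (INR q + 1)) in *.
    assert (/ (1 + INR q) <= 2 * (b - a)); [|lra].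
    assert (hb : a <= b) by nra.
    apply (Rmult_le_reg_l (1 + INR q)); [lra|]. rewrite Rinv_r by lra.
    assert (h4 : (b - a) * (b + a) = 1) by nra.
    assert (1 <= b) by nra.
    assert (b * b * (2 * (b - a)) >= (b + a) * (b - a)) by nra. nra.
Qed.

Section LogSine.

Variables (alpha p : R).

(** The logarithm of a product of sines along the orbit, each sine truncated below at [s] so that a
    visit near an integer stays harmless. *)
Definition trsum (s x : R) (m : nat) : R :=
  sumL (fun j => ln (Rmax (msin (x + INR j * alpha)) s)) (seq 0 m).

Lemma trsum_add s x m1 m2 : trsum s x (m1 + m2) = trsum s x m1 + trsum s (x + INR m1 * alpha) m2.
Proof.
  unfold trsum. rewrite seq_app, sumL_app. f_equal. simpl.
  rewrite <- (Nat.add_0_r m1) at 1.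
  assert (h : forall a, seq (m1 + a) m2 = map (fun i => (m1 + i)%nat) (seq a m2)).
  { clear. induction m2 as [|m2 IH]; intros a; simpl; [easy|].
    f_equal. rewrite <- IH. f_equal. lia. }
  rewrite h, sumL_map. apply sumL_ext. intros i _.
  rewrite plus_INR, Rmult_plus_distr_r, Rplus_assoc. easy.
Qed.

(** As [q alpha] is within [1 / q] of [P], the point [x + j alpha] lies within [2 / q], modulo 1, of
    the grid point with index [(a + j P) mod q]. These indices run through a permutation, so the sum
    is compared with the exact grid product. *)
Lemma trsum_block (q Q : nat) (P : Z) s x : (1 <= q <= Q)%nat -> Z.gcd P (Z.of_nat q) = 1%Z ->
  Rabs (INR q * alpha - IZR P) <= / INR Q -> 0 < s <= / INR q ->
  Rabs (trsum s x q) <= 129 * (1 + - ln s) * sqrt (INR q).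
Proof.
  intros hq hg ha hs.
  assert (hq0 : 1 <= INR q) by (apply (le_INR 1); lia).
  assert (hqQ : INR q <= INR Q) by (apply le_INR; lia).
  assert (ha' : Rabs (INR q * alpha - IZR P) <= / INR q).
  { eapply Rle_trans; [apply ha|]. apply Rinv_le_contravar; lra. }
  assert (hq1 : / INR q <= 1) by (rewrite <- Rinv_1; apply Rinv_le_contravar; lra).
  assert (hqi : 0 < / INR q) by (apply Rinv_0_lt_compat; lra).
  assert (hls : ln s <= 0) by (rewrite <- ln_1; apply ln_le_compat; lra).
  set (a := Int_part (INR q * x)). pose proof (Int_part_bounds (INR q * x)) as hax. fold a in hax.
  set (f := fun j : nat => Z.to_nat ((a + Z.of_nat j * P) mod Z.of_nat q)).
  assert (hf : forall j, Z.of_nat (f j) = ((a + Z.of_nat j * P) mod Z.of_nat q)%Z /\ (f j < q)%nat).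
  { intros j. pose proof (Z.mod_pos_bound (a + Z.of_nat j * P) (Z.of_nat q)).
    unfold f. lia. }
  assert (Hperm : Permutation (map f (seq 0 q)) (seq 0 q)).
  { apply seq_perm_inj; [intros; apply hf|]. intros i j hi hj he.
    destruct (hf i) as [e1 _]. destruct (hf j) as [e2 _]. rewrite he, e2 in e1.
    assert (hdv : (Z.of_nat q | P * (Z.of_nat j - Z.of_nat i))%Z).
    { replace (P * (Z.of_nat j - Z.of_nat i))%Z
        with ((a + Z.of_nat j * P) - (a + Z.of_nat i * P))%Z by ring.
      apply Z.mod_divide; [lia|]. rewrite Zminus_mod, e1, Z.sub_diag. now rewrite Z.mod_0_l by lia. }
    apply Z.gauss in hdv; [|now rewrite Z.gcd_comm]. destruct hdv as [t ht].
    assert (t = 0)%Z by nia. nia. }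
  set (F := fun i => ln (msin ((INR i + 1/4) / INR q))).
  set (W := fun i : nat => / (1 + INR i) + / (1 + INR (q - 1 - i))).
  assert (Hterm : forall j, In j (seq 0 q) ->
    Rabs (ln (Rmax (msin (x + INR j * alpha)) s) - F (f j)) <= 32 * (1 + - ln s) * W (f j)).
  { intros j hj. apply in_seq in hj. destruct (hf j) as [e hlt].
    set (t := ((a + Z.of_nat j * P) / Z.of_nat q)%Z).
    assert (e' : (a + Z.of_nat j * P = Z.of_nat q * t + Z.of_nat (f j))%Z).
    { rewrite e. apply Z.div_mod. lia. }
    replace (msin (x + INR j * alpha)) with (msin (x + INR j * alpha + IZR (- t))) by apply msin_int.
    apply compare_grid; [easy|easy|].
    assert (e2 : IZR a + INR j * IZR P = INR q * IZR t + INR (f j)).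
    { rewrite !INR_IZR_INZ, <- !mult_IZR, <- !plus_IZR. now f_equal. }
    rewrite opp_IZR.
    replace (x + INR j * alpha + - IZR t - (INR (f j) + 1/4) / INR q)
      with ((INR q * x - IZR a - 1/4) * / INR q + INR j * (INR q * alpha - IZR P) * / INR q).
    2:{ replace (INR (f j)) with (IZR a + INR j * IZR P - INR q * IZR t) by lra. field. lra. }
    eapply Rle_trans; [apply Rabs_triang|]. rewrite !Rabs_mult, (Rabs_right (/ INR q)) by lra.
    assert (hj0 : Rabs (INR j) <= INR q).
    { rewrite Rabs_right by (apply Rle_ge, pos_INR). apply le_INR. lia. }
    assert (Rabs (INR q * x - IZR a - 1/4) <= 1) by (apply Rabs_le; lra).
    assert (Rabs (INR j) * Rabs (INR q * alpha - IZR P) <= INR q * / INR q).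
    { apply Rmult_le_compat; try apply Rabs_pos; easy. }
    rewrite Rinv_r in * by lra. unfold Rdiv. rewrite <- Rmult_plus_distr_r.
    apply Rmult_le_compat_r; lra. }
  assert (HF : Rabs (sumL F (seq 0 q)) <= 1).
  { assert (h : sumL (fun i => 2 * F i) (seq 0 q) = ln 2).
    { transitivity (ln (prodL (fun i => (msin ((INR i + 1/4) / INR q))^2) (seq 0 q)));
        [|now rewrite prod_msin_grid by lia].
      rewrite ln_prodL.
      - apply sumL_ext. intros i hi. unfold F.
        assert (0 < msin ((INR i + 1/4) / INR q)).
        { apply in_seq in hi. pose proof (pos_INR i).
          assert (INR i <= INR q - 1). { replace (INR q - 1) with (INR (q - 1)) by (rewrite minus_INR by lia; easy). apply le_INR. lia. }
          eapply Rlt_le_trans; [|apply msin_lower].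
          - assert (0 < (INR i + 1/4) / INR q) by (apply Rdiv_lt_0_compat; lra).
            assert (0 < 1 - (INR i + 1/4) / INR q).
            { replace (1 - (INR i + 1/4) / INR q) with ((INR q - INR i - 1/4) / INR q) by (field; lra).
              apply Rdiv_lt_0_compat; lra. }
            apply Rmult_lt_0_compat; [lra|]. now apply Rmin_glb_lt.
          - split; [apply Rdiv_le_0_compat; lra|].
            apply (Rmult_le_reg_r (INR q)); [lra|]. unfold Rdiv. rewrite Rmult_assoc, Rinv_l; lra. }
        rewrite ln_pow by easy. simpl INR. ring.
      - intros i hi. apply pow_lt.
        assert (hne : 0 <= msin ((INR i + 1/4) / INR q)) by apply msin_nonneg.
        destruct hne as [hne|hne]; [easy|]. symmetry in hne. apply msin_eq0 in hne.
        destruct hne as [k hk]. exfalso.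
        assert (e : INR i + 1/4 = IZR k * INR q) by (rewrite <- hk; field; lra).
        assert (e' : 4 * INR i + 1 = 4 * (IZR k * INR q)) by lra.
        rewrite !INR_IZR_INZ, <- !mult_IZR, <- plus_IZR in e'. apply eq_IZR in e'. lia. }
    rewrite sumL_scal in h. pose proof ln2_le1. pose proof (ln_lt_2). apply Rabs_le. lra. }
  assert (HW : sumL W (seq 0 q) <= 4 * sqrt (INR q)).
  { unfold W. rewrite sumL_plus. pose proof (harmonic_sqrt q) as h.
    assert (e : sumL (fun i => / (1 + INR (q - 1 - i))) (seq 0 q) = sumL (fun i => / (1 + INR i)) (seq 0 q)).
    { rewrite <- (sumL_map (fun i => (q - 1 - i)%nat) (fun i => / (1 + INR i))).
      apply sumL_perm, seq_perm_inj; intros; lia. }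
    rewrite e. lra. }
  assert (Hperm2 : forall G : nat -> R, sumL (fun j => G (f j)) (seq 0 q) = sumL G (seq 0 q)).
  { intros G. rewrite <- sumL_map. now apply sumL_perm. }
  unfold trsum.
  rewrite (sumL_ext _ (fun j => (ln (Rmax (msin (x + INR j * alpha)) s) - F (f j)) + F (f j))) by (intros; ring).
  rewrite sumL_plus, Hperm2. eapply Rle_trans; [apply Rabs_triang|].
  assert (hmain : Rabs (sumL (fun j => ln (Rmax (msin (x + INR j * alpha)) s) - F (f j)) (seq 0 q))
    <= 32 * (1 + - ln s) * (4 * sqrt (INR q))).
  { eapply Rle_trans; [apply sumL_abs|]. eapply Rle_trans; [apply sumL_le, Hterm|].
    rewrite (Hperm2 (fun i => 32 * (1 + - ln s) * W i)), sumL_scal.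
    apply Rmult_le_compat_l; [lra|easy]. }
  (* [129 = 32 * 4 + 1]: the comparison weights and the grid sum. *)
  assert (1 <= sqrt (INR q)) by (rewrite <- sqrt_1; apply sqrt_le_1_alt; lra).
  nra.
Qed.

Lemma trsum_crude s x m : 0 < s <= 1 -> Rabs (trsum s x m) <= INR m * (1 + - ln s).
Proof.
  intros hs. eapply Rle_trans; [apply sumL_abs|].
  rewrite <- (length_seq m 0) at 2. apply sumL_le_const. intros j _.
  apply ln_trunc_bound; [easy|apply msin_le2].
Qed.

Lemma trsum_blocks (q Q b : nat) (P : Z) s x : (1 <= q <= Q)%nat -> Z.gcd P (Z.of_nat q) = 1%Z ->
  Rabs (INR q * alpha - IZR P) <= / INR Q -> 0 < s <= / INR q ->
  Rabs (trsum s x (b * q)) <= INR b * (129 * (1 + - ln s) * sqrt (INR q)).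
Proof.
  intros hq hg ha hs. revert x. induction b as [|b IH]; intros x.
  - simpl. unfold trsum; simpl. rewrite Rabs_R0. lra.
  - replace (S b * q)%nat with (q + b * q)%nat by lia. rewrite trsum_add, S_INR.
    eapply Rle_trans; [apply Rabs_triang|].
    pose proof (trsum_block q Q P s x hq hg ha hs). pose proof (IH (x + INR q * alpha)). lra.
Qed.

End LogSine.

Lemma linear_le_exp A a e : 0 <= A -> 0 < a -> 0 < e ->
  exists Y, forall y, Y <= y -> 1 + A * y <= e * exp (a * y).
Proof.
  intros hA ha he. exists (4 * (1 + A) / (e * a * a) + 1). intros y hy.
  assert (h0 : 0 <= 4 * (1 + A) / (e * a * a)).
  { apply Rdiv_le_0_compat; [lra|]. repeat apply Rmult_lt_0_compat; easy. }
  assert (h1 : 4 * (1 + A) <= e * a * a * y).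
  { apply Rle_trans with (e * a * a * (4 * (1 + A) / (e * a * a))).
    - right. field. lra.
    - apply Rmult_le_compat_l; [|lra]. repeat apply Rmult_le_pos; lra. }
  pose proof (exp_ineq1_le (a * y / 2)) as h2.
  assert (h3 : exp (a * y) = exp (a * y / 2) * exp (a * y / 2)) by (rewrite <- exp_plus; f_equal; lra).
  assert (0 <= a * y / 2) by nra.
  assert (h4 : a * y / 2 * (a * y / 2) <= exp (a * y)) by (rewrite h3; apply Rmult_le_compat; lra).
  apply Rle_trans with (e * (a * y / 2 * (a * y / 2))); [|apply Rmult_le_compat_l; lra].
  apply Rle_trans with ((1 + A) * y); [nra|].
  replace (e * (a * y / 2 * (a * y / 2))) with (e * a * a * y / 4 * y) by field.
  apply Rmult_le_compat_r; lra.
Qed.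

(** The bound [n ^ (- p)], written as an exponential and stated for all nonzero [|k| <= n] at
    once. *)
Definition dioph_exp (alpha p : R) : Prop :=
  forall (n : nat) (k : Z), (2 <= n)%nat -> k <> 0%Z -> (Z.abs k <= Z.of_nat n)%Z ->
    exp (- p * ln (INR n)) <= msin (IZR k * alpha).

(** The constant [tau] is absorbed into the exponent, since [c ln n >= |ln (2 tau)|] for [n >= 2];
    the extra 1 ensures [p >= 1]. *)
Lemma diophantine_exp alpha : diophantine alpha -> exists p, 1 <= p /\ dioph_exp alpha p.
Proof.
  intros [ka [tau [hka [htau H]]]].
  pose proof ln_lt_2. set (c := Rabs (ln (2 * tau)) / ln 2).
  assert (hc : 0 <= c) by (apply Rdiv_le_0_compat; [apply Rabs_pos|lra]).
  exists (ka + 1 + c). split; [lra|]. intros n k hn hk hkn.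
  assert (hn2 : 2 <= INR n) by (apply (le_INR 2); lia).
  assert (hln : ln 2 <= ln (INR n)) by (apply ln_le_compat; lra).
  apply Rle_trans with (2 * (tau / Rpower (IZR (Z.abs k)) ka)).
  - assert (hk1 : 1 <= IZR (Z.abs k)) by (apply IZR_le; lia).
    assert (hk2 : IZR (Z.abs k) <= INR n) by (rewrite INR_IZR_INZ; apply IZR_le; lia).
    apply Rle_trans with (exp (ln (2 * tau) - ka * ln (INR n))).
    + apply exp_mono. assert (e : c * ln 2 = Rabs (ln (2 * tau))) by (unfold c; field; lra).
      pose proof (Rle_abs (- ln (2 * tau))) as h. rewrite Rabs_Ropp in h. nra.
    + unfold Rminus. rewrite exp_plus, exp_ln by lra. unfold Rdiv, Rpower.
      rewrite <- exp_Ropp. rewrite Rmult_assoc. apply Rmult_le_compat_l; [lra|].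
      apply Rmult_le_compat_l; [lra|]. apply exp_mono.
      assert (ln (IZR (Z.abs k)) <= ln (INR n)) by (apply ln_le_compat; lra). nra.
  - eapply Rle_trans; [|apply msin_distZ]. apply Rmult_le_compat_l; [lra|]. now apply Rge_le, H.
Qed.

(** The orbit is cut into blocks of length [q], a Dirichlet denominator below [sqrt n]. A block
    costs a multiple of [ln n * sqrt q], which is small against [q] because [q] is at least a power
    of [n]. The incomplete block has fewer than [sqrt n] factors, each with logarithm of order
    [ln n]. *)
Lemma sine_product_bounds alpha p eps : dioph_exp alpha p -> 1 <= p -> 0 < eps ->
  exists N : nat, forall (n m : nat) (x : R), (N <= n)%nat -> (m <= n)%nat ->
    exp (- eps * INR n) <=
      prodL (fun j => Rmax (msin (x + INR j * alpha)) (exp (- p * ln (INR n)))) (seq 0 m)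
      <= exp (eps * INR n).
Proof.
  intros hd hp heps.
  (* [258 = 2 * 129]: the full blocks get half of [eps]. The exponent [1 / (4 p)] is the power of
     [n] below [sqrt q]; the other half of [eps] pays for the incomplete block. *)
  destruct (linear_le_exp p (/ (4 * p)) (eps / 258 / (2 * exp (ln 32 / (2 * p))))) as [Y1 hY1];
    [lra|apply Rinv_0_lt_compat; lra| |].
  { assert (0 < exp (ln 32 / (2 * p))) by apply exp_pos. repeat apply Rdiv_lt_0_compat; lra. }
  destruct (linear_le_exp p (1/2) (eps / 2)) as [Y2 hY2]; [lra|lra|lra|].
  destruct (INR_unbounded (exp (Rmax Y1 Y2))) as [N0 hN0].
  exists (N0 + 4)%nat. intros n m x hn hm.
  assert (hn4 : 4 <= INR n) by (replace 4 with (INR 4) by (simpl; lra); apply le_INR; lia).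
  assert (hnY : exp (Rmax Y1 Y2) <= INR n).
  { apply Rle_trans with (INR N0); [lra|]. apply le_INR. lia. }
  assert (hlnY : Rmax Y1 Y2 <= ln (INR n)).
  { rewrite <- (ln_exp (Rmax Y1 Y2)). apply ln_le_compat; [apply exp_pos|easy]. }
  specialize (hY1 (ln (INR n))). specialize (hY2 (ln (INR n))).
  pose proof (Rmax_l Y1 Y2). pose proof (Rmax_r Y1 Y2).
  assert (h1 := hY1 ltac:(lra)). assert (h2 := hY2 ltac:(lra)). clear hY1 hY2.
  set (s := exp (- p * ln (INR n))).
  assert (hlns : ln s = - p * ln (INR n)) by (unfold s; apply ln_exp).
  assert (hs0 : 0 < s) by apply exp_pos.
  assert (hln0 : 0 <= ln (INR n)) by (rewrite <- ln_1; apply ln_le_compat; lra).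
  set (Q := Nat.sqrt n). destruct (Nat.sqrt_spec n) as [hQ1 hQ2]; [lia|]. fold Q in hQ1, hQ2.
  assert (hQ0 : (1 <= Q)%nat) by nia.
  destruct (dirichlet alpha Q hQ0) as [q [P [hq [hg ha]]]].
  assert (hqr : 1 <= INR q) by (apply (le_INR 1); lia).
  assert (hQR : INR Q * INR Q <= INR n) by (rewrite <- mult_INR; now apply le_INR).
  assert (hQR2 : INR n <= (INR Q + 1) * (INR Q + 1)).
  { rewrite <- S_INR, <- mult_INR. apply le_INR. lia. }
  assert (hqQ : INR q <= INR Q) by (apply le_INR; lia).
  assert (hsq : s <= / INR q).
  { apply Rle_trans with (/ INR n); [|apply Rinv_le_contravar; nra].
    unfold s. rewrite <- (exp_ln (INR n)) at 2 by lra. rewrite <- exp_Ropp. apply exp_mono. nra. }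
  set (rt := exp (1/2 * ln (INR n))).
  assert (hrt : rt * rt = INR n).
  { unfold rt. rewrite <- exp_plus. rewrite <- (exp_ln (INR n)) at 3 by lra. f_equal. lra. }
  assert (hrt0 : 0 < rt) by apply exp_pos.
  assert (hQrt : INR Q <= rt) by nra.
  assert (hrtQ : rt <= 2 * INR Q) by nra.
  (* the Diophantine condition forces the denominator [q] to be at least a power of [n] *)
  assert (hqbig : exp ((1/2 * ln (INR n) - ln 16) / p) <= INR q + 1).
  { assert (hm1 : exp (- p * ln (INR (q + 1))) <= msin (IZR (Z.of_nat q) * alpha)) by (apply hd; lia).
    assert (hm2 : msin (IZR (Z.of_nat q) * alpha) <= 8 / INR Q).
    { rewrite <- (msin_int _ (- P)), opp_IZR, <- INR_IZR_INZ.
      eapply Rle_trans; [apply msin_lip0|]. pose proof PI_4. pose proof PI_RGT_0.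
      assert (0 <= Rabs (INR q * alpha + - IZR P)) by apply Rabs_pos.
      unfold Rminus in ha. unfold Rdiv. nra. }
    rewrite plus_INR in hm1. simpl (INR 1) in hm1.
    assert (h3 : / (8 / INR Q) <= exp (p * ln (INR q + 1))).
    { replace (p * ln (INR q + 1)) with (- (- p * ln (INR q + 1))) by ring.
      rewrite exp_Ropp. apply Rinv_le_contravar; [apply exp_pos|lra]. }
    assert (h4 : rt / 16 <= exp (p * ln (INR q + 1))).
    { eapply Rle_trans; [|apply h3]. replace (/ (8 / INR Q)) with (INR Q / 8) by (field; lra). lra. }
    rewrite <- (exp_ln (INR q + 1)) by lra. apply exp_mono.
    apply (Rmult_le_reg_r p); [lra|]. unfold Rdiv at 1. rewrite Rmult_assoc, Rinv_l by lra.
    assert (h5 : ln (rt / 16) <= p * ln (INR q + 1)).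
    { rewrite <- (ln_exp (p * ln (INR q + 1))). apply ln_le_compat; lra. }
    rewrite ln_div in h5 by lra. unfold rt in h5. rewrite ln_exp in h5. lra. }
  set (La := 1 + - ln s).
  assert (hLa : La = 1 + p * ln (INR n)) by (unfold La; rewrite hlns; ring).
  assert (hLa1 : 1 <= La) by nra.
  assert (hsqrt : La <= eps / 258 * sqrt (INR q)).
  { rewrite hLa. eapply Rle_trans; [apply h1|].
    set (E32 := exp (ln 32 / (2 * p))). assert (0 < E32) by apply exp_pos.
    unfold Rdiv at 1. rewrite (Rmult_assoc (eps / 258)). apply Rmult_le_compat_l; [lra|].
    apply (Rmult_le_reg_l (2 * E32)); [lra|]. rewrite <- Rmult_assoc, Rinv_r, Rmult_1_l by lra.
    assert (hs2 : sqrt (INR q) * sqrt (INR q) = INR q) by (apply sqrt_sqrt; lra).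
    assert (hs1 : 1 <= sqrt (INR q)) by (rewrite <- sqrt_1; apply sqrt_le_1_alt; lra).
    set (v := exp (/ (4 * p) * ln (INR n))).
    assert (hv : 0 < v) by apply exp_pos.
    assert (hv2 : v * v = exp ((1/2 * ln (INR n) - ln 16) / p) * exp (ln 16 / p)).
    { unfold v. rewrite <- !exp_plus. f_equal. field. lra. }
    assert (hE : E32 * E32 = exp (ln 32 / p)).
    { unfold E32. rewrite <- exp_plus. f_equal. field. lra. }
    assert (hE2 : exp (ln 16 / p) <= E32 * E32).
    { rewrite hE. apply exp_mono. unfold Rdiv. apply Rmult_le_compat_r; [left; apply Rinv_0_lt_compat; lra|].
      apply ln_le_compat; lra. }
    assert (hvv : v * v <= (INR q + 1) * (E32 * E32)).
    { rewrite hv2. apply Rmult_le_compat; try (left; apply exp_pos); easy. }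
    assert (v * v <= (2 * E32 * sqrt (INR q)) * (2 * E32 * sqrt (INR q))).
    { replace ((2 * E32 * sqrt (INR q)) * (2 * E32 * sqrt (INR q)))
        with (4 * (E32 * E32) * (sqrt (INR q) * sqrt (INR q))) by ring. rewrite hs2. nra. }
    apply Rsqr_incr_0_var; [unfold Rsqr; easy|]. repeat apply Rmult_le_pos; lra. }
  assert (Hsum : forall x0, Rabs (trsum alpha s x0 m) <= eps * INR n).
  { intros x0.
    assert (em : (m = (m / q) * q + m mod q)%nat) by (rewrite (Nat.div_mod_eq m q) at 1; lia).
    pose proof (Nat.mod_upper_bound m q ltac:(lia)) as hr.
    set (b := (m / q)%nat) in *. set (r := (m mod q)%nat) in *.
    rewrite em, trsum_add. eapply Rle_trans; [apply Rabs_triang|].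
    pose proof (trsum_blocks alpha q Q b P s x0 hq hg ha ltac:(lra)) as hb.
    pose proof (trsum_crude alpha s (x0 + INR (b * q) * alpha) r) as hc.
    assert (hs1 : s <= 1).
    { apply Rle_trans with (/ INR q); [easy|]. rewrite <- Rinv_1. apply Rinv_le_contravar; lra. }
    specialize (hc ltac:(lra)). fold La in hb, hc.
    assert (hs2 : sqrt (INR q) * sqrt (INR q) = INR q) by (apply sqrt_sqrt; lra).
    assert (hbq : INR b * INR q <= INR n) by (rewrite <- mult_INR; apply le_INR; lia).
    assert (hb' : INR b * (129 * La * sqrt (INR q)) <= eps / 2 * INR n).
    { apply Rle_trans with (INR b * (129 * (eps / 258 * sqrt (INR q)) * sqrt (INR q))).
      - apply Rmult_le_compat_l; [apply pos_INR|]. apply Rmult_le_compat_r; [apply sqrt_pos|]. lra.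
      - replace (INR b * (129 * (eps / 258 * sqrt (INR q)) * sqrt (INR q)))
          with (eps / 2 * (INR b * (sqrt (INR q) * sqrt (INR q)))) by field.
        rewrite hs2. apply Rmult_le_compat_l; lra. }
    assert (hr' : INR r * La <= eps / 2 * INR n).
    { assert (INR r <= rt) by (apply Rle_trans with (INR q); [apply le_INR; lia|lra]).
      rewrite <- hrt. apply Rle_trans with (rt * (eps / 2 * rt)); [|right; ring].
      apply Rmult_le_compat; [apply pos_INR|lra|easy|]. rewrite hLa. fold rt in h2. lra. }
    lra. }
  specialize (Hsum x). apply Rabs_le_between in Hsum.
  assert (Hpos : forall j : nat, In j (seq 0 m) -> 0 < Rmax (msin (x + INR j * alpha)) s).
  { intros j _. eapply Rlt_le_trans; [apply hs0|apply Rmax_r]. }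
  assert (Hln := ln_prodL _ _ Hpos). pose proof (prodL_pos _ _ Hpos).
  rewrite <- (exp_ln (prodL _ _)) by easy. rewrite Hln. unfold trsum in Hsum.
  split; apply exp_mono; lra.
Qed.

(** * Determinants of finite boxes *)

Section Boxes.

Variables (lambda alpha E : R).

Definition pot (th : R) : R := 2 * lambda * cos (2 * PI * th) - E.

(* Determinant of [H - E] restricted to [k] consecutive sites, the first one having phase [th]. *)
Fixpoint boxdet (th : R) (k : nat) : R :=
  match k with
  | O => 1
  | S k' => pot (th + INR k' * alpha) * boxdet th k'
            - match k' with O => 0 | S k'' => boxdet th k'' end
  end.

Lemma boxdet_SS th k : boxdet th (S (S k)) = pot (th + INR (S k) * alpha) * boxdet th (S k) - boxdet th k.
Proof. reflexivity. Qed.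

Lemma boxdet_1 th : boxdet th 1 = pot th.
Proof. simpl. rewrite Rmult_0_l, Rplus_0_r. ring. Qed.

Lemma two_step (P : nat -> Prop) : P O -> P 1%nat -> (forall n, P n -> P (S n) -> P (S (S n))) -> forall n, P n.
Proof.
  intros h0 h1 h n. assert (P n /\ P (S n)); [|easy].
  induction n as [|n [IH1 IH2]]; split; auto.
Qed.

(** A tridiagonal determinant cut at one bond: the product of the two blocks, minus the product of
    the blocks deprived of the sites next to the bond. *)
Lemma boxdet_split th m n :
  boxdet th (S m + S n) = boxdet th (S m) * boxdet (th + INR (S m) * alpha) (S n)
                     - boxdet th m * boxdet (th + INR (S (S m)) * alpha) n.
Proof.
  induction n as [| |n IH1 IH2] using two_step.
  - replace (S m + 1)%nat with (S (S m)) by lia. rewrite boxdet_SS, boxdet_1. simpl (boxdet _ 0). ring.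
  - replace (S m + 2)%nat with (S (S (S m))) by lia. rewrite (boxdet_SS _ (S m)), (boxdet_SS _ m), (boxdet_SS _ 0), !boxdet_1.
    simpl (boxdet _ 0). replace (th + INR (S m) * alpha + INR 1 * alpha) with (th + INR (S (S m)) * alpha)
      by (rewrite (S_INR (S m)); simpl (INR 1); ring). ring.
  - replace (S m + S (S (S n)))%nat with (S (S (S m + S n))) by lia. rewrite boxdet_SS.
    replace (S (S m + S n)) with (S m + S (S n))%nat by lia. rewrite IH1, IH2.
    rewrite (boxdet_SS _ (S n)), (boxdet_SS (th + INR (S (S m)) * alpha) n).
    replace (th + INR (S m) * alpha + INR (S (S n)) * alpha) with (th + INR (S m + S (S n)) * alpha)
      by (rewrite plus_INR; ring).
    replace (th + INR (S (S m)) * alpha + INR (S n) * alpha) with (th + INR (S m + S (S n)) * alpha)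
      by (rewrite plus_INR, !S_INR; ring).
    ring.
Qed.

Lemma boxdet_left th n : boxdet th (S (S n)) = pot th * boxdet (th + alpha) (S n) - boxdet (th + 2 * alpha) n.
Proof.
  pose proof (boxdet_split th 0 n) as h. change (1 + S n)%nat with (S (S n)) in h. rewrite h, boxdet_1.
  change (boxdet th 0) with 1. simpl (INR 1). replace (INR 2) with 2 by (simpl; lra).
  rewrite Rmult_1_l. ring.
Qed.

Lemma pot_even th : pot (- th) = pot th.
Proof.
  unfold pot. replace (2 * PI * - th) with (- (2 * PI * th)) by ring. now rewrite cos_neg.
Qed.

(** The potential is even in the phase, so reversing the order of the sites gives the box that
    starts at the opposite of the last phase. *)
Lemma boxdet_reflect k th : boxdet (- th - INR k * alpha) (S k) = boxdet th (S k).
Proof.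
  revert th. induction k as [| |k IH1 IH2] using two_step; intros th.
  - rewrite !boxdet_1. simpl. rewrite <- pot_even. f_equal. ring.
  - rewrite boxdet_left, (boxdet_SS th), !boxdet_1. simpl (boxdet _ 0). simpl (INR 1).
    rewrite <- (pot_even (th + _)), <- (pot_even th).
    replace (- th - 1 * alpha) with (- (th + 1 * alpha)) by ring.
    replace (- (th + 1 * alpha) + alpha) with (- th) by ring. ring.
  - rewrite boxdet_left, (boxdet_SS th).
    rewrite <- (IH2 th), <- (IH1 th).
    replace (- th - INR (S (S k)) * alpha + alpha) with (- th - INR (S k) * alpha)
      by (rewrite !S_INR; ring).
    replace (- th - INR (S (S k)) * alpha + 2 * alpha) with (- th - INR k * alpha)
      by (rewrite !S_INR; ring).
    rewrite <- (pot_even (th + _)). f_equal. f_equal. f_equal. ring.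
Qed.

Lemma boxdet_reflect' k th : boxdet (- th - (INR k - 1) * alpha) k = boxdet th k.
Proof.
  destruct k as [|k]; [easy|]. rewrite <- (boxdet_reflect k th). f_equal. rewrite S_INR. ring.
Qed.

(** The value of [(H - E) psi] at [j], the energy being part of [pot]. It vanishes for exact states
    and is small for those of an approximant. *)
Definition resid (th : R) (psi : Z -> R) (j : Z) : R :=
  psi (j + 1)%Z + psi (j - 1)%Z + pot (th + IZR j * alpha) * psi j.

(** The combination on the left changes sign when [i] increases and picks up one residual times one
    determinant; at [i = 0] it is [- psi (a - 1)] up to the residual. *)
Lemma green_left th psi f0 a i :
  (forall j, (a <= j <= a + Z.of_nat i)%Z -> Rabs (resid th psi j) <= f0) ->
  Rabs (boxdet (th + IZR a * alpha) (S i) * psi (a + Z.of_nat i)%Z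
        + boxdet (th + IZR a * alpha) i * psi (a + Z.of_nat i + 1)%Z)
  <= Rabs (psi (a - 1)%Z) + f0 * sumL (fun j => Rabs (boxdet (th + IZR a * alpha) j)) (seq 0 (S i)).
Proof.
  induction i as [|i IH]; intros H.
  - specialize (H a ltac:(lia)). unfold resid in H.
    rewrite boxdet_1. simpl (Z.of_nat 0). rewrite Z.add_0_r. simpl. rewrite Rabs_R1.
    set (r := psi (a + 1)%Z + psi (a - 1)%Z + pot (th + IZR a * alpha) * psi a) in *.
    replace (pot (th + IZR a * alpha) * psi a + 1 * psi (a + 1)%Z) with (r - psi (a - 1)%Z)
      by (unfold r; ring).
    unfold Rminus. eapply Rle_trans; [apply Rabs_triang|]. rewrite Rabs_Ropp. lra.
  - assert (IH' := IH ltac:(intros; apply H; lia)). clear IH.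
    specialize (H (a + Z.of_nat (S i))%Z ltac:(lia)).
    rewrite seq_S, sumL_app, sumL_one, Nat.add_0_l.
    set (t := th + IZR a * alpha) in *.
    rewrite boxdet_SS.
    set (X := boxdet t (S i) * psi (a + Z.of_nat i)%Z + boxdet t i * psi (a + Z.of_nat i + 1)%Z) in *.
    set (r := resid th psi (a + Z.of_nat (S i))) in *.
    replace ((pot (t + INR (S i) * alpha) * boxdet t (S i) - boxdet t i) * psi (a + Z.of_nat (S i))%Z
             + boxdet t (S i) * psi (a + Z.of_nat (S i) + 1)%Z) with (- X + boxdet t (S i) * r).
    + eapply Rle_trans; [apply Rabs_triang|]. rewrite Rabs_Ropp, Rabs_mult.
      pose proof (Rabs_pos (boxdet t (S i))). nra.
    + unfold X, r, resid, t.
      replace (a + Z.of_nat (S i) - 1)%Z with (a + Z.of_nat i)%Z by lia.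
      replace (a + Z.of_nat i + 1)%Z with (a + Z.of_nat (S i))%Z by lia.
      replace (th + IZR (a + Z.of_nat (S i)) * alpha) with (th + IZR a * alpha + INR (S i) * alpha)
        by (rewrite plus_IZR, <- INR_IZR_INZ; ring).
      ring.
Qed.

Lemma resid_opp th psi j : resid (- th) (fun i => psi (- i)%Z) j = resid th psi (- j)%Z.
Proof.
  unfold resid. replace (- th + IZR j * alpha) with (- (th + IZR (- j) * alpha)) by (rewrite opp_IZR; ring).
  rewrite pot_even.
  replace (- (j + 1))%Z with (- j - 1)%Z by lia. replace (- (j - 1))%Z with (- j + 1)%Z by lia. ring.
Qed.

Lemma green_right th psi f0 b m :
  (forall j, (b - Z.of_nat m <= j <= b)%Z -> Rabs (resid th psi j) <= f0) ->
  Rabs (boxdet (th + IZR (b - Z.of_nat m) * alpha) (S m) * psi (b - Z.of_nat m)%Z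
        + boxdet (th + IZR (b - Z.of_nat m + 1) * alpha) m * psi (b - Z.of_nat m - 1)%Z)
  <= Rabs (psi (b + 1)%Z)
     + f0 * sumL (fun j => Rabs (boxdet (th + IZR (b + 1 - Z.of_nat j) * alpha) j)) (seq 0 (S m)).
Proof.
  intros H.
  assert (e : forall j, boxdet (- th + IZR (- b) * alpha) j = boxdet (th + IZR (b + 1 - Z.of_nat j) * alpha) j).
  { intros j. rewrite <- (boxdet_reflect' j (th + _)). f_equal.
    rewrite !minus_IZR, plus_IZR, opp_IZR, <- INR_IZR_INZ. ring. }
  pose proof (green_left (- th) (fun i => psi (- i)%Z) f0 (- b) m) as h.
  rewrite (sumL_ext _ (fun j => Rabs (boxdet (th + IZR (b + 1 - Z.of_nat j) * alpha) j))) in h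
    by (intros; now rewrite e).
  rewrite !e in h.
  replace (- (- b - 1))%Z with (b + 1)%Z in h by lia.
  replace (- (- b + Z.of_nat m))%Z with (b - Z.of_nat m)%Z in h by lia.
  replace (- (- b + Z.of_nat m + 1))%Z with (b - Z.of_nat m - 1)%Z in h by lia.
  replace (b + 1 - Z.of_nat (S m))%Z with (b - Z.of_nat m)%Z in h by lia.
  replace (b + 1 - Z.of_nat m)%Z with (b - Z.of_nat m + 1)%Z in h by lia.
  apply h. intros j hj. rewrite resid_opp. apply H. lia.
Qed.

(** Eliminating [psi (a + i + 1)] between the recursions from the two ends leaves, by
    [boxdet_split], the determinant of the whole box. This is the Green function formula with its
    denominator cleared, so it also holds for a singular box, and it keeps track of a residual. *)
Lemma green th psi f0 a i m :
  (forall j, (a <= j <= a + Z.of_nat (i + m))%Z -> Rabs (resid th psi j) <= f0) ->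
  Rabs (boxdet (th + IZR a * alpha) (S (i + m))) * Rabs (psi (a + Z.of_nat i)%Z)
  <= Rabs (boxdet (th + IZR (a + Z.of_nat i + 1) * alpha) m) *
       (Rabs (psi (a - 1)%Z) + f0 * sumL (fun j => Rabs (boxdet (th + IZR a * alpha) j)) (seq 0 (S i)))
     + Rabs (boxdet (th + IZR a * alpha) i) *
       (Rabs (psi (a + Z.of_nat (i + m) + 1)%Z)
        + f0 * sumL (fun j => Rabs (boxdet (th + IZR (a + Z.of_nat (i + m) + 1 - Z.of_nat j) * alpha) j)) (seq 0 m)).
Proof.
  intros H. pose proof (green_left th psi f0 a i ltac:(intros; apply H; lia)) as hl.
  set (t := th + IZR a * alpha) in *.
  destruct m as [|m].
  - rewrite Nat.add_0_r in *. change (boxdet (th + IZR (a + Z.of_nat i + 1) * alpha) 0) with 1.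
    rewrite Rabs_R1. change (seq 0 0) with (@nil nat). unfold sumL at 2. cbn [fold_right].
    rewrite Rmult_0_r, Rplus_0_r, Rmult_1_l, <- !Rabs_mult.
    set (X := boxdet t (S i) * psi (a + Z.of_nat i)%Z + boxdet t i * psi (a + Z.of_nat i + 1)%Z) in *.
    replace (boxdet t (S i) * psi (a + Z.of_nat i)%Z) with (X - boxdet t i * psi (a + Z.of_nat i + 1)%Z)
      by (unfold X; ring).
    unfold Rminus. eapply Rle_trans; [apply Rabs_triang|]. rewrite Rabs_Ropp. lra.
  - set (b := (a + Z.of_nat (i + S m))%Z) in *.
    pose proof (green_right th psi f0 b m ltac:(intros; apply H; lia)) as hr.
    replace (b - Z.of_nat m)%Z with (a + Z.of_nat i + 1)%Z in hr by lia.
    replace (a + Z.of_nat i + 1 - 1)%Z with (a + Z.of_nat i)%Z in hr by lia.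
    set (X := boxdet t (S i) * psi (a + Z.of_nat i)%Z + boxdet t i * psi (a + Z.of_nat i + 1)%Z) in *.
    set (Y := boxdet (th + IZR (a + Z.of_nat i + 1) * alpha) (S m) * psi (a + Z.of_nat i + 1)%Z
        + boxdet (th + IZR (a + Z.of_nat i + 1 + 1) * alpha) m * psi (a + Z.of_nat i)%Z) in *.
    rewrite <- Rabs_mult.
    replace (boxdet t (S (i + S m)) * psi (a + Z.of_nat i)%Z)
      with (boxdet (th + IZR (a + Z.of_nat i + 1) * alpha) (S m) * X - boxdet t i * Y).
    + unfold Rminus. eapply Rle_trans; [apply Rabs_triang|]. rewrite Rabs_Ropp, !Rabs_mult.
      apply Rplus_le_compat; apply Rmult_le_compat_l; try apply Rabs_pos; easy.
    + replace (S (i + S m)) with (S i + S m)%nat by lia. rewrite boxdet_split.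
      unfold X, Y, t.
      replace (th + IZR a * alpha + INR (S i) * alpha) with (th + IZR (a + Z.of_nat i + 1) * alpha)
        by (rewrite !plus_IZR, <- INR_IZR_INZ, S_INR; ring).
      replace (th + IZR a * alpha + INR (S (S i)) * alpha) with (th + IZR (a + Z.of_nat i + 1 + 1) * alpha)
        by (rewrite !plus_IZR, <- INR_IZR_INZ, !S_INR; ring).
      ring.
Qed.

(* Writing [c = cos (2 pi phi)] and [s = sin (2 pi phi)], the determinant at phase [phi + beta] is
   [A + s * B] with polynomials [A], [B] in [c]; the relation [s^2 = 1 - c^2] keeps this form. *)
Fixpoint AB (beta : R) (k : nat) (x : R) : R * R :=
  match k with
  | O => (1, 0)
  | S k' =>
    let a := 2 * PI * (beta + INR k' * alpha) in
    let (A, B) := AB beta k' x in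
    let (A', B') := match k' with O => (0, 0) | S k'' => AB beta k'' x end in
    ((2 * lambda * cos a * x - E) * A - 2 * lambda * sin a * (1 - x * x) * B - A',
     (2 * lambda * cos a * x - E) * B - 2 * lambda * sin a * A - B')
  end.

Lemma AB_SS beta k x :
  let a := 2 * PI * (beta + INR (S k) * alpha) in
  AB beta (S (S k)) x =
    ((2 * lambda * cos a * x - E) * fst (AB beta (S k) x)
       - 2 * lambda * sin a * (1 - x * x) * snd (AB beta (S k) x) - fst (AB beta k x),
     (2 * lambda * cos a * x - E) * snd (AB beta (S k) x)
       - 2 * lambda * sin a * fst (AB beta (S k) x) - snd (AB beta k x)).
Proof.
  intros a. change (AB beta (S (S k)) x) with
   (let (A, B) := AB beta (S k) x in
    let (A', B') := AB beta k x in
    ((2 * lambda * cos a * x - E) * A - 2 * lambda * sin a * (1 - x * x) * B - A',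
     (2 * lambda * cos a * x - E) * B - 2 * lambda * sin a * A - B')).
  destruct (AB beta (S k) x), (AB beta k x). easy.
Qed.

Lemma AB_1 beta x : AB beta 1 x =
  (2 * lambda * cos (2 * PI * beta) * x - E, - 2 * lambda * sin (2 * PI * beta)).
Proof. simpl. rewrite Rmult_0_l, Rplus_0_r. f_equal; ring. Qed.

Lemma pot_expand phi b :
  pot (phi + b) = 2 * lambda * (cos (2 * PI * b) * cos (2 * PI * phi) - sin (2 * PI * b) * sin (2 * PI * phi)) - E.
Proof. unfold pot. rewrite Rmult_plus_distr_l, cos_plus. ring. Qed.

Lemma boxdet_AB beta k phi :
  boxdet (phi + beta) k = fst (AB beta k (cos (2 * PI * phi)))
                     + sin (2 * PI * phi) * snd (AB beta k (cos (2 * PI * phi))).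
Proof.
  induction k as [| |k IH1 IH2] using two_step.
  - simpl. ring.
  - rewrite boxdet_1, AB_1, pot_expand. simpl. ring.
  - rewrite boxdet_SS, AB_SS, IH1, IH2. cbn [fst snd].
    rewrite Rplus_assoc, pot_expand.
    pose proof (sin2_cos2 (2 * PI * phi)) as h. unfold Rsqr in h.
    set (c := cos (2 * PI * phi)) in *. set (s := sin (2 * PI * phi)) in *.
    assert (e : 1 - c * c = s * s) by lra. rewrite e. ring.
Qed.

(** The sum of the angles of the [k] sites at offset [beta]. The leading coefficients of [A] and [B]
    carry its cosine and minus its sine, as in a product of unit complex numbers. *)
Definition Ssum (beta : R) (k : nat) : R := 2 * PI * (INR k * beta + alpha * INR k * (INR k - 1) / 2).

Lemma Ssum_S beta k : Ssum beta (S k) = Ssum beta k + 2 * PI * (beta + INR k * alpha).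
Proof. unfold Ssum. rewrite S_INR. field. Qed.

Lemma AB_isP beta k :
  isP k ((2 * lambda) ^ k * cos (Ssum beta k)) (fun x => fst (AB beta k x)) /\
  isP (pred k) (- (2 * lambda) ^ k * sin (Ssum beta k)) (fun x => snd (AB beta k x)).
Proof.
  assert (hS0 : Ssum beta 0 = 0) by (unfold Ssum; simpl; field).
  assert (hS1 : Ssum beta 1 = 2 * PI * beta) by (unfold Ssum; simpl; field).
  induction k as [| |k [IH1 IH1'] [IH2 IH2']] using two_step.
  - rewrite hS0, cos_0, sin_0. simpl. rewrite Rmult_1_r, Rmult_0_r. split; apply isP_const.
  - rewrite hS1. set (a := 2 * PI * beta). split.
    + apply (isP_ext _ _ (fun x => 2 * lambda * cos a * (x * 1) + (- E) * 1)).
      { intros x. rewrite AB_1. simpl. fold a. ring. }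
      replace ((2 * lambda) ^ 1 * cos a) with (2 * lambda * cos a * 1 + - E * 0) by ring.
      apply isP_lin; [apply (isP_X 0 1 (fun _ => 1)), isP_const|].
      exact (isP_weaken 0 1 (fun _ => 1) (isP_const 1)).
    + simpl pred. apply (isP_ext _ _ (fun x => (-(2 * lambda) ^ 1 * sin a))).
      { intros x. rewrite AB_1. simpl. fold a. ring. }
      apply isP_const.
  - set (a := 2 * PI * (beta + INR (S k) * alpha)).
    assert (eS : Ssum beta (S (S k)) = Ssum beta (S k) + a) by apply Ssum_S.
    set (l := (2 * lambda) ^ S k) in *.
    assert (hA : isP (S (S k)) 0 (fun x => fst (AB beta k x)))
      by (eapply isP_weaken, isP_weaken, IH1).
    assert (hA1 : isP (S (S k)) 0 (fun x => fst (AB beta (S k) x)))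
      by (eapply isP_weaken, IH2).
    assert (hB1 : isP (S k) 0 (fun x => snd (AB beta (S k) x)))
      by (eapply isP_weaken, IH2').
    assert (hB2 : isP (S (S k)) 0 (fun x => snd (AB beta (S k) x)))
      by (eapply isP_weaken, hB1).
    assert (hB0 : isP (S k) 0 (fun x => snd (AB beta k x))).
    { destruct k as [|k]; [eapply isP_weaken, IH1'|eapply isP_weaken, isP_weaken, IH1']. }
    change ((2 * lambda) ^ S (S k)) with (2 * lambda * l). rewrite eS. split.
    + apply (isP_ext _ _ (fun x =>
        1 * (1 * (2 * lambda * cos a * (x * fst (AB beta (S k) x)) + (- E) * fst (AB beta (S k) x))
             + 1 * (2 * lambda * sin a * (x * (x * snd (AB beta (S k) x)))
                    + (- (2 * lambda * sin a)) * snd (AB beta (S k) x)))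
        + (-1) * fst (AB beta k x))).
      { intros x. rewrite AB_SS. fold a. cbn [fst snd]. ring. }
      replace (2 * lambda * l * cos (Ssum beta (S k) + a)) with
        (1 * (1 * (2 * lambda * cos a * (l * cos (Ssum beta (S k))) + - E * 0)
              + 1 * (2 * lambda * sin a * (- l * sin (Ssum beta (S k))) + - (2 * lambda * sin a) * 0))
         + (-1) * 0) by (rewrite cos_plus; ring).
      apply isP_lin; [|easy]. apply isP_lin; apply isP_lin; try easy.
      * now apply isP_X.
      * apply isP_X, isP_X. easy.
    + simpl pred. apply (isP_ext _ _ (fun x =>
        1 * (1 * (2 * lambda * cos a * (x * snd (AB beta (S k) x)) + (- E) * snd (AB beta (S k) x))
             + (- (2 * lambda * sin a)) * fst (AB beta (S k) x))
        + (-1) * snd (AB beta k x))).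
      { intros x. rewrite AB_SS. fold a. cbn [fst snd]. ring. }
      replace (- (2 * lambda * l) * sin (Ssum beta (S k) + a)) with
        (1 * (1 * (2 * lambda * cos a * (- l * sin (Ssum beta (S k))) + - E * 0)
              + (- (2 * lambda * sin a)) * (l * cos (Ssum beta (S k))))
         + (-1) * 0) by (rewrite sin_plus; ring).
      apply isP_lin; [|easy]. apply isP_lin; [apply isP_lin|]; try easy.
      apply (isP_X k _ (fun x => snd (AB beta (S k) x))). easy.
Qed.

(** A cosine [x >= 1] belongs to a complex phase of sine [i sqrt (x^2 - 1)], and
    [A + i sqrt (x^2 - 1) B] is the determinant there. Its recursion multiplies by numbers of
    modulus at most [2 lambda x + |E|], and [A] is its real part. *)
Lemma AB_bound beta k x : 0 <= lambda -> 1 <= x ->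
  Rabs (fst (AB beta k x)) <= (2 * lambda * x + Rabs E + 1) ^ k.
Proof.
  intros hl hx. set (w := 2 * lambda * x + Rabs E + 1).
  assert (hE := Rabs_pos E).
  assert (hlx : 0 <= lambda * x) by (apply Rmult_le_pos; lra).
  assert (hw : 1 <= w) by (unfold w; nra).
  set (sg := sqrt (x * x - 1)).
  assert (hsg : sg * sg = x * x - 1) by (apply sqrt_sqrt; nra).
  set (z := fun j => (fst (AB beta j x), sg * snd (AB beta j x)) : C).
  assert (hmul : forall a : R, Cmod ((2 * lambda * cos a * x - E, - (2 * lambda * sin a * sg)) : C)
                 <= 2 * lambda * x + Rabs E).
  { intros a.
    replace ((2 * lambda * cos a * x - E, - (2 * lambda * sin a * sg)) : C)
      with (Cplus (2 * lambda * cos a * x, - (2 * lambda * sin a * sg)) (RtoC (- E)))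
      by (unfold Cplus, RtoC; simpl; f_equal; ring).
    eapply Rle_trans; [apply Cmod_triangle|]. rewrite Cmod_R, Rabs_Ropp.
    apply Rplus_le_compat_r. unfold Cmod. simpl fst; simpl snd.
    rewrite <- (sqrt_square (2 * lambda * x)) by lra. apply sqrt_le_1_alt.
    pose proof (sin2_cos2 a) as h. unfold Rsqr in h.
    replace ((2 * lambda * cos a * x) ^ 2 + (- (2 * lambda * sin a * sg)) ^ 2)
      with (4 * (lambda * lambda) * (cos a * cos a * (x * x) + sin a * sin a * (sg * sg))) by ring.
    rewrite hsg.
    replace (2 * lambda * x * (2 * lambda * x)) with (4 * (lambda * lambda) * (x * x)) by ring.
    apply Rmult_le_compat_l; [nra|]. nra. }
  assert (Hz : forall j, Cmod (z j) <= w ^ j).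
  { intros j. induction j as [| |j IH1 IH2] using two_step.
    - unfold z; simpl. rewrite Rmult_0_r. change (Cmod (RtoC 1) <= 1). rewrite Cmod_1. lra.
    - unfold z. rewrite AB_1. cbn [fst snd]. rewrite pow_1.
      replace ((2 * lambda * cos (2 * PI * beta) * x - E, sg * (- 2 * lambda * sin (2 * PI * beta))) : C)
        with ((2 * lambda * cos (2 * PI * beta) * x - E, - (2 * lambda * sin (2 * PI * beta) * sg)) : C)
        by (f_equal; ring).
      eapply Rle_trans; [apply hmul|]. unfold w; lra.
    - set (a := 2 * PI * (beta + INR (S j) * alpha)).
      assert (e : z (S (S j)) = Cplus (Cmult (2 * lambda * cos a * x - E, - (2 * lambda * sin a * sg)) (z (S j)))
                                      (Copp (z j))).
      { unfold z. rewrite AB_SS. fold a. cbn [fst snd]. unfold Cplus, Cmult, Copp. cbn [fst snd].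
        f_equal; [|ring].
        replace (1 - x * x) with (- (sg * sg)) by lra. ring. }
      rewrite e. eapply Rle_trans; [apply Cmod_triangle|]. rewrite Cmod_mult, Cmod_opp.
      apply Rle_trans with ((2 * lambda * x + Rabs E) * w ^ S j + w ^ j).
      + apply Rplus_le_compat; [|easy]. apply Rmult_le_compat; try apply Cmod_ge_0; [apply hmul|easy].
      + assert (0 < w ^ j) by (apply pow_lt; lra).
        replace (w ^ S (S j)) with (w * w ^ S j) by (simpl; ring).
        replace (w ^ S j) with (w * w ^ j) by (simpl; ring). replace (2 * lambda * x + Rabs E) with (w - 1) by (unfold w; ring). nra. }
  eapply Rle_trans; [|apply Hz]. unfold z. eapply Rle_trans; [|apply Rmax_Cmod].
  simpl. apply Rmax_l.
Qed.

(** Measured from the midpoint the angles sum to zero, so the cosine in the leading coefficient is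
    1; the reflection symmetry removes the part that is odd in the phase. *)
Lemma box_polynomial k : 0 <= lambda -> exists Q : R -> R,
  isP k ((2 * lambda) ^ k) Q /\
  (forall phi, boxdet (phi - (INR k - 1) / 2 * alpha) k = Q (cos (2 * PI * phi))) /\
  (forall x, 1 <= x -> Rabs (Q x) <= (2 * lambda * x + Rabs E + 1) ^ k).
Proof.
  intros hl. set (beta := - ((INR k - 1) / 2 * alpha)).
  exists (fun x => fst (AB beta k x)). split; [|split].
  - destruct (AB_isP beta k) as [h _].
    assert (e : Ssum beta k = 0) by (unfold Ssum, beta; field).
    now rewrite e, cos_0, Rmult_1_r in h.
  - intros phi. change (phi - (INR k - 1) / 2 * alpha) with (phi + beta).
    pose proof (boxdet_AB beta k phi) as h1. pose proof (boxdet_AB beta k (- phi)) as h2.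
    replace (2 * PI * - phi) with (- (2 * PI * phi)) in h2 by ring.
    rewrite cos_neg, sin_neg in h2.
    replace (boxdet (- phi + beta) k) with (boxdet (phi + beta) k) in h2; [lra|].
    rewrite <- (boxdet_reflect' k (phi + beta)). f_equal. unfold beta. field.
  - intros x hx. now apply AB_bound.
Qed.

End Boxes.

(** * Products over interpolation nodes *)

Definition zlist (a : Z) (m : nat) : list Z := map (fun i => (a + Z.of_nat i)%Z) (seq 0 m).

Lemma zlist_length a m : length (zlist a m) = m.
Proof. unfold zlist. now rewrite length_map, length_seq. Qed.

Lemma zlist_In a m i : In i (zlist a m) <-> (a <= i < a + Z.of_nat m)%Z.
Proof.
  unfold zlist. rewrite in_map_iff. split.
  - intros [j [<- h]]. apply in_seq in h. lia.
  - intros h. exists (Z.to_nat (i - a)). split; [lia|]. apply in_seq. lia.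
Qed.

Lemma zlist_NoDup a m : NoDup (zlist a m).
Proof. apply NoDup_map_inj; [intros; lia|apply seq_NoDup]. Qed.

(** The conclusion of [sine_product_bounds] at one [n], with its truncation level named [s]. *)
Definition sine_bounds (alpha s eps : R) (n : nat) : Prop :=
  forall (m : nat) (x : R), (m <= n)%nat ->
    exp (- eps * INR n) <= prodL (fun j => Rmax (msin (x + INR j * alpha)) s) (seq 0 m)
      <= exp (eps * INR n).

Lemma prodL_single (J : list Z) j u : NoDup J ->
  prodL (fun i => if Z.eq_dec i j then u else 1) J = if in_dec Z.eq_dec j J then u else 1.
Proof.
  induction J as [|a J IH]; intros H; [easy|].
  inversion H as [|? ? h1 h2]; subst.
  change (prodL (fun i => if Z.eq_dec i j then u else 1) (a :: J)) with
    ((if Z.eq_dec a j then u else 1) * prodL (fun i => if Z.eq_dec i j then u else 1) J).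
  rewrite IH by easy.
  destruct (Z.eq_dec a j) as [->|ha].
  - destruct (in_dec Z.eq_dec j J); [easy|].
    destruct (in_dec Z.eq_dec j (j :: J)) as [_|h]; [ring|]. exfalso; apply h; now left.
  - destruct (in_dec Z.eq_dec j J) as [h|h]; destruct (in_dec Z.eq_dec j (a :: J)) as [h'|h']; try ring.
    + exfalso; apply h'; now right.
    + exfalso. destruct h'; easy.
Qed.

Section Nodes.

Variables (alpha s eps : R) (n : nat).
Hypothesis hs : 0 < s <= 1.
Hypothesis Hsb : sine_bounds alpha s eps n.

Let tr (x : R) : R := Rmax (msin x) s.

Lemma tr_pos x : 0 < tr x.
Proof. eapply Rlt_le_trans; [apply hs|apply Rmax_r]. Qed.

Lemma tr_le2 x : tr x <= 2.
Proof. apply Rmax_lub; [apply msin_le2|lra]. Qed.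

Lemma tr_zlist a m x : (m <= n)%nat ->
  exp (- eps * INR n) <= prodL (fun i => tr (x + IZR i * alpha)) (zlist a m) <= exp (eps * INR n).
Proof.
  intros hm. unfold zlist. rewrite prodL_map.
  rewrite (prodL_ext _ (fun j => Rmax (msin (x + IZR a * alpha + INR j * alpha)) s)).
  - now apply Hsb.
  - intros i _. unfold tr. rewrite plus_IZR, <- INR_IZR_INZ. do 2 f_equal. ring.
Qed.

Lemma tr_zlist2 a1 m1 a2 m2 x : (m1 <= n)%nat -> (m2 <= n)%nat ->
  exp (- (2 * eps) * INR n) <= prodL (fun i => tr (x + IZR i * alpha)) (zlist a1 m1 ++ zlist a2 m2)
    <= exp (2 * eps * INR n).
Proof.
  intros h1 h2. rewrite prodL_app.
  pose proof (tr_zlist a1 m1 x h1). pose proof (tr_zlist a2 m2 x h2).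
  replace (- (2 * eps) * INR n) with (- eps * INR n + - eps * INR n) by ring.
  replace (2 * eps * INR n) with (eps * INR n + eps * INR n) by ring.
  rewrite !exp_plus. pose proof (exp_pos (- eps * INR n)).
  split; apply Rmult_le_compat; lra.
Qed.

Variables (a1 a2 : Z) (m1 m2 : nat).
Hypotheses (hm1 : (m1 <= n)%nat) (hm2 : (m2 <= n)%nat).
Let J := zlist a1 m1 ++ zlist a2 m2.
Hypothesis HJ : NoDup J.

(** Each node contributes two sines and the nodes form two intervals, hence [4 eps]; the [/ 2] per
    node is that of [cos_diff_msin]. *)
Lemma tr_pair_product x y :
  (/ 2) ^ length J * exp (- (4 * eps) * INR n)
    <= prodL (fun i => / 2 * (tr (x + IZR i * alpha) * tr (y - IZR i * alpha))) J
    <= (/ 2) ^ length J * exp (4 * eps * INR n).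
Proof.
  rewrite prodL_mult, prodL_const, prodL_mult.
  rewrite (prodL_ext (fun i => tr (y - IZR i * alpha)) (fun i => tr (- y + IZR i * alpha))).
  2:{ intros i _. unfold tr. rewrite <- msin_opp. do 2 f_equal. ring. }
  pose proof (tr_zlist2 a1 m1 a2 m2 x hm1 hm2) as g1.
  pose proof (tr_zlist2 a1 m1 a2 m2 (- y) hm1 hm2) as g2.
  fold J in g1, g2.
  replace (- (4 * eps) * INR n) with (- (2 * eps) * INR n + - (2 * eps) * INR n) by ring.
  replace (4 * eps * INR n) with (2 * eps * INR n + 2 * eps * INR n) by ring.
  rewrite !exp_plus. pose proof (exp_pos (- (2 * eps) * INR n)).
  assert (0 < (/ 2) ^ length J) by (apply pow_lt; lra).
  split; (apply Rmult_le_compat_l; [lra|]); apply Rmult_le_compat; lra.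
Qed.

Variable om : R.
Definition node (al o : R) (i : Z) : R := cos (2 * PI * (o + IZR i * al)).
Let c := node alpha om.

Lemma node_diff i j : Rabs (c j - c i) =
  / 2 * (msin (2 * om + IZR (i + j) * alpha) * msin (IZR (i - j) * alpha)).
Proof.
  unfold c, node. rewrite cos_diff_msin.
  replace (om + IZR j * alpha + (om + IZR i * alpha)) with (2 * om + IZR (i + j) * alpha)
    by (rewrite plus_IZR; ring).
  replace (om + IZR j * alpha - (om + IZR i * alpha)) with (- (IZR (i - j) * alpha))
    by (rewrite minus_IZR; ring).
  rewrite msin_opp. lra.
Qed.

(** The truncation is inactive at all nodes except possibly the partner [x1 - j], so the truncated
    product is nearly the true one; the partner costs the factor [rho]. *)
Lemma node_product_lower j x1 rho :
  0 < rho <= 1 ->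
  (forall i, In i J -> i <> j -> s <= msin (IZR (i - j) * alpha)) ->
  (forall i, In i J -> i <> j -> (i + j)%Z <> x1 -> s <= msin (2 * om + IZR (i + j) * alpha)) ->
  (forall i, In i J -> i <> j -> (i + j)%Z = x1 -> 2 * rho <= msin (2 * om + IZR (i + j) * alpha)) ->
  (/ 2) ^ length J * exp (- (4 * eps) * INR n) * rho
    <= prodL (fun i => if Z.eq_dec i j then 1 else Rabs (c j - c i)) J.
Proof.
  intros hrho Hd Hs Hx.
  pose proof (tr_pair_product (2 * om + IZR j * alpha) (IZR j * alpha)) as [hp _].
  apply Rle_trans with (prodL (fun i => / 2 * (tr (2 * om + IZR j * alpha + IZR i * alpha)
      * tr (IZR j * alpha - IZR i * alpha)) * (if Z.eq_dec i (x1 - j) then rho else 1)) J).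
  - rewrite prodL_mult. apply Rmult_le_compat; try lra.
    + apply Rmult_le_pos; [apply pow_le; lra|left; apply exp_pos].
    + rewrite prodL_single by easy. destruct (in_dec _ _ _); lra.
  - apply prodL_le. intros i hi.
    set (t1 := tr (2 * om + IZR j * alpha + IZR i * alpha)).
    set (t2 := tr (IZR j * alpha - IZR i * alpha)).
    assert (ht1 : 0 < t1 <= 2) by (split; [apply tr_pos|apply tr_le2]).
    assert (ht2 : 0 < t2) by apply tr_pos.
    assert (ht12 : 0 < t1 * t2) by (apply Rmult_lt_0_compat; lra).
    set (rr := if Z.eq_dec i (x1 - j) then rho else 1).
    assert (hrr : 0 < rr <= 1) by (unfold rr; destruct (Z.eq_dec i (x1 - j)); lra).
    split; [left; repeat apply Rmult_lt_0_compat; lra|].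
    (* The truncated product still contains the factor [i = j], which is at most 1 because its
       difference sine is truncated to [s]. *)
    destruct (Z.eq_dec i j) as [->|hij].
    + assert (e : t2 = s).
      { unfold t2, tr. rewrite Rminus_diag, msin_0. apply Rmax_right. lra. }
      assert (t1 * t2 <= 2 * 1) by (apply Rmult_le_compat; lra).
      apply Rle_trans with (/ 2 * (t1 * t2) * 1); [|lra]. apply Rmult_le_compat_l; lra.
    + assert (e2 : t2 = msin (IZR (i - j) * alpha)).
      { unfold t2, tr. rewrite <- msin_opp.
        replace (- (IZR j * alpha - IZR i * alpha)) with (IZR (i - j) * alpha) by (rewrite minus_IZR; ring).
        apply Rmax_left. now apply Hd. }
      assert (e1 : t1 = Rmax (msin (2 * om + IZR (i + j) * alpha)) s).
      { unfold t1, tr. do 2 f_equal. rewrite plus_IZR; ring. }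
      rewrite node_diff, <- e2.
      rewrite Rmult_assoc. apply Rmult_le_compat_l; [lra|].
      rewrite Rmult_assoc, (Rmult_comm t2), <- Rmult_assoc.
      apply Rmult_le_compat_r; [lra|].
      unfold rr. destruct (Z.eq_dec i (x1 - j)) as [e|e].
      * specialize (Hx i hi hij ltac:(lia)). nra.
      * rewrite e1, Rmult_1_r, Rmax_left; [lra|]. apply Hs; [easy|easy|lia].
Qed.

Lemma node_product_upper X :
  prodL (fun i => Rabs (cos (2 * PI * X) - c i)) J <= (/ 2) ^ length J * exp (4 * eps * INR n).
Proof.
  pose proof (tr_pair_product (X + om) (X - om)) as [_ hp].
  eapply Rle_trans; [|apply hp]. apply prodL_le. intros i _. split; [apply Rabs_pos|].
  unfold c, node. rewrite cos_diff_msin.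
  replace (X + (om + IZR i * alpha)) with (X + om + IZR i * alpha) by ring.
  replace (X - (om + IZR i * alpha)) with (X - om - IZR i * alpha) by ring.
  assert (msin (X + om + IZR i * alpha) * msin (X - om - IZR i * alpha)
     <= tr (X + om + IZR i * alpha) * tr (X - om - IZR i * alpha)); [|lra].
  apply Rmult_le_compat; try apply msin_nonneg; apply Rmax_l.
Qed.

(** Removing one factor costs at most [2 / s^2], since each of its two truncated sines is at least
    [s]. *)
Lemma node_product_upper_but j X :
  prodL (fun i => if Z.eq_dec i j then 1 else Rabs (cos (2 * PI * X) - c i)) J
    <= (/ 2) ^ length J * exp (4 * eps * INR n) * (2 / (s * s)).
Proof.
  pose proof (tr_pair_product (X + om) (X - om)) as [_ hp].
  assert (hss : s * s <= 1) by nra. assert (hss0 : 0 < s * s) by nra.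
  assert (hi : 1 <= / (s * s)) by (rewrite <- Rinv_1; apply Rinv_le_contravar; lra).
  apply Rle_trans with (prodL (fun i => / 2 * (tr (X + om + IZR i * alpha) * tr (X - om - IZR i * alpha))
                               * (if Z.eq_dec i j then 2 / (s * s) else 1)) J).
  - apply prodL_le. intros i _.
    assert (h1 : s <= tr (X + om + IZR i * alpha)) by apply Rmax_r.
    assert (h2 : s <= tr (X - om - IZR i * alpha)) by apply Rmax_r.
    destruct (Z.eq_dec i j).
    + split; [lra|].
      apply Rle_trans with (/ 2 * (s * s) * (2 / (s * s))); [right; field; lra|].
      apply Rmult_le_compat_r; [unfold Rdiv; lra|]. apply Rmult_le_compat_l; [lra|].
      apply Rmult_le_compat; lra.
    + split; [apply Rabs_pos|]. rewrite Rmult_1_r. unfold c, node. rewrite cos_diff_msin.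
      replace (X + (om + IZR i * alpha)) with (X + om + IZR i * alpha) by ring.
      replace (X - (om + IZR i * alpha)) with (X - om - IZR i * alpha) by ring.
      assert (msin (X + om + IZR i * alpha) * msin (X - om - IZR i * alpha)
        <= tr (X + om + IZR i * alpha) * tr (X - om - IZR i * alpha)); [|lra].
      apply Rmult_le_compat; try apply msin_nonneg; apply Rmax_l.
  - rewrite prodL_mult. apply Rmult_le_compat.
    + apply prodL_nonneg. intros i _. left.
      apply Rmult_lt_0_compat; [lra|]. apply Rmult_lt_0_compat; apply tr_pos.
    + apply prodL_nonneg. intros i _. destruct (Z.eq_dec i j); unfold Rdiv; lra.
    + easy.
    + rewrite prodL_single by easy. destruct (in_dec _ _ _); unfold Rdiv; lra.
Qed.

End Nodes.

Lemma others_map {A} (eqd : forall x y : A, {x = y} + {x <> y}) (c : A -> R) (J : list A) j :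
  (forall i, In i J -> c i = c j -> i = j) ->
  others (c j) (map c J) = prodL (fun i => if eqd i j then 1 else c j - c i) J.
Proof.
  intros H. unfold others. rewrite prodL_map. apply prodL_ext. intros i hi.
  destruct (Req_dec_T (c i) (c j)) as [e|e]; destruct (eqd i j) as [e'|e']; try easy.
  - exfalso. apply e'. now apply H.
  - exfalso. apply e. now f_equal.
Qed.

(** The leading coefficient is a sum of [k + 1] terms [Q (c j) / others], so one of them reaches the
    average size. *)
Lemma isP_node_exists k a Q (c : Z -> R) (J : list Z) :
  isP k a Q -> NoDup J -> length J = S k ->
  (forall i j, In i J -> In j J -> c i = c j -> i = j) ->
  exists j, In j J /\
    Rabs a / INR (S k) * prodL (fun i => if Z.eq_dec i j then 1 else Rabs (c j - c i)) J <= Rabs (Q (c j)).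
Proof.
  intros HQ HJ Hl Hinj.
  assert (Hk : 0 < INR (S k)) by (apply lt_0_INR; lia).
  pose proof (HQ (map c J)) as h. unfold dd in h. rewrite sumL_map in h.
  assert (h' := h ltac:(now apply NoDup_map_inj) ltac:(now rewrite length_map)). clear h.
  destruct (sumL_exists_ge (fun j => Rabs (Q (c j) / others (c j) (map c J))) (Rabs a / INR (S k)) J)
    as [j [hj hjb]].
  - intros ->. simpl in Hl. lia.
  - rewrite Hl. replace (INR (S k) * (Rabs a / INR (S k))) with (Rabs a) by (field; lra).
    rewrite <- h'. apply sumL_abs.
  - exists j. split; [easy|].
    rewrite (others_map Z.eq_dec) in hjb by (intros; now apply Hinj).
    set (P := prodL (fun i => if Z.eq_dec i j then 1 else c j - c i) J) in hjb.
    assert (hP : P <> 0).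
    { apply prodL_neq0. intros i hi. destruct (Z.eq_dec i j) as [_|e]; [lra|].
      intros e'. apply e. apply Hinj; [easy|easy|lra]. }
    replace (prodL _ J) with (Rabs P).
    + unfold Rdiv in hjb at 2. rewrite Rabs_mult, Rabs_inv in hjb.
      assert (0 < Rabs P) by now apply Rabs_pos_lt.
      apply (Rmult_le_compat_r (Rabs P)) in hjb; [|lra].
      rewrite (Rmult_assoc (Rabs (Q (c j)))), Rinv_l, Rmult_1_r in hjb by lra. easy.
    + unfold P. rewrite prodL_abs. apply prodL_ext. intros i _.
      destruct (Z.eq_dec i j); [apply Rabs_R1|easy].
Qed.

(** The odd length puts the midpoint of the box on a site, so that phases of sites serve as nodes.
    The powers of 2 in the leading coefficient and in the node products cancel up to a constant and
    leave [lambda ^ (2 h + 1)]. [rho] may depend on the node because only a node [j] whose partner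
    [x1 - j] is also in [J] meets the resonance. *)
Lemma good_node lambda alpha E s eps n a1 m1 a2 m2 h th x1 (rho : Z -> R) :
  let J := zlist a1 m1 ++ zlist a2 m2 in
  0 < lambda -> 0 < s <= 1 -> sine_bounds alpha s eps n ->
  (m1 <= n)%nat -> (m2 <= n)%nat -> NoDup J -> (m1 + m2 = 2 * h + 2)%nat ->
  (forall j, In j J -> 0 < rho j <= 1) ->
  (forall i j, In i J -> In j J -> i <> j -> s <= msin (IZR (i - j) * alpha)) ->
  (forall i j, In i J -> In j J -> i <> j -> (i + j)%Z <> x1 -> s <= msin (2 * th + IZR (i + j) * alpha)) ->
  (forall i j, In i J -> In j J -> i <> j -> (i + j)%Z = x1 -> 2 * rho j <= msin (2 * th + IZR (i + j) * alpha)) ->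
  exists j, In j J /\
    lambda ^ (2 * h + 1) * exp (- (4 * eps) * INR n) * rho j / (4 * INR (h + 1))
      <= Rabs (boxdet lambda alpha E (th + IZR (j - Z.of_nat h) * alpha) (2 * h + 1)).
Proof.
  intros J hl hs Hsb hm1 hm2 HJ Hm Hrho Hd Hs Hx.
  assert (hlen : length J = S (2 * h + 1)).
  { unfold J. rewrite length_app, !zlist_length. lia. }
  destruct (box_polynomial lambda alpha E (2 * h + 1)) as [Q [HQ [HQD _]]]; [lra|].
  assert (Hinj : forall i j, In i J -> In j J -> node alpha th i = node alpha th j -> i = j).
  { intros i j hi hj e. destruct (Z.eq_dec i j) as [|hij]; [easy|exfalso].
    pose proof (node_diff alpha th i j) as hnd. rewrite e, Rminus_diag, Rabs_R0 in hnd.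
    pose proof (Hd i j hi hj hij) as h1.
    assert (0 < msin (2 * th + IZR (i + j) * alpha)).
    { destruct (Z.eq_dec (i + j) x1) as [e1|e1].
      - pose proof (Hx i j hi hj hij e1). pose proof (Hrho j hj). lra.
      - pose proof (Hs i j hi hj hij e1). lra. }
    assert (0 < msin (2 * th + IZR (i + j) * alpha) * msin (IZR (i - j) * alpha)).
    { apply Rmult_lt_0_compat; lra. }
    lra. }
  destruct (isP_node_exists _ _ _ (node alpha th) J HQ HJ hlen Hinj) as [j [hj hjb]].
  exists j. split; [easy|].
  assert (e : boxdet lambda alpha E (th + IZR (j - Z.of_nat h) * alpha) (2 * h + 1) = Q (node alpha th j)).
  { unfold node. rewrite <- HQD. f_equal. rewrite minus_IZR, <- INR_IZR_INZ.
    rewrite plus_INR, mult_INR. simpl (INR 1). simpl (INR 2). field. }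
  rewrite e. eapply Rle_trans; [|apply hjb].
  pose proof (node_product_lower alpha s eps n hs Hsb a1 a2 m1 m2 hm1 hm2 HJ th j x1 (rho j) (Hrho j hj)
    (fun i hi hij => Hd i j hi hj hij) (fun i hi hij => Hs i j hi hj hij)
    (fun i hi hij => Hx i j hi hj hij)) as hlow.
  fold J in hlow. rewrite hlen in hlow.
  assert (hk : 0 < INR (h + 1)) by (apply lt_0_INR; lia).
  assert (hk2 : INR (S (2 * h + 1)) = 2 * INR (h + 1)).
  { replace (S (2 * h + 1)) with (2 * (h + 1))%nat by lia. rewrite mult_INR. simpl (INR 2). ring. }
  rewrite hk2. rewrite Rabs_right by (apply Rle_ge, pow_le; lra).
  apply Rle_trans with ((2 * lambda) ^ (2 * h + 1) / (2 * INR (h + 1)) *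
     ((/ 2) ^ S (2 * h + 1) * exp (- (4 * eps) * INR n) * rho j)).
  - right. rewrite Rpow_mult_distr. set (k := (2 * h + 1)%nat).
    replace ((/ 2) ^ S k) with (/ 2 * / 2 ^ k) by (rewrite <- pow_inv; simpl; ring).
    field. split; [apply pow_nonzero; lra|lra].
  - apply Rmult_le_compat_l; [|easy].
    apply Rdiv_le_0_compat; [apply pow_le; lra|lra].
Qed.

(** * Approximate eigenvectors of real symmetric matrices *)

Module SymmetricMatrices.

Import all_boot all_order all_algebra complex.
Import Order.TTheory GRing.Theory Num.Theory.
Local Open Scope ring_scope.
Local Open Scope sesquilinear_scope.

Section Eigen.

Variable F : rcfType.
Local Notation C := (complex F).
Local Notation toC := (real_complex F).
Local Notation cRe := (@complex.Re F).
Local Notation cIm := (@complex.Im F).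

Lemma unitary_norm n (v : 'rV[C]_n) (P : 'M[C]_n) : P \is unitarymx ->
  \sum_i `|(v *m P) 0 i| ^+ 2 = \sum_i `|v 0 i| ^+ 2.
Proof.
have E (u : 'rV[C]_n) : \sum_i `|u 0 i| ^+ 2 = (u *m u ^t*) 0 0.
  by rewrite mxE; apply: eq_bigr => i _; rewrite !mxE normCK.
move=> /unitarymxP PP; rewrite !E trmx_mul map_mxM mulmxA -(mulmxA v) PP mulmx1 //.
Qed.

(** Expand [w] in an orthonormal eigenbasis of the Hermitian matrix obtained over the complex
    numbers: if every eigenvalue were farther than [kap] from [E], the residual would exceed [kap]
    times the norm of [w]. *)
Lemma approx_eigenvalue n (A : 'M[F]_n) (w : 'rV[F]_n) (E kap : F) :
  A^T = A -> w != 0 -> 0 <= kap ->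
  \sum_i ((w *m A) 0 i - E * w 0 i) ^+ 2 <= kap ^+ 2 * \sum_i (w 0 i) ^+ 2 ->
  exists E', exists u : 'rV[F]_n, `|E' - E| <= kap /\ u != 0 /\ u *m A = E' *: u.
Proof.
move=> Asym w0 kap0 Hle.
pose Ac := map_mx toC A.
have Aherm : Ac \is hermsymmx.
  apply: realsym_hermsym; first by apply/eqP; rewrite expr0 scale1r map_mx_id // map_trmx Asym.
  by apply/mxOverP => i j; rewrite mxE complex_real.
pose P := spectralmx Ac; pose d := spectral_diag Ac.
have Pu : P \is unitarymx by exact: spectral_unitarymx.
have Punit : P \in unitmx by exact: unitarymx_unit.
have /orthomx_spectralP : Ac \is normalmx by exact: hermitian_normalmx.
rewrite -/P -/d => AE.
have dreal : d \is a realmx by exact: hermitian_spectral_diag_real.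
have [i hi] : exists i, `|cRe (d 0 i) - E| <= kap.
  apply/existsP; apply: contraLR isT => /existsPn Hn.
  pose wc := map_mx toC w; pose y := wc *m P^t*.
  have yE : wc = y *m P by rewrite /y -mulmxA -(invmx_unitary Pu) mulVmx // mulmx1.
  have y0 : y != 0.
    apply: contra w0 => /eqP y0; move: yE; rewrite y0 mul0mx => /matrixP wc0.
    by apply/eqP/matrixP => a b; have := wc0 a b; rewrite !mxE => /eqP; rewrite fmorph_eq0 => /eqP.
  have eq1 : wc *m Ac - toC E *: wc = (\row_j ((d 0 j - toC E) * y 0 j)) *m P.
    rewrite AE invmx_unitary // !mulmxA -/y yE scalemxAl -mulmxBl; congr (_ *m _).
    by apply/rowP => j; rewrite mul_mx_diag !mxE mulrBl mulrC.
  have N1 : toC (\sum_i ((w *m A) 0 i - E * w 0 i) ^+ 2) = \sum_j `|(d 0 j - toC E) * y 0 j| ^+ 2.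
    have := unitary_norm _ (\row_j ((d 0 j - toC E) * y 0 j)) _ Pu; rewrite -eq1.
    under [X in _ = X -> _]eq_bigr => j _ do rewrite mxE.
    move=> <-; rewrite rmorph_sum; apply: eq_bigr => j _.
    rewrite rmorphXn rmorphB rmorphM /= -map_mxM !mxE real_normK // -?rmorphM -?rmorphB /=.
    by apply/complex_realP; eexists.
  have N2 : toC (\sum_i (w 0 i) ^+ 2) = \sum_j `|y 0 j| ^+ 2.
    rewrite -(unitary_norm _ y _ Pu) -yE rmorph_sum; apply: eq_bigr => j _.
    by rewrite rmorphXn /= mxE real_normK //; apply/complex_realP; eexists.
  have : toC (kap ^+ 2 * \sum_i (w 0 i) ^+ 2) < toC (\sum_i ((w *m A) 0 i - E * w 0 i) ^+ 2).
    rewrite N1 rmorphM /= N2 mulr_sumr.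
    have [j yj] : exists j, y 0 j != 0.
      apply/existsP; apply: contraNT y0 => /existsPn h; apply/eqP/rowP => j.
      by rewrite [RHS]mxE; apply/eqP; have := h j; rewrite negbK.
    have dn k : toC kap < `|d 0 k - toC E|.
      have /RRe_real <- : d 0 k \is Num.real by exact: (mxOverP dreal).
      have := Hn k; rewrite -ltNge -rmorphB normc_def /= expr0n addr0 sqrtr_sqr.
      by rewrite ltcR.
    have kap0' : 0 <= toC kap by rewrite ler0c.
    rewrite (bigD1 j) //= [X in _ < X](bigD1 j) //=; apply: ltr_leD.
      rewrite normrM exprMn rmorphXn /= ltr_pM2r ?exprn_gt0 ?normr_gt0 //.
      by rewrite ltrXn2r // ?dn.
    apply: ler_sum => k _; rewrite normrM exprMn rmorphXn /=.
    apply: ler_wpM2r; first exact: exprn_ge0.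
    by apply: lerXn2r; rewrite ?nnegrE //; exact: ltW.
  by rewrite ltcR ltNge Hle.
have dE : d 0 i = toC (cRe (d 0 i)) by apply/esym/RRe_real; exact: (mxOverP dreal).
pose r := row i P.
have rA : r *m Ac = d 0 i *: r.
  rewrite /r AE -row_mul !mulmxA mulmxV // mul1mx.
  by apply/rowP => j; rewrite !mxE (bigD1 i) //= big1 ?addr0 => [|k ki]; rewrite !mxE ?eqxx ?mulr1n // [i == k]eq_sym (negPf ki) mulr0n mul0r.
have r0 : r != 0.
  apply: contraTneq Punit => r0; rewrite -row_free_unit -kermx_eq0; apply/negP => /eqP k0.
  have : delta_mx 0 i *m P = 0 :> 'rV_n by rewrite -rowE -/r.
  move=> /sub_kermxP; rewrite k0 submx0 => /eqP /rowP /(_ i); rewrite !mxE !eqxx => /eqP.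
  by rewrite oner_eq0.
(* The matrix and the eigenvalue are real, so the real and imaginary parts of the eigenvector
   satisfy the same equation, and one of them is nonzero. *)
pose u1 := map_mx cRe r; pose u2 := map_mx cIm r.
have parts (g : C -> F) : (forall x y, g (x + y) = g x + g y) -> (forall a x, g (toC a * x) = a * g x) -> g 0 = 0 ->
    map_mx g r *m A = cRe (d 0 i) *: map_mx g r.
  move=> gD gM g0; apply/rowP => j; have /rowP /(_ j) := rA; rewrite !mxE dE /= => /(congr1 g).
  rewrite gM => <-; rewrite (big_morph g gD g0); apply: eq_bigr => k _.
  by rewrite !mxE mulrC -gM mulrC.
have [u1z|u1n] := eqVneq u1 0; last first.
  exists (cRe (d 0 i)), u1; split=> //; split=> //; apply: parts => // [[? ?] [? ?]//|a [x y] /=].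
  by rewrite mul0r subr0.
exists (cRe (d 0 i)), u2; split=> //; split; last first.
  apply: parts => // [[? ?] [? ?]//|a [x y] /=]; by rewrite mul0r addr0.
apply: contra r0 => /eqP u2z; apply/eqP/rowP => j.
have /rowP /(_ j) := u1z; have /rowP /(_ j) := u2z; rewrite !mxE.
by case: (P i j) => x y /= -> ->.
Qed.

End Eigen.

Import Rstruct.

Lemma sum_ord_sumL (q : nat) (f : nat -> Rdefinitions.R) : \sum_(i < q) f i = sumL f (List.seq 0 q).
Proof.
elim: q => [|q IH]; first by rewrite big_ord0.
by rewrite List.seq_S sumL_app sumL_one -IH big_ord_recr.
Qed.

Lemma symmetric_approx_eigenvalue (q : nat) (a : nat -> nat -> Rdefinitions.R)
    (w : nat -> Rdefinitions.R) (E kap : Rdefinitions.R) :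
  (forall i j, (i < q)%coq_nat -> (j < q)%coq_nat -> a i j = a j i) ->
  (exists i, (i < q)%coq_nat /\ w i <> 0%R) -> Rle 0 kap ->
  Rle (sumL (fun j => pow (Rminus (sumL (fun i => Rmult (w i) (a i j)) (List.seq 0 q)) (Rmult E (w j))) 2)
          (List.seq 0 q))
      (Rmult (pow kap 2) (sumL (fun i => pow (w i) 2) (List.seq 0 q))) ->
  exists E', exists u : nat -> Rdefinitions.R,
    Rle (Rabs (Rminus E' E)) kap /\ (exists i, (i < q)%coq_nat /\ u i <> 0%R) /\
    forall j, (j < q)%coq_nat -> sumL (fun i => Rmult (u i) (a i j)) (List.seq 0 q) = Rmult E' (u j).
Proof.
move=> Hsym [i0 [hi0 wi0]] hkap Hle.
pose A : 'M[Rdefinitions.R]_q := \matrix_(i, j) a i j.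
pose v : 'rV[Rdefinitions.R]_q := \row_i w i.
have vA (x : nat -> Rdefinitions.R) (j : 'I_q) : ((\row_i x i) *m A) 0 j
    = sumL (fun i => Rmult (x i) (a i j)) (List.seq 0 q).
  by rewrite mxE -sum_ord_sumL; apply: eq_bigr => i _; rewrite !mxE.
have [E' [u [hE [u0 hu]]]] : exists E', exists u : 'rV_q, `|E' - E| <= kap /\ u != 0 /\ u *m A = E' *: u.
  apply: (@approx_eigenvalue _ q A v E kap).
  - apply/matrixP => i j; rewrite !mxE; apply: Hsym; exact/ssrnat.ltP.
  - apply/eqP => /rowP /(_ (Ordinal (introT ssrnat.ltP hi0))); by rewrite !mxE /=.
  - exact/RleP.
  - apply/RleP; rewrite -!sum_ord_sumL in Hle; move: Hle.
    rewrite RpowE; congr (Rle _ (_ * _)).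
    + by apply: eq_bigr => j _; rewrite vA mxE RpowE.
    + by apply: eq_bigr => j _; rewrite mxE RpowE.
exists E', (fun i => if insub i is Some k then u 0 k else 0).
have uE (k : 'I_q) : (if insub (nat_of_ord k) is Some k' then u 0 k' else 0) = u 0 k by rewrite valK.
split; first by rewrite RminusE RabsE; exact/RleP.
split.
  have [k hk] : exists k, u 0 k != 0.
    apply/existsP; apply: contraNT u0 => /existsPn h; apply/eqP/rowP => j.
    by rewrite [RHS]mxE; apply/eqP; have := h j; rewrite negbK.
  by exists (nat_of_ord k); split; [exact/ssrnat.ltP|rewrite uE; apply/eqP].
move=> j /ssrnat.ltP hj; pose jo := Ordinal hj.
rewrite (uE jo) RmultE; have /rowP /(_ jo) := hu; rewrite [RHS]mxE => <-.
rewrite -(vA _ jo); congr ((_ *m A) 0 jo); apply/rowP => k; rewrite mxE; exact: uE.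
Qed.

End SymmetricMatrices.

(** * Periodic approximants *)

(** Neighbours on the cycle of [q] sites, with representatives [0] to [q - 1]. *)
Definition succq (q j : nat) : nat := if Nat.eq_dec (S j) q then O else S j.
Definition predq (q j : nat) : nat := match j with O => (q - 1)%nat | S j => j end.

Lemma sumL_indicator (x : nat -> R) a b k :
  sumL (fun i => if Nat.eq_dec i k then x i else 0) (seq a b)
  = if (Nat.leb a k && Nat.ltb k (a + b))%bool then x k else 0.
Proof.
  revert a; induction b as [|b IH]; intros a.
  - simpl. destruct (Nat.leb_spec a k), (Nat.ltb_spec k (a + 0)); simpl; try easy; lia.
  - change (seq a (S b)) with (a :: seq (S a) b).
    change (sumL ?f (a :: ?l)) with (f a + sumL f l). cbv beta. rewrite IH.
    destruct (Nat.eq_dec a k) as [e|e];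
    destruct (Nat.leb_spec a k), (Nat.ltb_spec k (a + S b)), (Nat.leb_spec (S a) k), (Nat.ltb_spec k (S a + b));
    try lia; rewrite ?e; simpl; lra.
Qed.

Lemma sumL_indicator0 (x : nat -> R) b k : (k < b)%nat ->
  sumL (fun i => if Nat.eq_dec i k then x i else 0) (seq 0 b) = x k.
Proof.
  intros h. rewrite sumL_indicator. simpl. destruct (Nat.ltb_spec k b); [easy|lia].
Qed.

(** Hopping and potential on the cycle form a real symmetric matrix, so an approximate eigenvector
    yields an exact one at a nearby energy. *)
Lemma ring_approx_eigenvalue (q : nat) (V w : nat -> R) E kap :
  (3 <= q)%nat -> (exists i, (i < q)%nat /\ w i <> 0) -> 0 <= kap ->
  sumL (fun j => (w (succq q j) + w (predq q j) + V j * w j - E * w j) ^ 2) (seq 0 q)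
    <= kap ^ 2 * sumL (fun i => w i ^ 2) (seq 0 q) ->
  exists E' (u : nat -> R), Rabs (E' - E) <= kap /\ (exists i, (i < q)%nat /\ u i <> 0) /\
    forall j, (j < q)%nat -> u (succq q j) + u (predq q j) + V j * u j = E' * u j.
Proof.
  intros hq hw hk H.
  set (a := fun i j : nat => (if Nat.eq_dec i (succq q j) then 1 else 0)
              + (if Nat.eq_dec i (predq q j) then 1 else 0) + (if Nat.eq_dec i j then V j else 0)).
  assert (Ha : forall (x : nat -> R) j, (j < q)%nat ->
    sumL (fun i => x i * a i j) (seq 0 q) = x (succq q j) + x (predq q j) + V j * x j).
  { intros x j hj.
    rewrite (sumL_ext _ (fun i => (if Nat.eq_dec i (succq q j) then x i else 0)
       + (if Nat.eq_dec i (predq q j) then x i else 0) + V j * (if Nat.eq_dec i j then x i else 0))).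
    - rewrite !sumL_plus, sumL_scal, !sumL_indicator0; [easy|easy| |].
      + unfold predq. destruct j; lia.
      + unfold succq. destruct (Nat.eq_dec (S j) q); lia.
    - intros i _. unfold a.
      destruct (Nat.eq_dec i (succq q j)), (Nat.eq_dec i (predq q j)), (Nat.eq_dec i j); subst; ring. }
  destruct (SymmetricMatrices.symmetric_approx_eigenvalue q a w E kap) as [E' [u [h1 [h2 h3]]]]; try easy.
  - intros i j hi hj. unfold a.
    assert (e1 : i = succq q j <-> j = predq q i).
    { unfold succq, predq. destruct (Nat.eq_dec (S j) q), i; lia. }
    assert (e2 : i = predq q j <-> j = succq q i).
    { unfold succq, predq. destruct (Nat.eq_dec (S i) q), j; lia. }
    destruct (Nat.eq_dec i (succq q j)), (Nat.eq_dec i (predq q j)), (Nat.eq_dec j (succq q i)),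
      (Nat.eq_dec j (predq q i)), (Nat.eq_dec i j), (Nat.eq_dec j i);
      try (exfalso; tauto); try (exfalso; congruence); try ring; congruence.
  - eapply Rle_trans; [|apply H]. right. apply sumL_ext. intros j hj. apply in_seq in hj.
    rewrite Ha by lia. easy.
  - exists E', u. split; [easy|]. split; [easy|]. intros j hj. rewrite <- h3 by easy. now rewrite Ha.
Qed.

Lemma succq_spec q j : (j < q)%nat ->
  Z.of_nat (succq q j) = ((Z.of_nat j + 1) mod Z.of_nat q)%Z.
Proof.
  intros h. unfold succq. destruct (Nat.eq_dec (S j) q) as [e|e].
  - replace (Z.of_nat j + 1)%Z with (Z.of_nat q) by lia. now rewrite Z_mod_same_full.
  - rewrite Z.mod_small; lia.
Qed.

Lemma predq_spec q j : (1 <= q)%nat -> (j < q)%nat ->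
  Z.of_nat (predq q j) = ((Z.of_nat j - 1) mod Z.of_nat q)%Z.
Proof.
  intros hq h. unfold predq. destruct j as [|j].
  - apply Z.mod_unique with (q := (-1)%Z); lia.
  - rewrite Z.mod_small; lia.
Qed.

Definition periodize (q : nat) (u : nat -> R) (z : Z) : R := u (Z.to_nat (z mod Z.of_nat q)).

(** An eigenvector on the cycle unrolls to a solution on the whole line. *)
Lemma periodize_eq q V u E' :
  (1 <= q)%nat -> (forall z, V (z + Z.of_nat q)%Z = V z) ->
  (forall j, (j < q)%nat -> u (succq q j) + u (predq q j) + V (Z.of_nat j) * u j = E' * u j) ->
  forall z, periodize q u (z + 1)%Z + periodize q u (z - 1)%Z + V z * periodize q u z
            = E' * periodize q u z.
Proof.
  intros hq HV H z. set (j := Z.to_nat (z mod Z.of_nat q)).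
  pose proof (Z.mod_pos_bound z (Z.of_nat q) ltac:(lia)) as hb.
  assert (hj : (j < q)%nat) by lia.
  assert (ej : Z.of_nat j = (z mod Z.of_nat q)%Z) by lia.
  assert (HVk : forall k z0, (0 <= k)%Z -> V (z0 + k * Z.of_nat q)%Z = V z0).
  { intros k z0 hk. pattern k. apply natlike_ind; [now rewrite Z.mul_0_l, Z.add_0_r| |easy].
    intros x hx IH. replace (z0 + Z.succ x * Z.of_nat q)%Z with (z0 + x * Z.of_nat q + Z.of_nat q)%Z by lia.
    now rewrite HV. }
  assert (eV : V z = V (Z.of_nat j)).
  { pose proof (Z.div_mod z (Z.of_nat q) ltac:(lia)) as hdm.
    destruct (Z.le_gt_cases 0 (z / Z.of_nat q)) as [h|h].
    - rewrite <- (HVk (z / Z.of_nat q)%Z (Z.of_nat j)) by easy. f_equal. unfold j. lia.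
    - rewrite <- (HVk (- (z / Z.of_nat q))%Z z) by lia. f_equal. unfold j. lia. }
  specialize (H j hj). rewrite eV. unfold periodize. fold j.
  replace (Z.to_nat ((z + 1) mod Z.of_nat q)) with (succq q j).
  - replace (Z.to_nat ((z - 1) mod Z.of_nat q)) with (predq q j); [easy|].
    apply Nat2Z.inj. rewrite predq_spec by lia. rewrite Z2Nat.id by (apply Z.mod_pos_bound; lia).
    unfold j. rewrite Z2Nat.id by lia. apply Zminus_mod_idemp_l.
  - apply Nat2Z.inj. rewrite succq_spec by lia. rewrite Z2Nat.id by (apply Z.mod_pos_bound; lia).
    unfold j. rewrite Z2Nat.id by lia. apply Zplus_mod_idemp_l.
Qed.

Section Truncation.

Variable psi : Z -> R.

Definition mass (W : nat) : R :=
  sumL (fun j => psi (Z.of_nat j - Z.of_nat W)%Z ^ 2) (seq 0 (2 * W + 1)).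

Lemma sumL_seq_S (f : nat -> R) m : sumL f (seq 0 (S m)) = f O + sumL (fun i => f (S i)) (seq 0 m).
Proof. simpl. f_equal. now rewrite <- seq_shift, sumL_map. Qed.

Lemma mass_S W : mass (S W) = mass W + psi (Z.of_nat (S W)) ^ 2 + psi (- Z.of_nat (S W))%Z ^ 2.
Proof.
  unfold mass. replace (2 * S W + 1)%nat with (S (S (2 * W + 1))) by lia.
  rewrite sumL_seq_S, seq_S, sumL_app, sumL_one.
  rewrite (sumL_ext _ (fun j => psi (Z.of_nat j - Z.of_nat W)%Z ^ 2)) by (intros; do 2 f_equal; lia).
  replace (Z.of_nat (S (0 + (2 * W + 1))) - Z.of_nat (S W))%Z with (Z.of_nat (S W)) by lia.
  replace (Z.of_nat 0 - Z.of_nat (S W))%Z with (- Z.of_nat (S W))%Z by lia. ring.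
Qed.

Lemma mass_0 : mass 0 = psi 0%Z ^ 2.
Proof. unfold mass. simpl. ring. Qed.

Hypotheses (Hb : forall z, Rabs (psi z) <= 1) (H0 : psi 0%Z = 1).

Lemma psi_sq z : 0 <= psi z ^ 2 <= 1.
Proof.
  split; [apply pow2_ge_0|]. rewrite <- pow2_abs. specialize (Hb z). pose proof (Rabs_pos (psi z)). nra.
Qed.

Lemma mass_le W : mass W <= 2 * INR W + 1.
Proof.
  induction W as [|W IH].
  - rewrite mass_0, H0. simpl; lra.
  - rewrite mass_S, S_INR. pose proof (psi_sq (Z.of_nat (S W))). pose proof (psi_sq (- Z.of_nat (S W))). lra.
Qed.

(** The quadratic term is enough: the mass to be contradicted grows only linearly. *)
Lemma binomial_two x i : 0 <= x -> 1 + INR i * x + INR i * (INR i - 1) / 2 * (x * x) <= (1 + x) ^ i.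
Proof.
  intros hx. induction i as [|i IH]; [simpl; lra|].
  rewrite S_INR. simpl. pose proof (pos_INR i) as hi.
  assert (hi2 : 0 <= INR i * (INR i - 1)).
  { destruct i as [|i]; [simpl; lra|]. rewrite S_INR in *. pose proof (pos_INR i). nra. }
  assert (hx3 : 0 <= INR i * (INR i - 1) * (x * x * x)).
  { apply Rmult_le_pos; [easy|]. repeat apply Rmult_le_pos; easy. }
  apply Rle_trans with ((1 + x) * (1 + INR i * x + INR i * (INR i - 1) / 2 * (x * x)));
    [nra|apply Rmult_le_compat_l; lra].
Qed.

(* Subexponential growth of the mass forces a scale at which little of it sits on the boundary. *)
Lemma small_boundary kap (i : nat) : 0 < kap -> 8 / kap ^ 4 + 2 <= INR i ->
  exists W, (1 <= W <= 2 * i)%nat /\ mass (S W) - mass (pred W) <= kap ^ 2 * mass (pred W).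
Proof.
  intros hk hi. apply NNPP. intros hn.
  assert (Hgr : forall m, (m <= i)%nat -> (1 + kap ^ 2) ^ m <= mass (2 * m)).
  { induction m as [|m IH]; intros hm.
    - simpl. rewrite mass_0, H0. lra.
    - specialize (IH ltac:(lia)).
      replace (2 * S m)%nat with (S (S (2 * m))) by lia.
      assert (h : kap ^ 2 * mass (2 * m) < mass (S (S (2 * m))) - mass (2 * m)).
      { apply Rnot_le_lt. intros h. apply hn. exists (S (2 * m)). split; [lia|]. exact h. }
      replace ((1 + kap ^ 2) ^ S m) with ((1 + kap ^ 2) * (1 + kap ^ 2) ^ m) by (simpl; ring).
      pose proof (pow2_ge_0 kap). nra. }
  specialize (Hgr i (le_n _)). pose proof (mass_le (2 * i)) as h2.
  pose proof (binomial_two (kap ^ 2) i (pow2_ge_0 kap)) as h3.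
  rewrite mult_INR in h2. simpl (INR 2) in h2.
  assert (hk4 : 0 < kap ^ 4) by (apply pow_lt; easy).
  assert (h4 : 8 < (INR i - 1) * kap ^ 4).
  { apply Rlt_le_trans with ((8 / kap ^ 4 + 1) * kap ^ 4); [|apply Rmult_le_compat_r; lra].
    unfold Rdiv. rewrite Rmult_plus_distr_r, Rmult_assoc, Rinv_l by lra. lra. }
  replace (kap ^ 2 * kap ^ 2) with (kap ^ 4) in h3 by ring.
  assert (0 < 8 / kap ^ 4) by (apply Rdiv_lt_0_compat; lra).
  assert (0 <= INR i * kap ^ 2) by (apply Rmult_le_pos; [lra|apply pow2_ge_0]).
  assert (INR i * 8 < INR i * ((INR i - 1) * kap ^ 4)) by (apply Rmult_lt_compat_l; lra).
  lra.
Qed.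

Definition cut (W : nat) (z : Z) : R := if Z_le_dec (Z.abs z) (Z.of_nat W) then psi z else 0.

Lemma cut_in W z : (Z.abs z <= Z.of_nat W)%Z -> cut W z = psi z.
Proof. intros h. unfold cut. now destruct (Z_le_dec (Z.abs z) (Z.of_nat W)). Qed.

Lemma cut_out W z : (Z.of_nat W < Z.abs z)%Z -> cut W z = 0.
Proof. intros h. unfold cut. destruct (Z_le_dec (Z.abs z) (Z.of_nat W)); [lia|easy]. Qed.

End Truncation.

Lemma sq_sum_le a b : (a + b) ^ 2 <= 2 * a ^ 2 + 2 * b ^ 2.
Proof. pose proof (pow2_ge_0 (a - b)). nra. Qed.

(** The cut leaves a residual only at [-W - 1], [-W], [W] and [W + 1], and the squares there sum to
    the boundary mass; replacing [v] by [V] adds [kap]. The shift by [W + 1] and [q >= 2 W + 3] put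
    a zero on either side of the support, so closing the ring is harmless. The energy is 0 because
    it is contained in the potentials. *)
Lemma truncated_ring psi (v V : Z -> R) (W q : nat) kap :
  (1 <= W)%nat -> (2 * W + 3 <= q)%nat -> 0 <= kap ->
  (forall z, Rabs (psi z) <= 1) -> psi 0%Z = 1 ->
  (forall z, psi (z + 1)%Z + psi (z - 1)%Z + v z * psi z = 0) ->
  (forall z, (Z.abs z <= Z.of_nat W)%Z -> Rabs (V z - v z) <= kap) ->
  mass psi (S W) - mass psi (pred W) <= kap ^ 2 * mass psi (pred W) ->
  let w := fun i : nat => cut psi W (Z.of_nat i - Z.of_nat W - 1)%Z in
  sumL (fun j => (w (succq q j) + w (predq q j) + V (Z.of_nat j - Z.of_nat W - 1)%Z * w j - 0 * w j) ^ 2) (seq 0 q)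
    <= (2 * kap) ^ 2 * sumL (fun i => w i ^ 2) (seq 0 q).
Proof.
  intros hW hq hk Hb H0 Hv HV Hm w.
  set (r0 := fun z => cut psi W (z + 1)%Z + cut psi W (z - 1)%Z + v z * cut psi W z).
  assert (Hterm : forall j, In j (seq 0 q) ->
    (w (succq q j) + w (predq q j) + V (Z.of_nat j - Z.of_nat W - 1)%Z * w j - 0 * w j) ^ 2
    <= 2 * r0 (Z.of_nat j - Z.of_nat W - 1)%Z ^ 2 + 2 * kap ^ 2 * w j ^ 2).
  { intros j hj. apply in_seq in hj. set (z := (Z.of_nat j - Z.of_nat W - 1)%Z).
    assert (e1 : w (succq q j) = cut psi W (z + 1)%Z).
    { unfold w, succq. destruct (Nat.eq_dec (S j) q).
      - rewrite !cut_out by (unfold z; lia). easy.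
      - f_equal. unfold z; lia. }
    assert (e2 : w (predq q j) = cut psi W (z - 1)%Z).
    { unfold w, predq. destruct j.
      - rewrite !cut_out by (unfold z; lia). easy.
      - f_equal. unfold z; lia. }
    rewrite e1, e2. change (w j) with (cut psi W z).
    replace (cut psi W (z + 1) + cut psi W (z - 1) + V z * cut psi W z - 0 * cut psi W z)
      with (r0 z + (V z - v z) * cut psi W z) by (unfold r0; ring).
    eapply Rle_trans; [apply sq_sum_le|]. apply Rplus_le_compat_l.
    rewrite Rmult_assoc. apply Rmult_le_compat_l; [lra|].
    destruct (Z_le_dec (Z.abs z) (Z.of_nat W)) as [h|h].
    - rewrite Rpow_mult_distr. apply Rmult_le_compat_r; [apply pow2_ge_0|].
      rewrite <- (pow2_abs (V z - v z)). apply pow_incr. split; [apply Rabs_pos|]. now apply HV.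
    - rewrite cut_out by lia. lra. }
  eapply Rle_trans; [apply sumL_le, Hterm|]. rewrite sumL_plus, !sumL_scal.
  assert (Hr : sumL (fun j => r0 (Z.of_nat j - Z.of_nat W - 1)%Z ^ 2) (seq 0 q)
               <= mass psi (S W) - mass psi (pred W)).
  { apply Rle_trans with (sumL (fun j =>
       ((if Nat.eq_dec j 0 then psi (- Z.of_nat W)%Z ^ 2 else 0)
       + (if Nat.eq_dec j 1 then psi (- Z.of_nat (S W))%Z ^ 2 else 0))
       + ((if Nat.eq_dec j (2 * W + 1) then psi (Z.of_nat (S W)) ^ 2 else 0)
       + (if Nat.eq_dec j (2 * W + 2) then psi (Z.of_nat W) ^ 2 else 0))) (seq 0 q)).
    - apply sumL_le. intros j hj. apply in_seq in hj. unfold r0.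
      set (z := (Z.of_nat j - Z.of_nat W - 1)%Z).
      destruct (Nat.eq_dec j 0) as [e0|e0]; [|destruct (Nat.eq_dec j 1) as [e1|e1];
        [|destruct (Nat.eq_dec j (2 * W + 1)) as [e2|e2]; [|destruct (Nat.eq_dec j (2 * W + 2)) as [e3|e3]]]].
      + destruct (Nat.eq_dec j 1), (Nat.eq_dec j (2 * W + 1)), (Nat.eq_dec j (2 * W + 2)); try lia.
        rewrite (cut_out _ _ (z - 1)), (cut_out _ _ z), cut_in by (unfold z; lia).
        replace (z + 1)%Z with (- Z.of_nat W)%Z by (unfold z; lia). right; ring.
      + destruct (Nat.eq_dec j (2 * W + 1)), (Nat.eq_dec j (2 * W + 2)); try lia.
        rewrite (cut_out _ _ (z - 1)), !cut_in by (unfold z; lia).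
        specialize (Hv z). replace (- Z.of_nat (S W))%Z with (z - 1)%Z by (unfold z; lia).
        replace (psi (z + 1)%Z + 0 + v z * psi z) with (- psi (z - 1)%Z) by lra. right; ring.
      + destruct (Nat.eq_dec j (2 * W + 2)); try lia.
        rewrite (cut_out _ _ (z + 1)), !cut_in by (unfold z; lia).
        specialize (Hv z). replace (Z.of_nat (S W))%Z with (z + 1)%Z by (unfold z; lia).
        replace (0 + psi (z - 1)%Z + v z * psi z) with (- psi (z + 1)%Z) by lra. right; ring.
      + rewrite (cut_out _ _ (z + 1)), (cut_out _ _ z), cut_in by (unfold z; lia).
        replace (z - 1)%Z with (Z.of_nat W)%Z by (unfold z; lia). right; ring.
      + destruct (Nat.le_gt_cases j (2 * W)) as [h|h].
        * rewrite !cut_in by (unfold z; lia). rewrite Hv. right; ring.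
        * rewrite !cut_out by (unfold z; lia). right; ring.
    - rewrite !sumL_plus.
      rewrite (sumL_indicator0 (fun _ => psi (- Z.of_nat W)%Z ^ 2)) by lia.
      rewrite (sumL_indicator0 (fun _ => psi (- Z.of_nat (S W))%Z ^ 2)) by lia.
      rewrite (sumL_indicator0 (fun _ => psi (Z.of_nat (S W)) ^ 2)) by lia.
      rewrite (sumL_indicator0 (fun _ => psi (Z.of_nat W) ^ 2)) by lia.
      destruct W as [|W]; [lia|]. simpl pred. rewrite (mass_S psi (S W)), (mass_S psi W). lra. }
  assert (Hw : mass psi (pred W) <= sumL (fun i => w i ^ 2) (seq 0 q)).
  { apply Rle_trans with (mass psi W).
    - destruct W as [|W]; [lia|]. simpl pred. rewrite mass_S.
      pose proof (pow2_ge_0 (psi (Z.of_nat (S W)))). pose proof (pow2_ge_0 (psi (- Z.of_nat (S W))%Z)). lra.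
    - replace q with (S (2 * W + 1) + (q - (2 * W + 2)))%nat by lia.
      rewrite seq_app, sumL_app, sumL_seq_S.
      assert (h1 : 0 <= w 0%nat ^ 2) by apply pow2_ge_0.
      assert (h2 : 0 <= sumL (fun i => w i ^ 2) (seq (0 + S (2 * W + 1)) (q - (2 * W + 2)))).
      { apply Rle_trans with (sumL (fun _ => 0 * 0) (seq (0 + S (2 * W + 1)) (q - (2 * W + 2)))).
        - rewrite sumL_scal. lra.
        - apply sumL_le. intros i _. rewrite Rmult_0_l. apply pow2_ge_0. }
      assert (h3 : mass psi W = sumL (fun i => w (S i) ^ 2) (seq 0 (2 * W + 1))).
      { apply sumL_ext. intros i hi. apply in_seq in hi. f_equal. unfold w. rewrite cut_in by lia. f_equal. lia. }
      lra. }
  pose proof (pow2_ge_0 kap). replace ((2 * kap) ^ 2) with (2 * kap ^ 2 + 2 * kap ^ 2) by ring. nra.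
Qed.

Lemma cos_lip2 x y : Rabs (cos (2 * PI * x) - cos (2 * PI * y)) <= 8 * Rabs (x - y).
Proof.
  rewrite cos_diff_msin. pose proof (msin_le2 (x + y)). pose proof (msin_nonneg (x + y)).
  pose proof (msin_nonneg (x - y)). pose proof (msin_lip0 (x - y)). pose proof PI_4. pose proof PI_RGT_0.
  pose proof (Rabs_pos (x - y)). apply Rle_trans with (msin (x - y)); nra.
Qed.

Lemma nat_argmax (f : nat -> R) q : (1 <= q)%nat ->
  exists t, (t < q)%nat /\ forall i, (i < q)%nat -> f i <= f t.
Proof.
  induction q as [|q IH]; [lia|]. intros _.
  destruct q as [|q]; [exists 0%nat; split; [lia|]; intros i hi; replace i with 0%nat by lia; lra|].
  destruct IH as [t [ht H]]; [lia|].
  destruct (Rle_dec (f (S q)) (f t)) as [h|h].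
  - exists t. split; [lia|]. intros i hi. destruct (Nat.eq_dec i (S q)) as [->|]; [easy|apply H; lia].
  - exists (S q). split; [lia|]. intros i hi. destruct (Nat.eq_dec i (S q)) as [->|]; [lra|].
    specialize (H i ltac:(lia)). lra.
Qed.

(** A half-integer is at distance at least [1/2] from every multiple of [q]. *)
Lemma msin_half_grid (q : nat) (N : Z) : (1 <= q)%nat -> / INR q <= msin ((IZR N + 1/2) / INR q).
Proof.
  intros hq. assert (hq0 : 1 <= INR q) by (apply (le_INR 1); lia).
  pose proof (Z.div_mod N (Z.of_nat q) ltac:(lia)) as hdm.
  pose proof (Z.mod_pos_bound N (Z.of_nat q) ltac:(lia)) as hb.
  set (t := (N / Z.of_nat q)%Z) in *. set (m := (N mod Z.of_nat q)%Z) in *.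
  replace ((IZR N + 1/2) / INR q) with ((IZR m + 1/2) / INR q + IZR t).
  2:{ rewrite hdm, plus_IZR, mult_IZR, <- INR_IZR_INZ. field. lra. }
  rewrite msin_int.
  assert (hm0 : 0 <= IZR m) by (apply IZR_le; lia).
  assert (hm1 : IZR m + 1 <= INR q) by (rewrite INR_IZR_INZ, <- plus_IZR; apply IZR_le; lia).
  assert (hi : 0 < / INR q) by (apply Rinv_0_lt_compat; lra).
  eapply Rle_trans; [|apply msin_lower].
  - assert (1/2 * / INR q <= Rmin ((IZR m + 1/2) / INR q) (1 - (IZR m + 1/2) / INR q)); [|lra].
    apply Rmin_glb.
    + unfold Rdiv. apply Rmult_le_compat_r; lra.
    + replace (1 - (IZR m + 1/2) / INR q) with ((INR q - (IZR m + 1/2)) * / INR q) by (field; lra).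
      apply Rmult_le_compat_r; lra.
  - split; [apply Rdiv_le_0_compat; lra|].
    apply (Rmult_le_reg_r (INR q)); [lra|]. unfold Rdiv. rewrite Rmult_assoc, Rinv_l by lra. lra.
Qed.

(* The phase [(r + 1/4) / q] of the approximant is as far as possible from all reflection centres. *)
Lemma ring_solution lambda alpha E theta psi (q Q i : nat) (P : Z) kap :
  0 < lambda -> (1 <= q <= Q)%nat -> Rabs (INR q * alpha - IZR P) <= / INR Q ->
  (forall z, Rabs (psi z) <= 1) -> psi 0%Z = 1 ->
  (forall z, resid lambda alpha E theta psi z = 0) ->
  0 < kap -> 8 / kap ^ 4 + 2 <= INR i -> (4 * i + 3 <= q)%nat -> 32 * lambda / INR q <= kap ->
  exists E' theta' (u : Z -> R), Rabs (E' - E) <= 2 * kap /\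
    (forall z, Rabs (u z) <= 1) /\ u 0%Z = 1 /\
    (forall z, Rabs (resid lambda alpha E' theta' u z) <= 16 * lambda * IZR (Z.abs z) / (INR q * INR Q)) /\
    (forall x, 16 * IZR (Z.abs x) <= INR Q -> / (2 * INR q) <= msin (2 * theta' + IZR x * alpha)).
Proof.
  intros hl hq ha Hb H0 Hres hk hi hiq hkl.
  assert (hq0 : 1 <= INR q) by (apply (le_INR 1); lia).
  assert (hQ0 : INR q <= INR Q) by (apply le_INR; lia).
  destruct (small_boundary psi Hb H0 kap i hk hi) as [W [hW Hm]].
  (* This moves the phase by at most [1 / q]. All reflection sums [2 * th' + x * be] below then have
     the form [(N + 1/2) / q], since the quarter is doubled. *)
  set (thc := (IZR (Int_part (INR q * theta)) + 1/4) / INR q).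
  set (be := IZR P / INR q).
  assert (hbe : Rabs (alpha - be) <= / (INR q * INR Q)).
  { replace (alpha - be) with (/ INR q * (INR q * alpha - IZR P)) by (unfold be; field; lra).
    rewrite Rabs_mult, Rabs_right by (left; apply Rinv_0_lt_compat; lra).
    rewrite Rinv_mult. apply Rmult_le_compat_l; [left; apply Rinv_0_lt_compat; lra|easy]. }
  set (v := fun z => pot lambda E (theta + IZR z * alpha)).
  set (V := fun z => pot lambda E (thc + IZR z * be)).
  assert (HvV : forall z, (Z.abs z <= Z.of_nat W)%Z -> Rabs (V z - v z) <= kap).
  { intros z hz. unfold V, v, pot.
    replace (2 * lambda * cos (2 * PI * (thc + IZR z * be)) - E - (2 * lambda * cos (2 * PI * (theta + IZR z * alpha)) - E))
      with (2 * lambda * (cos (2 * PI * (thc + IZR z * be)) - cos (2 * PI * (theta + IZR z * alpha)))) by ring.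
    rewrite Rabs_mult, Rabs_right by lra.
    pose proof (cos_lip2 (thc + IZR z * be) (theta + IZR z * alpha)) as h.
    assert (h2 : Rabs (thc + IZR z * be - (theta + IZR z * alpha)) <= 2 * / INR q).
    { replace (thc + IZR z * be - (theta + IZR z * alpha)) with ((thc - theta) + - (IZR z * (alpha - be))) by ring.
      eapply Rle_trans; [apply Rabs_triang|]. rewrite Rabs_Ropp, Rabs_mult.
      assert (h3 : Rabs (thc - theta) <= / INR q).
      { pose proof (Int_part_bounds (INR q * theta)).
        replace (thc - theta) with (/ INR q * (IZR (Int_part (INR q * theta)) + 1/4 - INR q * theta))
          by (unfold thc; field; lra).
        rewrite Rabs_mult, Rabs_right by (left; apply Rinv_0_lt_compat; lra).
        rewrite <- (Rmult_1_r (/ INR q)) at 2. apply Rmult_le_compat_l; [left; apply Rinv_0_lt_compat; lra|].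
        apply Rabs_le. lra. }
      assert (h4 : Rabs (IZR z) * Rabs (alpha - be) <= / INR q).
      { apply Rle_trans with (INR Q * / (INR q * INR Q)).
        - apply Rmult_le_compat; try apply Rabs_pos; [|easy].
          rewrite <- abs_IZR, INR_IZR_INZ. apply IZR_le. lia.
        - right. field. lra. }
      lra. }
    apply Rle_trans with (2 * lambda * (8 * (2 * / INR q))).
    - apply Rmult_le_compat_l; lra.
    - unfold Rdiv in hkl. lra. }
  pose proof (truncated_ring psi v V W q kap ltac:(lia) ltac:(lia) ltac:(lra) Hb H0 Hres HvV Hm) as Htr.
  cbv zeta in Htr. set (w := fun i : nat => cut psi W (Z.of_nat i - Z.of_nat W - 1)%Z) in *.
  destruct (ring_approx_eigenvalue q (fun j => V (Z.of_nat j - Z.of_nat W - 1)%Z) w 0 (2 * kap))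
    as [E'' [u [hE [[i1 [hi1 hu1]] Hu]]]]; [lia| |lra|easy|].
  { exists (W + 1)%nat. split; [lia|]. unfold w. rewrite cut_in by lia.
    replace (Z.of_nat (W + 1) - Z.of_nat W - 1)%Z with 0%Z by lia. lra. }
  rewrite Rminus_0_r in hE.
  (* Recentring and normalising the ring state at its maximum restores the bounds of the original
     state; it shifts the phase by a multiple of [be], which keeps the half-integer form. *)
  destruct (nat_argmax (fun i => Rabs (u i)) q ltac:(lia)) as [t [ht Hmax]].
  assert (hut : 0 < Rabs (u t)).
  { apply Rlt_le_trans with (Rabs (u i1)); [now apply Rabs_pos_lt|now apply Hmax]. }
  assert (hut0 : u t <> 0) by (intros h; rewrite h, Rabs_R0 in hut; lra).
  set (V' := fun z => V (z - Z.of_nat W - 1)%Z).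
  assert (HV' : forall z, V' (z + Z.of_nat q)%Z = V' z).
  { intros z. unfold V', V, pot. do 2 f_equal.
    replace (2 * PI * (thc + IZR (z + Z.of_nat q - Z.of_nat W - 1) * be))
      with (2 * PI * (thc + IZR (z - Z.of_nat W - 1) * be) + 2 * IZR P * PI).
    - rewrite cos_plus. replace (2 * IZR P * PI) with (2 * (PI * IZR P)) by ring.
      rewrite cos_2a, sin_2a, sin_IZR_PI.
      assert (h' : cos (PI * IZR P) * cos (PI * IZR P) = 1).
      { pose proof (sin2_cos2 (PI * IZR P)) as h2. unfold Rsqr in h2. rewrite sin_IZR_PI in h2. lra. }
      rewrite h'. ring.
    - rewrite !minus_IZR, plus_IZR, <- !INR_IZR_INZ. unfold be. field. lra. }
  pose proof (periodize_eq q V' u E'' ltac:(lia) HV' Hu) as Hper.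
  set (th' := thc + IZR (Z.of_nat t - Z.of_nat W - 1) * be).
  assert (hpt : periodize q u (Z.of_nat t) = u t).
  { unfold periodize. f_equal. rewrite Z.mod_small by lia. lia. }
  assert (Hb' : forall z, Rabs (periodize q u (z + Z.of_nat t)%Z / u t) <= 1).
  { intros z. unfold Rdiv. rewrite Rabs_mult, Rabs_inv.
    apply (Rmult_le_reg_r (Rabs (u t))); [easy|]. rewrite Rmult_assoc, Rinv_l, Rmult_1_l, Rmult_1_r by lra.
    apply Hmax. pose proof (Z.mod_pos_bound (z + Z.of_nat t) (Z.of_nat q) ltac:(lia)). lia. }
  (* The potential already contains [- E], so the ring eigenvalue [E''] is the correction to [E]. *)
  exists (E + E''), th', (fun z => periodize q u (z + Z.of_nat t)%Z / u t).
  split; [replace (E + E'' - E) with E'' by ring; easy|].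
  split; [easy|]. split; [rewrite Z.add_0_l, hpt; field; easy|]. split.
  - intros z. unfold resid.
    specialize (Hper (z + Z.of_nat t)%Z).
    replace (z + Z.of_nat t + 1)%Z with (z + 1 + Z.of_nat t)%Z in Hper by lia.
    replace (z + Z.of_nat t - 1)%Z with (z - 1 + Z.of_nat t)%Z in Hper by lia.
    set (p1 := periodize q u (z + 1 + Z.of_nat t)) in *. set (p2 := periodize q u (z - 1 + Z.of_nat t)) in *.
    specialize (Hb' z).
    set (p0 := periodize q u (z + Z.of_nat t)) in *.
    assert (eV : V' (z + Z.of_nat t)%Z = pot lambda E (th' + IZR z * be)).
    { unfold V', V, th'. f_equal. rewrite !minus_IZR, plus_IZR. ring. }
    rewrite eV in Hper.
    replace (p1 / u t + p2 / u t + pot lambda (E + E'') (th' + IZR z * alpha) * (p0 / u t))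
      with (2 * lambda * (cos (2 * PI * (th' + IZR z * alpha)) - cos (2 * PI * (th' + IZR z * be))) * (p0 / u t)).
    + rewrite !Rabs_mult, (Rabs_right 2), (Rabs_right lambda) by lra.
      pose proof (cos_lip2 (th' + IZR z * alpha) (th' + IZR z * be)) as h.
      replace (th' + IZR z * alpha - (th' + IZR z * be)) with (IZR z * (alpha - be)) in h by ring.
      rewrite Rabs_mult, <- abs_IZR in h.
      assert (hz : 0 <= IZR (Z.abs z)) by (apply IZR_le; lia).
      apply Rle_trans with (2 * lambda * (8 * (IZR (Z.abs z) * / (INR q * INR Q))) * 1).
      * apply Rmult_le_compat; [apply Rmult_le_pos; [lra|apply Rabs_pos]|apply Rabs_pos| |easy].
        apply Rmult_le_compat_l; [lra|]. eapply Rle_trans; [apply h|].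
        apply Rmult_le_compat_l; [lra|]. apply Rmult_le_compat_l; easy.
      * right. unfold Rdiv. ring.
    + unfold pot in *. replace p1 with (E'' * p0 - p2 - (2 * lambda * cos (2 * PI * (th' + IZR z * be)) - E) * p0) by lra.
      field. easy.
  - intros x hx.
    assert (h1 : / INR q <= msin (2 * th' + IZR x * be)).
    { set (N := (2 * Int_part (INR q * theta) + (2 * (Z.of_nat t - Z.of_nat W - 1) + x) * P)%Z).
      replace (2 * th' + IZR x * be) with ((IZR N + 1/2) / INR q); [apply msin_half_grid; lia|].
      unfold N, th', thc, be. rewrite plus_IZR, !mult_IZR, plus_IZR, mult_IZR. field. lra. }
    pose proof (msin_lip (2 * th' + IZR x * alpha) (2 * th' + IZR x * be)) as h2.
    replace (2 * th' + IZR x * alpha - (2 * th' + IZR x * be)) with (IZR x * (alpha - be)) in h2 by ring.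
    rewrite Rabs_mult, <- abs_IZR in h2. apply Rabs_le_between in h2.
    assert (hx0 : 0 <= IZR (Z.abs x)) by (apply IZR_le; lia).
    assert (h3 : 2 * PI * (IZR (Z.abs x) * Rabs (alpha - be)) <= / (2 * INR q)).
    { pose proof PI_4. pose proof PI_RGT_0. pose proof (Rabs_pos (alpha - be)).
      apply Rle_trans with (8 * (INR Q / 16 * / (INR q * INR Q))).
      - apply Rmult_le_compat; [lra|now apply Rmult_le_pos|lra|].
        apply Rmult_le_compat; lra.
      - right. field. lra. }
    replace (/ INR q) with (/ (2 * INR q) + / (2 * INR q)) in h1 by (field; lra). lra.
Qed.

(** * Lagrange interpolation with far nodes *)

Lemma prodL_but (f : R -> R) x l y : NoDup l -> In y l ->
  prodL (fun z => x - z) l = (x - y) * prodL (fun z => if Req_dec_T z y then 1 else x - z) l.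
Proof.
  induction l as [|a l IH]; [easy|]. intros Hn Hy. inversion Hn as [|? ? h1 h2]; subst.
  simpl. destruct (Req_dec_T a y) as [->|ha].
  - rewrite Rmult_1_l. f_equal. apply prodL_ext. intros z hz.
    destruct (Req_dec_T z y); [subst; easy|easy].
  - destruct Hy as [->|Hy]; [easy|]. rewrite IH by easy. ring.
Qed.

(** Lagrange interpolation, read off from the divided difference on [x :: l], which vanishes because
    it has one node more than the degree allows. *)
Lemma isP_eval_bound k a Q l x : isP k a Q -> NoDup l -> length l = S k -> ~ In x l ->
  Rabs (Q x) <= sumL (fun y => Rabs (Q y) *
     (Rabs (prodL (fun z => if Req_dec_T z y then 1 else x - z) l) / Rabs (others y l))) l.
Proof.
  intros HQ Hn Hl Hx.
  pose proof (isP_weaken _ _ _ HQ (x :: l) ltac:(now constructor) ltac:(simpl; lia)) as h.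
  unfold dd in h. change (sumL ?f (x :: l)) with (f x + sumL f l) in h. cbv beta in h.
  rewrite others_self, others_notin in h by easy.
  set (P := prodL (fun z => x - z) l) in *.
  assert (hP : P <> 0) by (unfold P; rewrite <- others_notin by easy; apply others_neq0).
  assert (e : Q x = - (P * sumL (fun c => Q c / others c (x :: l)) l)).
  { apply (Rmult_eq_reg_r (/ P)); [|now apply Rinv_neq_0_compat].
    transitivity (- sumL (fun c => Q c / others c (x :: l)) l); [unfold Rdiv in *; lra|].
    field. easy. }
  rewrite e, Rabs_Ropp, <- sumL_scal. eapply Rle_trans; [apply sumL_abs|].
  apply sumL_le. intros y hy.
  assert (hxy : x <> y) by (intros ->; easy).
  rewrite others_cons by easy. unfold P. rewrite (prodL_but Q x l y) by easy.
  set (A := prodL _ l). right.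
  rewrite <- Rabs_div by apply others_neq0. rewrite <- Rabs_mult.
  rewrite <- (Rabs_Ropp (_ * (A / _))). f_equal. field. split; [apply others_neq0|lra].
Qed.

Lemma prod_below l : prodL (fun i => INR l - INR i) (seq 0 l) = INR (fact l).
Proof.
  induction l as [|l IH]; [simpl; lra|].
  change (seq 0 (S l)) with (0%nat :: seq 1 l). rewrite <- seq_shift.
  change (prodL ?f (0%nat :: ?t)) with (f 0%nat * prodL f t). cbv beta.
  rewrite prodL_map, (prodL_ext _ (fun i => INR l - INR i)) by (intros; rewrite !S_INR; ring).
  rewrite IH. replace (fact (S l)) with (S l * fact l)%nat by reflexivity.
  rewrite mult_INR. simpl (INR 0). ring.
Qed.

Lemma prod_above l m : prodL (fun i => INR i - INR l) (seq (S l) m) = INR (fact m).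
Proof.
  induction m as [|m IH]; [simpl; lra|].
  rewrite seq_S, prodL_app, IH. change (prodL ?f [?a]) with (f a * 1). cbv beta.
  replace (fact (S m)) with (S m * fact m)%nat by reflexivity. rewrite mult_INR.
  replace (INR (S l + m) - INR l) with (INR (S m)) by (rewrite plus_INR, !S_INR; ring). ring.
Qed.

(** A binomial coefficient is at most [2 ^ (l + m)], by Pascal's rule. *)
Lemma fact_add_le l m : INR (fact (l + m)) <= 2 ^ (l + m) * (INR (fact l) * INR (fact m)).
Proof.
  assert (H : forall n l m, (l + m = n)%nat -> INR (fact (l + m)) <= 2 ^ (l + m) * (INR (fact l) * INR (fact m))).
  { clear. induction n as [|n IH]; intros l m h.
    - replace l with 0%nat by lia. replace m with 0%nat by lia. simpl. lra.
    - destruct l as [|l].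
      + change (0 + m)%nat with m. change (INR (fact 0)) with 1. assert (1 <= 2 ^ m) by (apply pow_R1_Rle; lra).
        pose proof (pos_INR (fact m)). nra.
      + destruct m as [|m].
        * rewrite Nat.add_0_r. assert (1 <= 2 ^ S l) by (apply pow_R1_Rle; lra).
          pose proof (pos_INR (fact (S l))). change (INR (fact 0)) with 1. nra.
        * pose proof (IH l (S m) ltac:(lia)) as h1. pose proof (IH (S l) m ltac:(lia)) as h2.
          replace (S l + S m)%nat with (S (l + S m)) by lia.
          replace (S l + m)%nat with (l + S m)%nat in h2 by lia.
          replace (fact (S (l + S m))) with (S (l + S m) * fact (l + S m))%nat by reflexivity.
          replace (fact (S l)) with (S l * fact l)%nat in * by reflexivity.
          replace (fact (S m)) with (S m * fact m)%nat in * by reflexivity.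
          rewrite !mult_INR in *. rewrite (S_INR (l + S m)), plus_INR.
          replace (INR l + INR (S m) + 1) with (INR (S l) + INR (S m)) by (rewrite !S_INR; ring).
          replace (2 ^ S (l + S m)) with (2 * 2 ^ (l + S m)) by (simpl; ring).
          set (f := INR (fact (l + S m))) in *. set (p := 2 ^ (l + S m)) in *.
          assert (0 <= INR (S l)) by apply pos_INR. assert (0 <= INR (S m)) by apply pos_INR.
          apply (Rmult_le_compat_l (INR (S l))) in h1; [|easy].
          apply (Rmult_le_compat_l (INR (S m))) in h2; [|easy]. lra. }
  now apply (H (l + m)%nat).
Qed.

(** A weak form of Stirling, from [(1 + 1/m) ^ m <= exp 1 <= 3]. *)
Lemma pow_le_fact n : INR n ^ n <= 3 ^ n * INR (fact n).
Proof.
  induction n as [|n IH]; [simpl; lra|].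
  destruct n as [|n]; [simpl; lra|].
  set (m := S n) in *. assert (hm : 1 <= INR m) by (apply (le_INR 1); unfold m; lia).
  replace (fact (S m)) with (S m * fact m)%nat by reflexivity. rewrite mult_INR.
  replace (INR (S m) ^ S m) with (INR (S m) * INR (S m) ^ m) by (simpl; ring).
  replace (3 ^ S m * (INR (S m) * INR (fact m))) with (INR (S m) * (3 * (3 ^ m * INR (fact m)))) by (simpl; ring).
  apply Rmult_le_compat_l; [apply pos_INR|].
  apply Rle_trans with (3 * INR m ^ m); [|lra].
  replace (INR (S m)) with (INR m * (1 + / INR m)) by (rewrite S_INR; field; lra).
  rewrite Rpow_mult_distr, Rmult_comm. apply Rmult_le_compat_r; [apply pow_le; lra|].
  apply Rle_trans with (exp (/ INR m) ^ m).
  - apply pow_incr. split; [|apply exp_ineq1_le].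
    assert (0 < / INR m) by (apply Rinv_0_lt_compat; lra). lra.
  - rewrite <- Rpower_pow by apply exp_pos. unfold Rpower. rewrite ln_exp, Rinv_r by lra. apply exp_le_3.
Qed.

(** The product is [l! (n - l)! / n ^ n], which is at least [n! / (2 n) ^ n] and hence
    [6 ^ (- n)]. *)
Lemma far_node_product (n l : nat) : (1 <= n)%nat -> (l <= n)%nat ->
  (/ 6) ^ n <= prodL (fun i => if Nat.eq_dec i l then 1 else Rabs (INR l / INR n - INR i / INR n)) (seq 0 (S n)).
Proof.
  intros hn hl. assert (hn0 : 0 < INR n) by (apply lt_0_INR; lia).
  replace (S n) with (l + S (n - l))%nat by lia. rewrite seq_app, prodL_app.
  change (seq (0 + l) (S (n - l))) with (l :: seq (S l) (n - l)).
  change (prodL ?f (l :: ?t)) with (f l * prodL f t). cbv beta.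
  destruct (Nat.eq_dec l l) as [_|]; [|easy].
  rewrite (prodL_ext _ (fun i => / INR n * (INR l - INR i)) (seq 0 l)).
  2:{ intros i hi. apply in_seq in hi. destruct (Nat.eq_dec i l); [lia|].
      replace (INR l / INR n - INR i / INR n) with (/ INR n * (INR l - INR i)) by (field; lra).
      apply Rabs_right, Rle_ge, Rmult_le_pos; [left; now apply Rinv_0_lt_compat|].
      assert (INR i <= INR l) by (apply le_INR; lia). lra. }
  rewrite (prodL_ext _ (fun i => / INR n * (INR i - INR l)) (seq (S l) (n - l))).
  2:{ intros i hi. apply in_seq in hi. destruct (Nat.eq_dec i l); [lia|].
      replace (INR l / INR n - INR i / INR n) with (- (/ INR n * (INR i - INR l))) by (field; lra).
      rewrite Rabs_Ropp. apply Rabs_right, Rle_ge, Rmult_le_pos; [left; now apply Rinv_0_lt_compat|].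
      assert (INR l <= INR i) by (apply le_INR; lia). lra. }
  rewrite !prodL_mult, !prodL_const, !length_seq, prod_below, prod_above.
  pose proof (fact_add_le l (n - l)) as h1. replace (l + (n - l))%nat with n in h1 by lia.
  pose proof (pow_le_fact n) as h2.
  replace ((/ INR n) ^ l * INR (fact l) * (1 * ((/ INR n) ^ (n - l) * INR (fact (n - l)))))
    with ((/ INR n) ^ n * (INR (fact l) * INR (fact (n - l)))).
  2:{ replace n with (l + (n - l))%nat at 2 by lia. rewrite pow_add. ring. }
  set (F := INR (fact l) * INR (fact (n - l))) in *.
  assert (h3 : INR n ^ n <= 6 ^ n * F).
  { replace 6 with (3 * 2) by lra. rewrite Rpow_mult_distr, Rmult_assoc.
    eapply Rle_trans; [apply h2|]. apply Rmult_le_compat_l; [apply pow_le; lra|easy]. }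
  rewrite !pow_inv. assert (0 < INR n ^ n) by now apply pow_lt.
  assert (0 < 6 ^ n) by (apply pow_lt; lra).
  apply (Rmult_le_reg_l (6 ^ n * INR n ^ n)); [now apply Rmult_lt_0_compat|].
  replace (6 ^ n * INR n ^ n * / 6 ^ n) with (INR n ^ n) by (field; lra).
  replace (6 ^ n * INR n ^ n * (/ INR n ^ n * F)) with (6 ^ n * F) by (field; lra). easy.
Qed.

Lemma prodL_but_map {A} (eqd : forall x y : A, {x = y} + {x <> y}) (c : A -> R) (g : R -> R) (J : list A) j :
  (forall i, In i J -> c i = c j -> i = j) ->
  prodL (fun z => if Req_dec_T z (c j) then 1 else g z) (map c J)
  = prodL (fun i => if eqd i j then 1 else g (c i)) J.
Proof.
  intros H. rewrite prodL_map. apply prodL_ext. intros i hi.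
  destruct (Req_dec_T (c i) (c j)) as [e|e]; destruct (eqd i j) as [e'|e']; try easy.
  - exfalso. apply e'. now apply H.
  - exfalso. apply e. now f_equal.
Qed.

Lemma prodL_but_notin (x : R) (g : R -> R) (l : list R) : ~ In x l ->
  prodL (fun z => if Req_dec_T z x then 1 else g z) l = prodL g l.
Proof.
  intros h. apply prodL_ext. intros d hd. destruct (Req_dec_T d x); [subst; easy|easy].
Qed.

Lemma exp_pow x n : exp x ^ n = exp (INR n * x).
Proof.
  induction n as [|n IH]; [simpl; now rewrite Rmult_0_l, exp_0|].
  rewrite S_INR. simpl. rewrite IH, <- exp_plus. f_equal. ring.
Qed.

(** In the term of a near node each far factor changes by a ratio of at most [1 + 2 / (B - 1)], so
    interpolation inside [[-1, 1]] is barely disturbed; this term is proportional to [bb]. At a far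
    node [t] the value [Q t] is at most about [(2 lambda t) ^ k], and the [k - 2 d] factors [t - c]
    of the denominator, together with the halves in the near node product, reduce it to [lambda ^ k]
    times a price exponential in [d]. *)
Lemma interpolation_bound lambda alpha E k d s eps n om a0 B bb rho X Q x1 R1 :
  let J := zlist a0 (k - 2 * d) in
  1 <= lambda -> (1 <= d)%nat -> (2 * d < k)%nat -> (k <= n)%nat ->
  0 < s <= 1 -> sine_bounds alpha s eps n -> 0 < rho <= 1 ->
  (forall i j, In i J -> In j J -> i <> j -> s <= msin (IZR (i - j) * alpha)) ->
  (forall i j, In i J -> In j J -> i <> j -> (i + j)%Z <> x1 -> s <= msin (2 * om + IZR (i + j) * alpha)) ->
  (forall i j, In i J -> In j J -> i <> j -> (i + j)%Z = x1 -> 2 * rho <= msin (2 * om + IZR (i + j) * alpha)) ->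
  2 <= B -> Rabs E + 1 <= R1 -> isP k ((2 * lambda) ^ k) Q ->
  (forall x, 1 <= x -> Rabs (Q x) <= (2 * lambda * x + Rabs E + 1) ^ k) ->
  (forall a, In a J -> Rabs (Q (node alpha om a)) <= bb) ->
  Rabs (Q (cos (2 * PI * X))) <= bb
    + INR k * (bb * (exp (8 * eps * INR n) * (2 / (s * s * rho)))
               * exp (INR (2 * d + 1) * (2 / (B - 1))))
    + INR (2 * d + 1) * (lambda ^ k * exp (4 * eps * INR n) * (72 * B * B) ^ (2 * d + 1)
               * exp (INR k * (/ (B - 1))) * exp (INR k * (R1 / (2 * B)))).
Proof.
  intros J hl hd hk hkn hs Hsb hrho Hd Hs Hx hB hR1 HQ HQt Hbb.
  set (x := cos (2 * PI * X)).
  assert (hx : -1 <= x <= 1) by apply COS_bound.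
  set (c := node alpha om).
  assert (hc : forall i, -1 <= c i <= 1) by (intros; apply COS_bound).
  (* Equidistant in [[B, 2 B]], so that [far_node_product] bounds the denominators among them. *)
  set (t := fun i : nat => B * (1 + INR i / INR (2 * d))).
  assert (hd0 : 0 < INR (2 * d)) by (apply lt_0_INR; lia).
  assert (htB : forall i, (i <= 2 * d)%nat -> B <= t i <= 2 * B).
  { intros i hi. unfold t.
    assert (0 <= INR i / INR (2 * d) <= 1).
    { split; [apply Rdiv_le_0_compat; [apply pos_INR|easy]|].
      apply (Rmult_le_reg_r (INR (2 * d))); [easy|]. unfold Rdiv. rewrite Rmult_assoc, Rinv_l by lra.
      rewrite Rmult_1_l, Rmult_1_r. now apply le_INR. }
    nra. }
  set (I := seq 0 (S (2 * d))).
  assert (hI : forall i, In i I -> (i <= 2 * d)%nat) by (intros i hi; apply in_seq in hi; lia).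
  assert (HlenJ : length J = (k - 2 * d)%nat) by apply zlist_length.
  assert (HJ : NoDup J) by apply zlist_NoDup.
  assert (HJ' : NoDup (zlist a0 (k - 2 * d) ++ zlist 0 0)) by (simpl; now rewrite app_nil_r).
  assert (EJ : zlist a0 (k - 2 * d) ++ zlist 0 0 = J) by (simpl; now rewrite app_nil_r).
  assert (hbb : 0 <= bb).
  { eapply Rle_trans; [apply Rabs_pos|apply (Hbb a0)]. apply zlist_In. lia. }
  assert (Hinj : forall i j, In i J -> In j J -> c i = c j -> i = j).
  { intros i j hi hj e. destruct (Z.eq_dec i j) as [|hij]; [easy|exfalso].
    pose proof (node_diff alpha om i j) as hnd. fold c in hnd. rewrite e, Rminus_diag, Rabs_R0 in hnd.
    pose proof (Hd i j hi hj hij) as h1.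
    assert (0 < msin (2 * om + IZR (i + j) * alpha)).
    { destruct (Z.eq_dec (i + j) x1) as [e1|e1].
      - pose proof (Hx i j hi hj hij e1). lra.
      - pose proof (Hs i j hi hj hij e1). lra. }
    assert (0 < msin (2 * om + IZR (i + j) * alpha) * msin (IZR (i - j) * alpha)).
    { apply Rmult_lt_0_compat; lra. }
    lra. }
  assert (Hinjt : forall i j, t i = t j -> i = j).
  { intros i j e. unfold t in e. apply INR_eq.
    assert (e1 : INR i / INR (2 * d) = INR j / INR (2 * d)) by nra.
    apply (Rmult_eq_reg_r (/ INR (2 * d))); [easy|]. apply Rinv_neq_0_compat. lra. }
  set (l := map c J ++ map t I).
  assert (Hct : forall j i, (i <= 2 * d)%nat -> c j <> t i).
  { intros j i hi e. specialize (hc j). specialize (htB i hi). lra. }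
  assert (Hl : NoDup l).
  { apply NoDup_app.
    - apply NoDup_map_inj; [intros; now apply Hinj|easy].
    - apply NoDup_map_inj; [intros; now apply Hinjt|apply seq_NoDup].
    - intros y hy1 hy2. apply in_map_iff in hy1, hy2.
      destruct hy1 as [j [<- hj]], hy2 as [i [e hi]]. apply (Hct j i); [now apply hI|easy]. }
  assert (Hllen : length l = S k).
  { unfold l, I. rewrite length_app, !length_map, length_seq, HlenJ. lia. }
  assert (Hpos1 : 0 <= INR k * (bb * (exp (8 * eps * INR n) * (2 / (s * s * rho)))
               * exp (INR (2 * d + 1) * (2 / (B - 1))))).
  { apply Rmult_le_pos; [apply pos_INR|]. apply Rmult_le_pos; [|left; apply exp_pos].
    apply Rmult_le_pos; [easy|]. apply Rmult_le_pos; [left; apply exp_pos|].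
    apply Rdiv_le_0_compat; [lra|]. repeat apply Rmult_lt_0_compat; lra. }
  assert (Hpos2 : 0 <= INR (2 * d + 1) * (lambda ^ k * exp (4 * eps * INR n) * (72 * B * B) ^ (2 * d + 1)
               * exp (INR k * (/ (B - 1))) * exp (INR k * (R1 / (2 * B))))).
  { apply Rmult_le_pos; [apply pos_INR|]. repeat apply Rmult_le_pos; try (left; apply exp_pos).
    - apply pow_le; lra.
    - apply pow_le. nra. }
  destruct (in_dec Req_dec_T x l) as [hxl|hxl].
  { apply in_app_or in hxl. destruct hxl as [h|h]; apply in_map_iff in h; destruct h as [j [e hj]].
    - rewrite <- e. specialize (Hbb j hj). fold c in Hbb. lra.
    - specialize (htB j (hI j hj)). lra. }
  eapply Rle_trans; [apply (isP_eval_bound k _ Q l x HQ Hl Hllen hxl)|].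
  unfold l at 3. rewrite sumL_app, !sumL_map.
  rewrite (Rplus_assoc bb).
  match goal with |- ?a + ?b <= bb + (?c1 + ?c2) => assert (a <= c1); [|assert (b <= c2); [|lra]] end.
  - apply Rle_trans with (INR (length J) * (bb * (exp (8 * eps * INR n) * (2 / (s * s * rho)))
               * exp (INR (2 * d + 1) * (2 / (B - 1))))).
    2:{ apply Rmult_le_compat_r; [|apply le_INR; lia].
        apply Rmult_le_pos; [|left; apply exp_pos].
        apply Rmult_le_pos; [easy|]. apply Rmult_le_pos; [left; apply exp_pos|].
        apply Rdiv_le_0_compat; [lra|]. repeat apply Rmult_lt_0_compat; lra. }
    apply sumL_le_const. intros j hj. rewrite Rmult_assoc.
    apply Rmult_le_compat; [apply Rabs_pos| |now apply Hbb|].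
    { apply Rdiv_le_0_compat; [apply Rabs_pos|apply Rabs_pos_lt, others_neq0]. }
    assert (Hnt : ~ In (c j) (map t I)).
    { intros h. apply in_map_iff in h. destruct h as [i [e hi]]. apply (Hct j i); [now apply hI|easy]. }
    assert (Hcj : forall i, In i J -> c i = c j -> i = j) by (intros i hi; now apply Hinj).
    unfold others, l. rewrite !prodL_app.
    rewrite !(prodL_but_map Z.eq_dec) by easy.
    rewrite !prodL_but_notin by easy. rewrite !prodL_map, !Rabs_mult, !prodL_abs.
    rewrite (prodL_ext _ (fun i => if Z.eq_dec i j then 1 else Rabs (x - c i)) J)
      by (intros i _; destruct (Z.eq_dec i j); [apply Rabs_R1|easy]).
    rewrite (prodL_ext (fun a => Rabs (if Z.eq_dec a j then 1 else c j - c a))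
        (fun i => if Z.eq_dec i j then 1 else Rabs (c j - c i)) J)
      by (intros i _; destruct (Z.eq_dec i j); [apply Rabs_R1|easy]).
    pose proof (node_product_lower alpha s eps n hs Hsb a0 0 (k - 2 * d) 0 ltac:(lia) ltac:(lia) HJ' om j x1 rho hrho) as hlow.
    rewrite EJ in hlow. specialize (hlow (fun i hi hij => Hd i j hi hj hij) (fun i hi hij => Hs i j hi hj hij)
      (fun i hi hij => Hx i j hi hj hij)). fold c in hlow.
    pose proof (node_product_upper_but alpha s eps n hs Hsb a0 0 (k - 2 * d) 0 ltac:(lia) ltac:(lia) HJ' om j X) as hup.
    rewrite EJ in hup. fold c x in hup.
    set (p1 := prodL (fun i => if Z.eq_dec i j then 1 else Rabs (x - c i)) J) in *.
    set (p2 := prodL (fun i => if Z.eq_dec i j then 1 else Rabs (c j - c i)) J) in *.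
    set (r1 := prodL (fun a => Rabs (x - t a)) I).
    set (r2 := prodL (fun a => Rabs (c j - t a)) I).
    assert (hr2 : 0 < r2).
    { apply prodL_pos. intros i hi. apply Rabs_pos_lt. specialize (Hct j i (hI i hi)). lra. }
    assert (hr : r1 <= exp (INR (2 * d + 1) * (2 / (B - 1))) * r2).
    { replace (2 * d + 1)%nat with (length I) by (unfold I; rewrite length_seq; lia).
      rewrite <- exp_pow, <- prodL_const. unfold r2. rewrite <- prodL_mult. apply prodL_le.
      intros i hi. split; [apply Rabs_pos|]. specialize (htB i (hI i hi)). specialize (hc j).
      rewrite (Rabs_left (x - t i)), (Rabs_left (c j - t i)) by lra.
      pose proof (exp_ineq1_le (2 / (B - 1))) as he.
      assert (h0 : 0 < / (B - 1)) by (apply Rinv_0_lt_compat; lra).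
      apply Rle_trans with ((1 + 2 / (B - 1)) * (t i - 1)).
      - assert (2 <= 2 / (B - 1) * (t i - 1)); [|lra].
        replace 2 with (2 / (B - 1) * (B - 1)) at 1 by (field; lra).
        apply Rmult_le_compat_l; [apply Rdiv_le_0_compat|]; lra.
      - apply Rmult_le_compat; lra. }
    assert (hh : 0 < (/ 2) ^ length J) by (apply pow_lt; lra).
    set (hp := (/ 2) ^ length J) in *.
    assert (he4 : 0 < exp (4 * eps * INR n)) by apply exp_pos.
    assert (he4' : exp (- (4 * eps) * INR n) = / exp (4 * eps * INR n)).
    { rewrite <- exp_Ropp. f_equal. ring. }
    assert (he8 : exp (8 * eps * INR n) = exp (4 * eps * INR n) * exp (4 * eps * INR n)).
    { rewrite <- exp_plus. f_equal. ring. }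
    rewrite he4' in hlow. set (e4 := exp (4 * eps * INR n)) in *.
    assert (hp2 : 0 < p2).
    { eapply Rlt_le_trans; [|apply hlow]. repeat apply Rmult_lt_0_compat; try lra. now apply Rinv_0_lt_compat. }
    assert (hp1 : 0 <= p1).
    { apply prodL_nonneg. intros i _. destruct (Z.eq_dec i j); [lra|apply Rabs_pos]. }
    assert (hr1 : 0 <= r1) by (apply prodL_nonneg; intros; apply Rabs_pos).
    apply (Rmult_le_reg_r (p2 * r2)); [now apply Rmult_lt_0_compat|].
    assert (hne : p2 * r2 <> 0) by (apply Rgt_not_eq, Rmult_lt_0_compat; easy).
    unfold Rdiv at 1. rewrite Rmult_assoc, Rinv_l, Rmult_1_r by easy.
    set (z := exp (INR (2 * d + 1) * (2 / (B - 1)))) in *.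
    apply Rle_trans with ((hp * e4 * (2 / (s * s))) * (z * r2)).
    { apply Rmult_le_compat; easy. }
    rewrite he8.
    apply Rle_trans with (e4 * e4 * (2 / (s * s * rho)) * z * ((hp * / e4 * rho) * r2)).
    + right. field. repeat split; lra.
    + apply Rmult_le_compat_l.
      * apply Rmult_le_pos; [|left; apply exp_pos]. apply Rmult_le_pos; [nra|].
        apply Rdiv_le_0_compat; [lra|]. repeat apply Rmult_lt_0_compat; lra.
      * apply Rmult_le_compat_r; lra.
  - replace (INR (2 * d + 1)) with (INR (length I)) by (unfold I; rewrite length_seq; f_equal; lia).
    apply sumL_le_const. intros i hi.
    assert (hti := htB i (hI i hi)).
    assert (Hnt : ~ In (t i) (map c J)).
    { intros h. apply in_map_iff in h. destruct h as [j [e hj]]. apply (Hct j i); [now apply hI|easy]. }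
    assert (Hti : forall i', In i' I -> t i' = t i -> i' = i) by (intros; now apply Hinjt).
    unfold others, l. rewrite !prodL_app.
    rewrite !(prodL_but_map Nat.eq_dec) by easy.
    rewrite !prodL_but_notin by easy. rewrite !prodL_map, !Rabs_mult, !prodL_abs.
    pose proof (node_product_upper alpha s eps n Hsb a0 0 (k - 2 * d) 0 ltac:(lia) ltac:(lia) om X) as hup.
    rewrite EJ in hup. fold c x in hup.
    set (p1 := prodL (fun a => Rabs (x - c a)) J) in *.
    set (p2 := prodL (fun a => Rabs (t i - c a)) J).
    set (r1 := prodL (fun a => Rabs (if Nat.eq_dec a i then 1 else x - t a)) I).
    set (r2 := prodL (fun a => Rabs (if Nat.eq_dec a i then 1 else t i - t a)) I).
    assert (hr1 : r1 <= (3 * B) ^ (2 * d + 1)).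
    { replace (2 * d + 1)%nat with (length I) by (unfold I; rewrite length_seq; lia).
      rewrite <- prodL_const. apply prodL_le. intros a ha. split; [apply Rabs_pos|].
      specialize (htB a (hI a ha)).
      destruct (Nat.eq_dec a i); [rewrite Rabs_R1; lra|]. rewrite Rabs_left by lra. lra. }
    assert (hr2 : (/ 6) ^ (2 * d + 1) <= r2).
    { apply Rle_trans with ((/ 6) ^ (2 * d)).
      - rewrite pow_add, pow_1. assert (0 < (/ 6) ^ (2 * d)) by (apply pow_lt; lra). nra.
      - eapply Rle_trans; [apply (far_node_product (2 * d) i); [lia|now apply hI]|].
        apply prodL_le. intros a ha. destruct (Nat.eq_dec a i); [rewrite Rabs_R1; lra|].
        split; [apply Rabs_pos|]. unfold t.
        replace (B * (1 + INR i / INR (2 * d)) - B * (1 + INR a / INR (2 * d)))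
          with (B * (INR i / INR (2 * d) - INR a / INR (2 * d))) by ring.
        rewrite Rabs_mult, (Rabs_right B) by lra.
        pose proof (Rabs_pos (INR i / INR (2 * d) - INR a / INR (2 * d))). nra. }
    assert (hp2 : (t i - 1) ^ (k - 2 * d) <= p2).
    { rewrite <- HlenJ, <- prodL_const. apply prodL_le. intros a _. split; [lra|].
      specialize (hc a). rewrite Rabs_right by lra. lra. }
    assert (hp1 : 0 <= p1) by (apply prodL_nonneg; intros; apply Rabs_pos).
    assert (hr10 : 0 <= r1) by (apply prodL_nonneg; intros; apply Rabs_pos).
    assert (hq : Rabs (Q (t i)) <= (2 * lambda * t i) ^ k * exp (INR k * (R1 / (2 * B)))).
    { eapply Rle_trans; [apply HQt; lra|]. rewrite <- exp_pow, <- Rpow_mult_distr.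
      apply pow_incr. split; [pose proof (Rabs_pos E); nra|].
      assert (hR10 : 0 <= R1) by (pose proof (Rabs_pos E); lra).
      pose proof (exp_ineq1_le (R1 / (2 * B))) as he.
      assert (hlt : B <= lambda * t i) by nra.
      apply Rle_trans with (2 * lambda * t i * (1 + R1 / (2 * B))); [|apply Rmult_le_compat_l; nra].
      assert (R1 <= 2 * lambda * t i * (R1 / (2 * B))); [|lra].
      apply Rle_trans with (2 * B * (R1 / (2 * B))); [right; field; lra|].
      apply Rmult_le_compat_r; [apply Rdiv_le_0_compat; lra|lra]. }
    assert (ht : t i ^ (k - 2 * d) <= (t i - 1) ^ (k - 2 * d) * exp (INR k * / (B - 1))).
    { apply Rle_trans with ((t i - 1) ^ (k - 2 * d) * exp (INR (k - 2 * d) * / (B - 1))).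
      - rewrite <- exp_pow, <- Rpow_mult_distr. apply pow_incr. split; [lra|].
        pose proof (exp_ineq1_le (/ (B - 1))) as he.
        assert (0 < / (B - 1)) by (apply Rinv_0_lt_compat; lra).
        apply Rle_trans with ((t i - 1) * (1 + / (B - 1))); [|apply Rmult_le_compat_l; lra].
        assert (1 <= (t i - 1) * / (B - 1)); [|lra].
        replace 1 with ((B - 1) * / (B - 1)) at 1 by (field; lra). apply Rmult_le_compat_r; lra.
      - apply Rmult_le_compat_l; [apply pow_le; lra|]. apply exp_mono.
        apply Rmult_le_compat_r; [left; apply Rinv_0_lt_compat; lra|]. apply le_INR; lia. }
    set (eB := exp (INR k * / (B - 1))) in *. set (eR := exp (INR k * (R1 / (2 * B)))) in *.
    set (e4 := exp (4 * eps * INR n)) in *. rewrite HlenJ in hup.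
    assert (heB : 0 < eB) by apply exp_pos. assert (heR : 0 < eR) by apply exp_pos.
    assert (he4 : 0 < e4) by apply exp_pos.
    set (k' := (k - 2 * d)%nat) in *.
    assert (htp : 0 < (t i - 1) ^ k') by (apply pow_lt; lra).
    assert (h6 : 0 < (/ 6) ^ (2 * d + 1)) by (apply pow_lt; lra).
    assert (hp20 : 0 < p2) by lra. assert (hr20 : 0 < r2) by lra.
    apply Rle_trans with (((2 * lambda * t i) ^ k * eR) *
       (((/ 2) ^ k' * e4 * (3 * B) ^ (2 * d + 1)) / ((t i - 1) ^ k' * (/ 6) ^ (2 * d + 1)))).
    + apply Rmult_le_compat; [apply Rabs_pos| |easy|].
      { apply Rdiv_le_0_compat; [now apply Rmult_le_pos|now apply Rmult_lt_0_compat]. }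
      unfold Rdiv. apply Rmult_le_compat.
      * now apply Rmult_le_pos.
      * left. apply Rinv_0_lt_compat. now apply Rmult_lt_0_compat.
      * now apply Rmult_le_compat.
      * apply Rinv_le_contravar; [now apply Rmult_lt_0_compat|]. apply Rmult_le_compat; lra.
    + assert (ek : (2 * lambda * t i) ^ k = lambda ^ k * (2 ^ k' * (t i ^ k' * (2 * t i) ^ (2 * d)))).
      { rewrite !Rpow_mult_distr. replace k with (k' + 2 * d)%nat at 1 3 by (unfold k'; lia).
        rewrite !pow_add. ring. }
      rewrite ek, pow_inv.
      assert (e6 : (/ 6) ^ (2 * d + 1) * 6 ^ (2 * d + 1) = 1) by (rewrite <- Rpow_mult_distr, Rinv_l, pow1; lra).
      assert (h2k : 0 < 2 ^ k') by (apply pow_lt; lra).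
      set (s6 := (/ 6) ^ (2 * d + 1)) in *.
      replace (lambda ^ k * (2 ^ k' * (t i ^ k' * (2 * t i) ^ (2 * d))) * eR *
          (/ 2 ^ k' * e4 * (3 * B) ^ (2 * d + 1) / ((t i - 1) ^ k' * s6)))
        with (lambda ^ k * e4 * (t i ^ k' / (t i - 1) ^ k') * eR * ((2 * t i) ^ (2 * d) * ((3 * B) ^ (2 * d + 1) * 6 ^ (2 * d + 1)))).
      2:{ replace (6 ^ (2 * d + 1)) with (/ s6).
          - field. repeat split; lra.
          - apply (Rmult_eq_reg_l s6); [|lra]. rewrite e6. field. lra. }
      assert (hlk : 0 < lambda ^ k) by (apply pow_lt; lra).
      apply Rle_trans with (lambda ^ k * e4 * eB * eR * (72 * B * B) ^ (2 * d + 1)); [|right; ring].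
      apply Rmult_le_compat.
      * repeat apply Rmult_le_pos; try lra; [apply pow_le; lra|left; now apply Rinv_0_lt_compat].
      * repeat apply Rmult_le_pos; apply pow_le; lra.
      * apply Rmult_le_compat_r; [lra|]. apply Rmult_le_compat_l; [apply Rmult_le_pos; lra|].
        apply (Rmult_le_reg_r ((t i - 1) ^ k')); [easy|]. unfold Rdiv. rewrite Rmult_assoc, Rinv_l, Rmult_1_r by lra. lra.
      (* [72 = 4 * 3 * 6]: [2 t <= 4 B], the distances [t - x <= 3 B], and the 6 of
         [far_node_product]. *)
      * rewrite <- Rpow_mult_distr.
        apply Rle_trans with ((4 * B) ^ (2 * d + 1) * (3 * B * 6) ^ (2 * d + 1)).
        -- apply Rmult_le_compat_r; [apply pow_le; lra|].
           apply Rle_trans with ((4 * B) ^ (2 * d)); [apply pow_incr; lra|].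
           rewrite (pow_add _ (2 * d) 1), pow_1. assert (0 < (4 * B) ^ (2 * d)) by (apply pow_lt; lra). nra.
        -- right. rewrite <- Rpow_mult_distr. f_equal. ring.
Qed.

(** * Growth of determinants and choice of scale *)

(** Round [j] up to a multiple of [k]. *)
Lemma subadditive_le (b : nat -> R) :
  (forall m n, b (m + n)%nat <= b m + b n) -> (forall m n, (m <= n)%nat -> b m <= b n) ->
  (forall n, 0 <= b n) ->
  forall k j, (1 <= k)%nat -> b j <= (INR j / INR k + 1) * b k.
Proof.
  intros Hs Hm H0 k j hk. assert (hk0 : 1 <= INR k) by (apply (le_INR 1); lia).
  assert (Hq : forall q, (1 <= q)%nat -> b (q * k)%nat <= INR q * b k).
  { intros q hq. induction q as [|q IH]; [lia|]. destruct q as [|q].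
    - simpl. rewrite Nat.add_0_r. lra.
    - replace (S (S q) * k)%nat with (S q * k + k)%nat by lia. rewrite S_INR.
      pose proof (Hs (S q * k)%nat k). specialize (IH ltac:(lia)). lra. }
  apply Rle_trans with (INR (S (j / k)) * b k).
  - eapply Rle_trans; [|apply Hq; lia]. apply Hm.
    pose proof (Nat.mod_upper_bound j k ltac:(lia)). pose proof (Nat.div_mod_eq j k). nia.
  - apply Rmult_le_compat_r; [easy|]. rewrite S_INR. apply Rplus_le_compat_r.
    apply (Rmult_le_reg_r (INR k)); [lra|]. unfold Rdiv. rewrite Rmult_assoc, Rinv_l, Rmult_1_r by lra.
    rewrite <- mult_INR. apply le_INR. rewrite Nat.mul_comm. apply Nat.Div0.mul_div_le.
Qed.

(* Along a geometric sequence of scales the averages [b K / K] decrease, so two consecutive ones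
   must nearly agree; at the larger of them [b] is almost linear below [K]. *)
Lemma scale_choice (R2 e : R) (K0 : nat) : 0 < R2 -> 0 < e -> (1 <= K0)%nat ->
  exists K1 : nat, forall b : nat -> R,
    (forall m n, b (m + n)%nat <= b m + b n) -> (forall m n, (m <= n)%nat -> b m <= b n) ->
    (forall n, 0 <= b n) -> (forall n, (1 <= n)%nat -> b n <= R2 * INR n) ->
    exists K, (K0 <= K <= K1)%nat /\
      forall j, (j <= K)%nat -> b j <= INR j * (b K / INR K) + e * INR K.
Proof.
  intros hR he hK0.
  destruct (INR_unbounded (2 * R2 / e)) as [T0 hT0].
  set (T := S T0). assert (hT : 2 * R2 / e < INR T) by (unfold T; rewrite S_INR; lra).
  assert (hT1 : 1 <= INR T) by (apply (le_INR 1); unfold T; lia).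
  assert (hRT : R2 / INR T <= e / 2).
  { apply (Rmult_le_reg_r (INR T)); [lra|]. unfold Rdiv at 1. rewrite Rmult_assoc, Rinv_l, Rmult_1_r by lra.
    apply Rle_trans with (e / 2 * (2 * R2 / e)); [right; field; lra|]. apply Rmult_le_compat_l; lra. }
  exists (K0 * T ^ T)%nat. intros b Hs Hm H0 HR.
  set (sc := fun i => (K0 * T ^ i)%nat). set (r := fun i => b (sc i) / INR (sc i)).
  assert (hsc : forall i, (1 <= sc i)%nat).
  { intros i. unfold sc. assert (T ^ i <> 0)%nat by (apply Nat.pow_nonzero; unfold T; lia). nia. }
  assert (hscR : forall i, 1 <= INR (sc i)) by (intros i; apply (le_INR 1), hsc).
  assert (hscS : forall i, sc (S i) = (sc i * T)%nat) by (intros i; unfold sc; simpl; lia).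
  assert (hr : forall i, 0 <= r i <= R2).
  { intros i. specialize (hscR i). unfold r. split; [apply Rdiv_le_0_compat; [easy|lra]|].
    apply (Rmult_le_reg_r (INR (sc i))); [lra|]. unfold Rdiv. rewrite Rmult_assoc, Rinv_l, Rmult_1_r by lra.
    now apply HR. }
  assert (Hex : exists i, (i < T)%nat /\ r i - r (S i) <= R2 / INR T).
  { apply NNPP. intros hn.
    assert (Hd : forall i, (i < T)%nat -> R2 / INR T < r i - r (S i)).
    { intros i hi. apply Rnot_le_lt. intros h. apply hn. now exists i. }
    assert (Hi : forall i, (i < T)%nat -> r i <= r 0%nat - INR i * (R2 / INR T)).
    { induction i as [|i IH]; intros hi; [simpl; lra|].
      specialize (IH ltac:(lia)). specialize (Hd i ltac:(lia)). rewrite S_INR. lra. }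
    specialize (Hi T0 ltac:(unfold T; lia)). specialize (Hd T0 ltac:(unfold T; lia)).
    pose proof (hr 0%nat). pose proof (hr (S T0)).
    assert (hTR : INR T * (R2 / INR T) = R2) by (field; lra).
    assert (hTS : INR T = INR T0 + 1) by (unfold T; apply S_INR).
    assert (hTR' : INR T0 * (R2 / INR T) + R2 / INR T = R2) by (rewrite <- hTR at 3; rewrite hTS at 3; ring).
    lra. }
  destruct Hex as [i [hi hdi]]. exists (sc (S i)). split.
  { unfold sc. split.
    - assert (T ^ S i <> 0)%nat by (apply Nat.pow_nonzero; unfold T; lia). nia.
    - apply Nat.mul_le_mono_l, Nat.pow_le_mono_r; unfold T in *; lia. }
  intros j hj. fold (r (S i)).
  set (k := sc i). set (K := sc (S i)) in *.
  assert (hkK : INR K = INR k * INR T) by (unfold K, k; rewrite hscS; apply mult_INR).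
  pose proof (hscR i) as hk1. fold k in hk1. pose proof (hr i) as hri.
  assert (eb : b k = INR k * r i) by (unfold r; fold k; field; lra).
  pose proof (subadditive_le b Hs Hm H0 k j (hsc i)) as h.
  replace ((INR j / INR k + 1) * b k) with ((INR j + INR k) * r i) in h by (rewrite eb; field; lra).
  eapply Rle_trans; [apply h|].
  assert (INR j * r i <= INR j * r (S i) + e / 2 * INR K).
  { apply Rle_trans with (INR j * (r (S i) + e / 2)).
    - apply Rmult_le_compat_l; [apply pos_INR|lra].
    - assert (INR j <= INR K) by now apply le_INR. nra. }
  assert (INR k * r i <= e / 2 * INR K).
  { rewrite hkK. apply Rle_trans with (INR k * (R2 / INR T * INR T)).
    - apply Rmult_le_compat_l; [lra|]. replace (R2 / INR T * INR T) with R2 by (field; lra). lra.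
    - replace (e / 2 * (INR k * INR T)) with (INR k * (e / 2 * INR T)) by ring.
      apply Rmult_le_compat_l; [lra|]. apply Rmult_le_compat_r; lra. }
  lra.
Qed.

Section Growth.

Variables (lambda alpha E R1 : R).
Hypothesis hR1 : 2 * Rabs lambda + Rabs E + 1 <= R1.

Lemma pot_abs th : Rabs (pot lambda E th) <= R1 - 1.
Proof.
  unfold pot, Rminus. eapply Rle_trans; [apply Rabs_triang|]. rewrite Rabs_Ropp, !Rabs_mult, (Rabs_right 2) by lra.
  assert (Rabs (cos (2 * PI * th)) <= 1) by (apply Rabs_le, COS_bound).
  pose proof (Rabs_pos lambda). nra.
Qed.

Lemma R1_ge1 : 1 <= R1.
Proof. pose proof (Rabs_pos lambda). pose proof (Rabs_pos E). lra. Qed.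

Lemma boxdet_crude th k : Rabs (boxdet lambda alpha E th k) <= R1 ^ k.
Proof.
  pose proof R1_ge1.
  induction k as [| |k IH1 IH2] using two_step.
  - simpl. rewrite Rabs_R1. lra.
  - rewrite boxdet_1, pow_1. pose proof (pot_abs th). lra.
  - rewrite boxdet_SS. unfold Rminus. eapply Rle_trans; [apply Rabs_triang|]. rewrite Rabs_Ropp, Rabs_mult.
    pose proof (pot_abs (th + INR (S k) * alpha)) as h.
    assert (0 < R1 ^ k) by (apply pow_lt; lra).
    apply Rle_trans with ((R1 - 1) * R1 ^ S k + R1 ^ k).
    + apply Rplus_le_compat; [|easy]. apply Rmult_le_compat; try apply Rabs_pos; easy.
    + simpl. nra.
Qed.

Let Bset (K : nat) (y : R) : Prop := exists j phi, (j <= K)%nat /\ y = Rabs (boxdet lambda alpha E phi j).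

(** Suprema over all phases and all lengths up to [K]. The second clause replaces attainment by a
    factor 2. The last one has a factor 2 because cutting a box gives two products; thus [ln (2 B)]
    is subadditive. *)
Lemma box_sup : exists B : nat -> R,
  (forall K j phi, (j <= K)%nat -> Rabs (boxdet lambda alpha E phi j) <= B K) /\
  (forall K, exists j phi, (j <= K)%nat /\ B K <= 2 * Rabs (boxdet lambda alpha E phi j)) /\
  (forall K, 1 <= B K) /\ (forall K, B K <= R1 ^ K) /\
  (forall m n, (m <= n)%nat -> B m <= B n) /\
  (forall m n, 2 * B (m + n)%nat <= 2 * B m * (2 * B n)).
Proof.
  pose proof R1_ge1 as hR.
  assert (Hub : forall K, is_upper_bound (Bset K) (R1 ^ K)).
  { intros K y [j [phi [hj ->]]]. eapply Rle_trans; [apply boxdet_crude|]. now apply Rle_pow. }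
  assert (Hne : forall K, exists y, Bset K y).
  { intros K. exists (Rabs (boxdet lambda alpha E 0 0)), 0%nat, 0. split; [lia|easy]. }
  set (B := fun K => proj1_sig (completeness (Bset K) (ex_intro _ _ (Hub K)) (Hne K))).
  assert (HB : forall K, is_lub (Bset K) (B K)) by (intros K; unfold B; apply proj2_sig).
  assert (H1 : forall K j phi, (j <= K)%nat -> Rabs (boxdet lambda alpha E phi j) <= B K).
  { intros K j phi hj. apply (HB K). now exists j, phi. }
  assert (H3 : forall K, 1 <= B K).
  { intros K. pose proof (H1 K 0%nat 0 ltac:(lia)) as h. simpl in h. now rewrite Rabs_R1 in h. }
  exists B. split; [easy|]. split; [|split; [easy|split; [|split]]].
  - intros K. apply NNPP. intros hn.
    assert (h : is_upper_bound (Bset K) (B K / 2)).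
    { intros y [j [phi [hj ->]]]. apply Rnot_lt_le. intros h. apply hn. exists j, phi. split; [easy|lra]. }
    apply (HB K) in h. specialize (H3 K). lra.
  - intros K. apply (HB K). apply Hub.
  - intros m n hmn. apply (HB m). intros y [j [phi [hj ->]]]. apply H1. lia.
  - intros m n. pose proof (H3 m) as hm. pose proof (H3 n) as hn.
    assert (h : B (m + n)%nat <= 2 * (B m * B n)); [|lra].
    apply (HB (m + n)%nat). intros y [j [phi [hj ->]]].
    destruct (Nat.le_gt_cases j m) as [hjm|hjm].
    + specialize (H1 m j phi hjm). nra.
    + destruct m as [|m].
      * specialize (H1 n j phi ltac:(lia)). nra.
      * replace j with (S m + S (j - S (S m)))%nat by lia.
        rewrite boxdet_split. unfold Rminus. eapply Rle_trans; [apply Rabs_triang|]. rewrite Rabs_Ropp, !Rabs_mult.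
        rewrite double. apply Rplus_le_compat; apply Rmult_le_compat; try apply Rabs_pos; apply H1; lia.
Qed.

End Growth.

(** * Stability in the energy, and uniqueness of the resonance *)

(** The resolvent identity for determinants: the energy is switched one site at a time, with [E] to
    the left of the site and [E'] to its right. *)
Lemma boxdet_shift_energy lambda alpha E E' th k :
  boxdet lambda alpha E' th k = boxdet lambda alpha E th k
    + (E - E') * sumL (fun j => boxdet lambda alpha E th j
                               * boxdet lambda alpha E' (th + INR (S j) * alpha) (k - 1 - j)) (seq 0 k).
Proof.
  assert (hpot : forall t, pot lambda E' t = pot lambda E t + (E - E')) by (intros; unfold pot; ring).
  induction k as [| |k IH1 IH2] using two_step.
  - simpl. ring.
  - rewrite !boxdet_1, hpot. change (seq 0 1) with [0%nat]. rewrite sumL_one. simpl. ring.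
  - rewrite !boxdet_SS. rewrite IH2 at 1. rewrite IH1 at 1.
    set (D := boxdet lambda alpha E). set (D' := boxdet lambda alpha E').
    set (v := pot lambda E' (th + INR (S k) * alpha)).
    set (S2 := sumL (fun j => D th j * D' (th + INR (S j) * alpha) (S k - 1 - j)%nat) (seq 0 (S k))).
    set (S1 := sumL (fun j => D th j * D' (th + INR (S j) * alpha) (k - 1 - j)%nat) (seq 0 k)).
    assert (e : sumL (fun j => D th j * D' (th + INR (S j) * alpha) (S (S k) - 1 - j)%nat) (seq 0 (S (S k)))
                = v * S2 - S1 + D th (S k)).
    { rewrite seq_S, sumL_app, sumL_one. replace (S (S k) - 1 - (0 + S k))%nat with 0%nat by lia.
      change (0 + S k)%nat with (S k). change (D' (th + INR (S (S k)) * alpha) 0%nat) with 1. rewrite Rmult_1_r. f_equal.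
      unfold S2. rewrite seq_S, !sumL_app, !sumL_one. change (0 + k)%nat with k.
      replace (S (S k) - 1 - k)%nat with 1%nat by lia. replace (S k - 1 - k)%nat with 0%nat by lia.
      unfold D' at 2. rewrite boxdet_1. change (D' (th + INR (S k) * alpha) 0%nat) with 1. fold v.
      assert (e1 : sumL (fun j => D th j * D' (th + INR (S j) * alpha) (S (S k) - 1 - j)%nat) (seq 0 k)
        = v * sumL (fun j => D th j * D' (th + INR (S j) * alpha) (S k - 1 - j)%nat) (seq 0 k) + (-1) * S1).
      { unfold S1. rewrite <- !sumL_scal, <- sumL_plus. apply sumL_ext. intros j hj. apply in_seq in hj.
        replace (S (S k) - 1 - j)%nat with (S (S (k - 1 - j))) by lia.
        replace (S k - 1 - j)%nat with (S (k - 1 - j)) by lia.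
        unfold D' at 1. rewrite boxdet_SS. fold D'.
        replace (th + INR (S j) * alpha + INR (S (k - 1 - j)) * alpha) with (th + INR (S k) * alpha).
        - fold v. ring.
        - replace (INR (S k)) with (INR (S j + S (k - 1 - j))) by (f_equal; lia). rewrite plus_INR. ring. }
      rewrite e1. ring. }
    rewrite e. replace (pot lambda E (th + INR (S k) * alpha)) with (v - (E - E')) by (unfold v; rewrite hpot; ring).
    ring.
Qed.

(** Strong induction on the length: the perturbation sum uses determinants at [E'] of smaller length
    only, already bounded by twice the growth, and the smallness condition reproduces the factor
    2. *)
Lemma gronwall lambda alpha E E' r G K :
  0 <= r -> 1 <= G ->
  (forall j phi, (j <= K)%nat -> Rabs (boxdet lambda alpha E phi j) <= G * exp (INR j * r)) ->
  2 * Rabs (E - E') * G * INR K <= 1 ->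
  forall j phi, (j <= K)%nat -> Rabs (boxdet lambda alpha E' phi j) <= 2 * G * exp (INR j * r) /\
    Rabs (boxdet lambda alpha E' phi j - boxdet lambda alpha E phi j)
      <= 2 * Rabs (E - E') * G * G * INR K * exp (INR j * r).
Proof.
  intros hr hG H Hsm j. induction j as [j IH] using lt_wf_ind. intros phi hj.
  assert (hd : Rabs (boxdet lambda alpha E' phi j - boxdet lambda alpha E phi j)
      <= 2 * Rabs (E - E') * G * G * INR K * exp (INR j * r)).
  { rewrite (boxdet_shift_energy lambda alpha E E' phi j).
    match goal with |- Rabs (?a + ?b - ?a) <= _ => replace (a + b - a) with b by ring end.
    rewrite Rabs_mult.
    replace (2 * Rabs (E - E') * G * G * INR K * exp (INR j * r))
      with (Rabs (E - E') * (INR K * (2 * G * G * exp (INR j * r)))) by ring.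
    apply Rmult_le_compat_l; [apply Rabs_pos|].
    eapply Rle_trans; [apply sumL_abs|].
    pose proof (exp_pos (INR j * r)).
    apply Rle_trans with (INR (length (seq 0 j)) * (2 * G * G * exp (INR j * r))).
    - apply sumL_le_const. intros i hi. apply in_seq in hi. rewrite Rabs_mult.
      destruct (IH (j - 1 - i)%nat ltac:(lia) (phi + INR (S i) * alpha) ltac:(lia)) as [h1 _].
      apply Rle_trans with (G * exp (INR i * r) * (2 * G * exp (INR (j - 1 - i) * r))).
      + apply Rmult_le_compat; try apply Rabs_pos; [apply H; lia|easy].
      + replace (G * exp (INR i * r) * (2 * G * exp (INR (j - 1 - i) * r)))
          with (2 * G * G * (exp (INR i * r) * exp (INR (j - 1 - i) * r))) by ring.
        apply Rmult_le_compat_l; [nra|]. rewrite <- exp_plus. apply exp_mono.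
        rewrite <- Rmult_plus_distr_r. apply Rmult_le_compat_r; [easy|].
        rewrite <- plus_INR. apply le_INR. lia.
    - rewrite length_seq. apply Rmult_le_compat_r; [nra|now apply le_INR]. }
  split; [|easy].
  specialize (H j phi hj).
  replace (boxdet lambda alpha E' phi j)
    with ((boxdet lambda alpha E' phi j - boxdet lambda alpha E phi j) + boxdet lambda alpha E phi j) by ring.
  eapply Rle_trans; [apply Rabs_triang|].
  pose proof (exp_pos (INR j * r)).
  assert (2 * Rabs (E - E') * G * G * INR K * exp (INR j * r) <= G * exp (INR j * r)); [|lra].
  apply Rmult_le_compat_r; [lra|].
  replace (2 * Rabs (E - E') * G * G * INR K) with (G * (2 * Rabs (E - E') * G * INR K)) by ring. nra.
Qed.

Lemma dioph_exp_mono alpha p p' : p <= p' -> dioph_exp alpha p -> dioph_exp alpha p'.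
Proof.
  intros hp H n k hn hk hkn. eapply Rle_trans; [|apply (H n k hn hk hkn)]. apply exp_mono.
  assert (0 <= ln (INR n)).
  { rewrite <- ln_1. apply ln_le_compat; [lra|]. apply (le_INR 1). lia. }
  nra.
Qed.

(** Two strong reflections would bring [(x' - x) alpha] too near an integer. The exponent [2 p + 1]
    leaves room for [|x' - x| <= 2 n] and for adding the two sines. *)
Lemma unique_resonance alpha p (n : nat) th x x' :
  dioph_exp alpha p -> 0 <= p -> (2 <= n)%nat ->
  (Z.abs x <= Z.of_nat n)%Z -> (Z.abs x' <= Z.of_nat n)%Z -> x <> x' ->
  msin (2 * th + IZR x * alpha) < exp (- (2 * p + 1) * ln (INR n)) ->
  exp (- (2 * p + 1) * ln (INR n)) <= msin (2 * th + IZR x' * alpha).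
Proof.
  intros H hp hn hx hx' hne hlt.
  assert (hn2 : 2 <= INR n) by (apply (le_INR 2); lia).
  assert (hl : ln 2 <= ln (INR n)) by (apply ln_le_compat; lra).
  pose proof (H (2 * n)%nat (x' - x)%Z ltac:(lia) ltac:(lia) ltac:(lia)) as h.
  rewrite mult_INR in h. replace (INR 2) with 2 in h by (simpl; lra). rewrite ln_mult in h by lra.
  pose proof (msin_minus_le (2 * th + IZR x' * alpha) (2 * th + IZR x * alpha)) as h2.
  replace (2 * th + IZR x' * alpha - (2 * th + IZR x * alpha)) with (IZR (x' - x) * alpha) in h2
    by (rewrite minus_IZR; ring).
  assert (h3 : 2 * exp (- (2 * p + 1) * ln (INR n)) <= exp (- p * (ln 2 + ln (INR n)))).
  { rewrite <- (exp_ln 2) at 1 by lra. rewrite <- exp_plus. apply exp_mono. nra. }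
  lra.
Qed.

Lemma resonance_exists alpha p (n : nat) th : dioph_exp alpha p -> 0 <= p -> (2 <= n)%nat ->
  exists x1, forall x, (Z.abs x <= Z.of_nat n)%Z -> x <> x1 ->
    exp (- (2 * p + 1) * ln (INR n)) <= msin (2 * th + IZR x * alpha).
Proof.
  intros H hp hn.
  destruct (classic (exists x, (Z.abs x <= Z.of_nat n)%Z /\
    msin (2 * th + IZR x * alpha) < exp (- (2 * p + 1) * ln (INR n)))) as [[x1 [h1 h2]]|hno].
  - exists x1. intros x hx hne. apply (unique_resonance alpha p n th x1 x); auto.
  (* Without a strong reflection any exceptional site is admissible; 0 is a default. *)
  - exists 0%Z. intros x hx _. apply Rnot_lt_le. intros h. apply hno. now exists x.
Qed.

(** * Upper bound for the determinants *)

Lemma log_le_linear A C0 c : 0 <= A -> 0 <= C0 -> 0 < c ->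
  exists K0 : nat, forall K : nat, (K0 <= K)%nat -> A * ln (INR K) + C0 <= c * INR K.
Proof.
  intros hA hC hc. destruct (linear_le_exp A 1 (c / (1 + C0))) as [Y hY]; [easy|lra|apply Rdiv_lt_0_compat; lra|].
  destruct (INR_unbounded (exp (Rmax 0 Y))) as [N hN]. exists (S N). intros K hK.
  assert (h1 : exp (Rmax 0 Y) <= INR K) by (apply Rle_trans with (INR N); [lra|apply le_INR; lia]).
  pose proof (exp_pos (Rmax 0 Y)).
  assert (h2 : Rmax 0 Y <= ln (INR K)) by (rewrite <- (ln_exp (Rmax 0 Y)); now apply ln_le_compat).
  pose proof (Rmax_l 0 Y). pose proof (Rmax_r 0 Y).
  specialize (hY (ln (INR K)) ltac:(lra)). rewrite Rmult_1_l, exp_ln in hY by lra.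
  assert (h3 : (1 + C0) * (1 + A * ln (INR K)) <= c * INR K).
  { apply Rle_trans with ((1 + C0) * (c / (1 + C0) * INR K)); [apply Rmult_le_compat_l; lra|].
    right. field. lra. }
  assert (0 <= A * ln (INR K)) by (apply Rmult_le_pos; lra). nra.
Qed.

Lemma nat_ceil x : 0 <= x -> exists n : nat, x <= INR n <= x + 1.
Proof.
  intros hx. exists (Z.to_nat (up x)). destruct (archimed x) as [h1 h2].
  assert (0 <= up x)%Z by (apply le_IZR; lra).
  rewrite INR_IZR_INZ, Z2Nat.id by easy. lra.
Qed.

Lemma exp_ge1 x : 0 <= x -> 1 <= exp x.
Proof. intros h. rewrite <- exp_0. now apply exp_mono. Qed.

Lemma exp_le1 x : x <= 0 -> exp x <= 1.
Proof. intros h. rewrite <- exp_0. now apply exp_mono. Qed.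

Lemma le_exp_self x : x <= exp x.
Proof. pose proof (exp_ineq1_le x). lra. Qed.

Definition bounded_state (lambda alpha E theta : R) (psi : Z -> R) : Prop :=
  (forall z, Rabs (psi z) <= 1) /\ psi 0%Z = 1 /\ (forall z, resid lambda alpha E theta psi z = 0).

Lemma bounded_state_energy lambda alpha E theta psi : 0 <= lambda ->
  bounded_state lambda alpha E theta psi -> Rabs E <= 2 * lambda + 2.
Proof.
  intros hl [Hb [H0 Hr]]. specialize (Hr 0%Z). unfold resid, pot in Hr. rewrite H0 in Hr.
  pose proof (Hb (0 + 1)%Z) as h1. pose proof (Hb (0 - 1)%Z) as h2.
  apply Rabs_le_between in h1, h2. pose proof (COS_bound (2 * PI * (theta + IZR 0 * alpha))).
  apply Rabs_le. nra.
Qed.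

Lemma exp_pow_nat lambda k : 0 < lambda -> lambda ^ k = exp (INR k * ln lambda).
Proof. intros h. rewrite <- exp_pow, exp_ln; easy. Qed.

(** Green's formula at 0, where [u] equals 1, bounds the whole determinant by those of the two
    parts. Each part has length at most [k - 1 - d], which gains [exp (- d L)] over [exp (r K)]; the
    residual adds a term of order [f0 G^2 K]. *)
Lemma deep_box_small lambda alpha E theta (u : Z -> R) r G f0 L K k d a :
  0 <= r -> 0 <= G -> 0 <= f0 -> L <= r -> (k <= K)%nat -> (1 <= d)%nat -> (2 * d < k)%nat ->
  (forall z, Rabs (u z) <= 1) -> u 0%Z = 1 ->
  (forall z, (Z.abs z <= Z.of_nat K)%Z -> Rabs (resid lambda alpha E theta u z) <= f0) ->
  (forall j phi, (j <= K)%nat -> Rabs (boxdet lambda alpha E phi j) <= G * exp (INR j * r)) ->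
  In a (zlist (- Z.of_nat (k - 1) + Z.of_nat d) (k - 2 * d)) ->
  Rabs (boxdet lambda alpha E (theta + IZR a * alpha) k)
    <= exp (r * INR K) * (2 * G * exp (- (INR d * L)) + 2 * f0 * G * G * INR K).
Proof.
  intros hr hG hf hL hk hd hdk Hb H0 Hf HD ha. apply zlist_In in ha.
  set (i := Z.to_nat (- a)). set (m := (k - 1 - i)%nat).
  assert (hi : (d <= i <= k - 1 - d)%nat) by (unfold i; lia).
  assert (hm : (d <= m <= k - 1 - d)%nat) by (unfold m; lia).
  assert (him : S (i + m) = k) by (unfold m; lia).
  assert (hai : (a + Z.of_nat i = 0)%Z) by (unfold i; lia).
  assert (hside : forall j, (d <= j <= k - 1 - d)%nat -> exp (INR j * r) <= exp (r * INR K) * exp (- (INR d * L))).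
  { intros j hj. rewrite <- exp_plus. apply exp_mono.
    assert (INR j + INR d <= INR K) by (rewrite <- plus_INR; apply le_INR; lia).
    pose proof (pos_INR d). nra. }
  assert (hkr : forall j1 j2, (j1 + j2 <= k - 1)%nat -> exp (INR j1 * r) * exp (INR j2 * r) <= exp (r * INR K)).
  { intros j1 j2 hj. rewrite <- exp_plus. apply exp_mono.
    assert (INR j1 + INR j2 <= INR K) by (rewrite <- plus_INR; apply le_INR; lia). nra. }
  pose proof (green lambda alpha E theta u f0 a i m) as Hg.
  rewrite him, hai, H0, Rabs_R1, Rmult_1_r in Hg.
  specialize (Hg ltac:(intros; apply Hf; lia)).
  eapply Rle_trans; [apply Hg|].
  assert (hsum : forall (F : nat -> R) n1 n2, (n1 + n2 <= k)%nat -> (n2 <= k - 1)%nat ->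
     (forall j, (j < n2)%nat -> exists phi, F j = boxdet lambda alpha E phi j) ->
     forall D0, (exists phi, D0 = boxdet lambda alpha E phi n1) ->
     Rabs D0 * (f0 * sumL (fun j => Rabs (F j)) (seq 0 n2)) <= f0 * G * G * INR K * exp (r * INR K)).
  { intros F n1 n2 hn hn2 HF D0 [phi0 ->].
    apply Rle_trans with (G * exp (INR n1 * r) * (f0 * (INR n2 * (G * exp (INR (n2 - 1) * r))))).
    - apply Rmult_le_compat; [apply Rabs_pos| |apply HD; lia|].
      + apply Rmult_le_pos; [easy|]. apply Rle_trans with (sumL (fun _ => 0 * 0) (seq 0 n2)); [rewrite sumL_scal; lra|].
        apply sumL_le. intros; rewrite Rmult_0_l; apply Rabs_pos.
      + apply Rmult_le_compat_l; [easy|]. rewrite <- (length_seq n2 0) at 2. apply sumL_le_const.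
        intros j hj. apply in_seq in hj. destruct (HF j ltac:(lia)) as [phi ->].
        eapply Rle_trans; [apply HD; lia|]. apply Rmult_le_compat_l; [easy|]. apply exp_mono.
        apply Rmult_le_compat_r; [easy|]. apply le_INR. lia.
    - destruct n2 as [|n2].
      + simpl (INR 0). rewrite Rmult_0_l, !Rmult_0_r. pose proof (exp_pos (r * INR K)). pose proof (pos_INR K).
        repeat apply Rmult_le_pos; lra.
      + replace (G * exp (INR n1 * r) * (f0 * (INR (S n2) * (G * exp (INR (S n2 - 1) * r)))))
          with (f0 * G * G * INR (S n2) * (exp (INR n1 * r) * exp (INR (S n2 - 1) * r))) by ring.
        assert (0 <= f0 * G * G) by (repeat apply Rmult_le_pos; easy).
        apply Rmult_le_compat.
        * apply Rmult_le_pos; [easy|apply pos_INR].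
        * apply Rmult_le_pos; left; apply exp_pos.
        * apply Rmult_le_compat_l; [easy|]. apply le_INR. lia.
        * apply hkr. lia. }
  assert (h1 := hsum (fun j => boxdet lambda alpha E (theta + IZR a * alpha) j) m (S i) ltac:(lia) ltac:(lia)
     ltac:(intros; eexists; reflexivity) _ (ex_intro _ (theta + IZR (0 + 1) * alpha) eq_refl)).
  assert (h2 := hsum (fun j => boxdet lambda alpha E (theta + IZR (a + Z.of_nat (i + m) + 1 - Z.of_nat j) * alpha) j) i m ltac:(lia) ltac:(lia)
     ltac:(intros; eexists; reflexivity) _ (ex_intro _ (theta + IZR a * alpha) eq_refl)).
  assert (h3 : forall n phi z, (d <= n <= k - 1 - d)%nat ->
     Rabs (boxdet lambda alpha E phi n) * Rabs (u z) <= G * (exp (r * INR K) * exp (- (INR d * L)))).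
  { intros n phi z hn. rewrite <- (Rmult_1_r (G * _)). apply Rmult_le_compat; try apply Rabs_pos; [|easy].
    eapply Rle_trans; [apply HD; lia|]. apply Rmult_le_compat_l; [easy|]. now apply hside. }
  pose proof (h3 m (theta + IZR (0 + 1) * alpha) (a - 1)%Z hm).
  pose proof (h3 i (theta + IZR a * alpha) (a + Z.of_nat (i + m) + 1)%Z hi).
  rewrite !Rmult_plus_distr_l. lra.
Qed.

Lemma one_le_two_div t : 0 < t <= 1 -> 1 <= 2 / t.
Proof.
  intros h. apply (Rmult_le_reg_r t); [lra|]. replace (2 / t * t) with 2 by (field; lra). lra.
Qed.

Lemma one_le_mult a b : 1 <= a -> 1 <= b -> 1 <= a * b.
Proof. nra. Qed.

Lemma prod3_unit a b c : 0 < a <= 1 -> 0 < b <= 1 -> 0 < c <= 1 -> 0 < a * b * c <= 1.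
Proof.
  intros ha hb hc. assert (0 < a * b <= 1) by nra. nra.
Qed.

(** Dirichlet's theorem with bound about [exp (c K)]. The Diophantine condition keeps the
    denominator above the [p]-th root of that bound, up to a constant, so [q] and [Q] are both
    exponential in [K]. *)
Lemma approximant_denominator alpha p c (K : nat) : dioph_exp alpha p -> 1 <= p -> 0 <= c ->
  exists (q Q : nat) (P : Z), (1 <= q <= Q)%nat /\ Rabs (INR q * alpha - IZR P) <= / INR Q /\
    exp (c * INR K) <= INR Q <= 2 * exp (c * INR K) /\
    exp (c * INR K / p - 3) <= INR q + 1.
Proof.
  intros hd hp hc. assert (hcK : 0 <= c * INR K) by (apply Rmult_le_pos; [easy|apply pos_INR]).
  assert (he1 : 1 <= exp (c * INR K)) by (rewrite <- exp_0; now apply exp_mono).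
  destruct (nat_ceil (exp (c * INR K))) as [Q hQ]; [lra|].
  assert (hQ1 : (1 <= Q)%nat) by (apply INR_le; simpl; lra).
  destruct (dirichlet alpha Q hQ1) as [q [P [hq [_ ha]]]].
  exists q, Q, P. split; [easy|]. split; [easy|]. split; [lra|].
  assert (hqr : 1 <= INR q) by (apply (le_INR 1); lia).
  pose proof (hd (q + 1)%nat (Z.of_nat q) ltac:(lia) ltac:(lia) ltac:(lia)) as h1.
  rewrite plus_INR in h1. simpl (INR 1) in h1.
  assert (h2 : msin (IZR (Z.of_nat q) * alpha) <= 8 / INR Q).
  { rewrite <- (msin_int _ (- P)), opp_IZR, <- INR_IZR_INZ.
    eapply Rle_trans; [apply msin_lip0|]. pose proof PI_4. pose proof PI_RGT_0.
    pose proof (Rabs_pos (INR q * alpha + - IZR P)). unfold Rminus in ha. unfold Rdiv. nra. }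
  assert (h3 : ln (8 / INR Q) <= 3 - c * INR K).
  { rewrite ln_div by lra.
    assert (ln 8 <= 3).
    { replace 8 with (2 * (2 * 2)) by lra. rewrite !ln_mult by lra. pose proof ln2_le1. lra. }
    assert (c * INR K <= ln (INR Q)); [|lra].
    rewrite <- (ln_exp (c * INR K)). apply ln_le_compat; lra. }
  assert (h4 : - p * ln (INR q + 1) <= 3 - c * INR K).
  { eapply Rle_trans; [|apply h3]. rewrite <- (ln_exp (- p * _)). apply ln_le_compat; [apply exp_pos|lra]. }
  rewrite <- (exp_ln (INR q + 1)) by lra. apply exp_mono.
  assert (h5 : c * INR K / p <= 3 / p + ln (INR q + 1)).
  { apply (Rmult_le_reg_r p); [lra|]. unfold Rdiv. rewrite Rmult_plus_distr_r, !Rmult_assoc, Rinv_l, !Rmult_1_r by lra. lra. }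
  assert (3 / p <= 3); [|lra].
  apply (Rmult_le_reg_r p); [lra|]. unfold Rdiv. rewrite Rmult_assoc, Rinv_l by lra. lra.
Qed.

(* Fast growth at an energy of a bounded state is impossible: the same growth would hold at the
   nearby energy of a state of a periodic approximant whose phase has no strong reflection, and there
   interpolation through the small determinants of the boxes around the maximum bounds the growth. *)
Lemma no_fast_growth lambda alpha p eps : 1 < lambda -> dioph_exp alpha p -> 1 <= p -> 0 < eps ->
  exists (e2 : R) (K0 : nat), 0 < e2 /\ forall (K : nat) E theta psi r, (K0 <= K)%nat ->
    bounded_state lambda alpha E theta psi -> ln lambda + eps < r ->
    (forall j phi, (j <= K)%nat -> Rabs (boxdet lambda alpha E phi j) <= exp (INR j * r + e2 * INR K)) ->
    (exists k phi, (k <= K)%nat /\ exp (r * INR K) <= 4 * Rabs (boxdet lambda alpha E phi k)) -> False.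
Proof.
  intros hl hd hp heps.
  set (L := ln lambda). assert (hL : 0 < L) by (unfold L; rewrite <- ln_1; apply ln_increasing; lra).
  set (R1 := 4 * lambda + 6).
  assert (hR1 : 10 <= R1) by (unfold R1; lra).
  (* The far nodes are so distant that the two corrections of the leading term cost at most
     [eps / 8] per unit of length, and each ratio of far factors at most [L / 128] in the
     exponent. *)
  set (B := 2 + 8 * (1 + R1) / eps + 256 / L).
  assert (hB1 : 0 < 8 * (1 + R1) / eps) by (apply Rdiv_lt_0_compat; lra).
  assert (hB2 : 0 < 256 / L) by (apply Rdiv_lt_0_compat; lra).
  assert (hB : 2 <= B) by (unfold B; lra).
  assert (hBeps : (1 + R1) / (B - 1) <= eps / 8).
  { apply (Rmult_le_reg_r (B - 1)); [lra|]. unfold Rdiv at 1. rewrite Rmult_assoc, Rinv_l, Rmult_1_r by lra.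
    apply Rle_trans with (eps / 8 * (8 * (1 + R1) / eps)); [right; field; lra|].
    apply Rmult_le_compat_l; [lra|unfold B; lra]. }
  assert (hBL : 2 / (B - 1) <= L / 128).
  { apply (Rmult_le_reg_r (B - 1)); [lra|]. unfold Rdiv at 1. rewrite Rmult_assoc, Rinv_l, Rmult_1_r by lra.
    apply Rle_trans with (L / 128 * (256 / L)); [right; field; lra|].
    apply Rmult_le_compat_l; [lra|unfold B; lra]. }
  set (W := ln (72 * B * B)).
  assert (hBB : 4 <= B * B) by nra.
  assert (hW : 0 < W) by (unfold W; rewrite <- ln_1; apply ln_increasing; lra).
  (* [d] will be about [e4 K]. The cap [1/8] keeps [2 d < k], and the other one keeps
     [(72 B^2) ^ (2 d + 1)] below [exp (eps K / 16)] up to a constant. *)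
  set (e4 := Rmin (1/8) (eps / (32 * W))).
  assert (he4 : 0 < e4) by (apply Rmin_glb_lt; [lra|apply Rdiv_lt_0_compat; lra]).
  assert (he4a : e4 <= 1/8) by apply Rmin_l.
  assert (he4W : e4 * W <= eps / 32).
  { apply Rle_trans with (eps / (32 * W) * W); [apply Rmult_le_compat_r; [lra|apply Rmin_r]|right; field; lra]. }
  (* [Q] will be about [exp (c2 K)], so the gain exponent [d L] is at least [8 c2 K], which pays for
     the factor [q] lost at a resonance. *)
  set (c2 := e4 * L / 8). assert (hc2 : 0 < c2) by (unfold c2; assert (0 < e4 * L) by (now apply Rmult_lt_0_compat); lra).
  (* Then [q] is at least about [exp (15 e2 K)], above the size [kap ^ (-4) = exp (12 e2 K)] that
     the truncation to a ring demands. *)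
  set (e2 := c2 / (15 * p)). assert (he2 : 0 < e2) by (apply Rdiv_lt_0_compat; lra).
  assert (he2c : 15 * (p * e2) = c2) by (unfold e2; field; lra).
  assert (he2c' : 15 * e2 <= c2) by nra.
  set (ep := Rmin (c2 / 64) (eps / 64)).
  assert (hep : 0 < ep) by (apply Rmin_glb_lt; lra).
  assert (hep1 : ep <= c2 / 64) by apply Rmin_l. assert (hep2 : ep <= eps / 64) by apply Rmin_r.
  set (p' := 2 * p + 1).
  destruct (sine_product_bounds alpha p' ep) as [N1 hN1];
    [apply (dioph_exp_mono alpha p); [unfold p'; lra|easy]|unfold p'; lra|easy|].
  set (cc := Rmin e2 (eps / 4)).
  assert (hcc : 0 < cc) by (apply Rmin_glb_lt; lra).
  destruct (log_le_linear (8 * p + 20) (200000 + 8 * L + 8 * W + 10 * lambda) cc) as [N2 hN2]; [lra|lra|easy|].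
  exists e2, (N1 + N2 + 2)%nat. split; [easy|].
  intros K E theta psi r hK Hst hr HD [k [phs [hkK Hbig]]].
  assert (hbigK := hN2 K ltac:(lia)).
  assert (hK2 : 2 <= INR K) by (apply (le_INR 2); lia).
  set (x2 := e2 * INR K). set (xc := c2 * INR K). set (y := ln (INR K)).
  assert (hy : 0 <= y) by (unfold y; rewrite <- ln_1; apply ln_le_compat; lra).
  assert (hx2 : 15 * x2 <= xc) by (unfold x2, xc; nra).
  assert (hpx2 : xc / p = 15 * x2) by (unfold xc, x2; rewrite <- he2c; field; lra).
  assert (hbig2 : (8 * p + 20) * y + (200000 + 8 * L + 8 * W + 10 * lambda) <= x2).
  { eapply Rle_trans; [apply hbigK|]. apply Rmult_le_compat_r; [lra|apply Rmin_l]. }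
  assert (hbig3 : (8 * p + 20) * y + (200000 + 8 * L + 8 * W + 10 * lambda) <= eps / 4 * INR K).
  { eapply Rle_trans; [apply hbigK|]. apply Rmult_le_compat_r; [lra|apply Rmin_r]. }
  assert (hpy : 0 <= p * y) by nra.
  assert (hKexp : INR K = exp y) by (unfold y; rewrite exp_ln; lra).
  assert (hbig4 : 8 * (p * y) + 20 * y + (200000 + 8 * L + 8 * W + 10 * lambda) <= x2) by lra.
  assert (hpy' : p' * y = 2 * (p * y) + y) by (unfold p'; ring).
  set (G := exp x2). assert (hG1 : 1 <= G) by (unfold G; rewrite <- exp_0; apply exp_mono; lra).
  assert (hr0 : 0 < r) by lra.
  destruct Hst as [Hb [H0 Hres]].
  assert (HE : Rabs E <= 2 * lambda + 2).
  { apply (bounded_state_energy lambda alpha E theta psi); [lra|now split]. }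
  assert (HD' : forall j phi, (j <= K)%nat -> Rabs (boxdet lambda alpha E phi j) <= G * exp (INR j * r)).
  { intros j phi hj. eapply Rle_trans; [now apply HD|]. unfold G. rewrite <- exp_plus. apply exp_mono. unfold x2; lra. }
  destruct (approximant_denominator alpha p c2 K hd hp ltac:(lra)) as [q [Q [P [hq [ha [hQ hqbig]]]]]].
  fold xc in hQ, hqbig. rewrite hpx2 in hqbig.
  assert (hqr : 1 <= INR q) by (apply (le_INR 1); lia).
  assert (hQr : INR q <= INR Q) by (apply le_INR; lia).
  (* The exponent 3 beats the two factors [G = exp x2] of the perturbation bound and leaves
     [exp (- x2)] to absorb [K]. *)
  set (kap := exp (- (3 * x2))). assert (hkap : 0 < kap) by apply exp_pos.
  assert (hkap4 : 8 / kap ^ 4 = 8 * exp (12 * x2)).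
  { unfold kap. rewrite exp_pow. unfold Rdiv. rewrite <- exp_Ropp. f_equal. f_equal. simpl; ring. }
  destruct (nat_ceil (8 / kap ^ 4 + 2)) as [i hi].
  { assert (0 < 8 / kap ^ 4) by (apply Rdiv_lt_0_compat; [lra|now apply pow_lt]). lra. }
  assert (h12 : 1 <= exp (12 * x2)) by (rewrite <- exp_0; apply exp_mono; lra).
  assert (hq12 : 48 * exp (12 * x2) <= INR q + 1).
  { eapply Rle_trans; [|apply hqbig]. apply Rle_trans with (exp 48 * exp (12 * x2)).
    - apply Rmult_le_compat_r; [lra|apply le_exp_self].
    - rewrite <- exp_plus. apply exp_mono. lra. }
  assert (hiq : (4 * i + 3 <= q)%nat).
  { apply INR_le. rewrite plus_INR, mult_INR. replace (INR 4) with 4 by (simpl; lra).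
    replace (INR 3) with 3 by (simpl; lra). rewrite hkap4 in hi. lra. }
  assert (hlq : 32 * lambda / INR q <= kap).
  { apply (Rmult_le_reg_r (INR q)); [lra|]. unfold Rdiv. rewrite Rmult_assoc, Rinv_l, Rmult_1_r by lra.
    apply Rle_trans with (kap * (32 * exp (12 * x2))); [|apply Rmult_le_compat_l; lra].
    replace (kap * (32 * exp (12 * x2))) with (32 * exp (9 * x2)).
    - apply Rmult_le_compat_l; [lra|]. pose proof (le_exp_self (9 * x2)). lra.
    - unfold kap. replace (9 * x2) with (- (3 * x2) + 12 * x2) by ring. rewrite exp_plus. ring. }
  destruct (ring_solution lambda alpha E theta psi q Q i P kap ltac:(lra) hq ha Hb H0 Hres hkap ltac:(lra) hiq hlq)
    as [E' [th' [u [hE' [Hub [Hu0 [Hures Hunr]]]]]]].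
  assert (hkap1 : kap <= 1) by (unfold kap; rewrite <- exp_0; apply exp_mono; lra).
  assert (HE' : Rabs E' <= 2 * lambda + 4).
  { replace E' with (E' - E + E) by ring. eapply Rle_trans; [apply Rabs_triang|]. lra. }
  assert (hEE : Rabs (E - E') <= 2 * kap) by now rewrite Rabs_minus_sym.
  assert (hGx : kap * G = exp (- (2 * x2))).
  { unfold kap, G. rewrite <- exp_plus. f_equal. ring. }
  assert (hGxx : kap * G * G = exp (- x2)).
  { unfold kap, G. rewrite <- !exp_plus. f_equal. ring. }
  assert (hsm : 32 * INR K * exp (- x2) <= 1).
  { rewrite hKexp. apply Rle_trans with (exp 32 * exp y * exp (- x2)).
    - pose proof (le_exp_self 32). repeat apply Rmult_le_compat_r; try (left; apply exp_pos). easy.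
    - rewrite <- !exp_plus. rewrite <- exp_0. apply exp_mono. lra. }
  assert (Hgr := gronwall lambda alpha E E' r G K ltac:(lra) hG1 HD').
  assert (hcond : 2 * Rabs (E - E') * G * INR K <= 1).
  { apply Rle_trans with (2 * (2 * kap) * G * INR K).
    - repeat apply Rmult_le_compat_r; try lra.
    - replace (2 * (2 * kap) * G * INR K) with (4 * INR K * (kap * G)) by ring. rewrite hGx.
      assert (h1 : exp (- (2 * x2)) <= exp (- x2)) by (apply exp_mono; lra).
      assert (h2 : 0 <= INR K * exp (- x2)) by (apply Rmult_le_pos; [lra|left; apply exp_pos]).
      apply Rle_trans with (4 * INR K * exp (- x2)); [apply Rmult_le_compat_l; lra|lra]. }
  specialize (Hgr hcond).
  set (G' := 2 * G).
  assert (HDG : forall j phi, (j <= K)%nat -> Rabs (boxdet lambda alpha E' phi j) <= G' * exp (INR j * r)).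
  { intros j phi hj. now apply Hgr. }
  assert (HM : exp (r * INR K) <= 8 * Rabs (boxdet lambda alpha E' phs k)).
  { destruct (Hgr k phs hkK) as [_ h].
    assert (h2 : 2 * Rabs (E - E') * G * G * INR K * exp (INR k * r) <= / 8 * exp (r * INR K)).
    { apply Rmult_le_compat; try (left; apply exp_pos).
      - pose proof (Rabs_pos (E - E')). repeat apply Rmult_le_pos; lra.
      - apply Rle_trans with (2 * (2 * kap) * G * G * INR K).
        + repeat apply Rmult_le_compat_r; lra.
        + replace (2 * (2 * kap) * G * G * INR K) with (4 * INR K * (kap * G * G)) by ring. rewrite hGxx. lra.
      - apply exp_mono. rewrite Rmult_comm. apply Rmult_le_compat_l; [lra|]. now apply le_INR. }
    pose proof (Rabs_triang_inv (boxdet lambda alpha E phs k) (boxdet lambda alpha E' phs k)) as h3.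
    rewrite Rabs_minus_sym in h3. lra. }
  (* A box shorter than [K / 2] cannot reach [exp (r K)] within the assumed growth. *)
  assert (hk2 : INR K <= 2 * INR k).
  { assert (h1 : exp (r * INR K) <= exp (4 + (INR k * r + e2 * INR K))).
    { eapply Rle_trans; [apply Hbig|]. rewrite exp_plus. apply Rmult_le_compat; [lra|apply Rabs_pos|apply le_exp_self|].
      now apply HD. }
    assert (h2 : r * INR K <= 4 + (INR k * r + e2 * INR K)).
    { apply Rnot_lt_le. intros h. apply exp_increasing in h. lra. }
    apply Rnot_lt_le. intros h.
    assert (h3 : INR K / 2 * L <= (INR K - INR k) * r) by (apply Rmult_le_compat; lra).
    assert (he2L : e2 * INR K <= L / 64 * INR K).
    { apply Rmult_le_compat_r; [lra|]. apply Rle_trans with c2; [lra|]. unfold c2.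
      assert (e4 * L <= 1/8 * L) by (apply Rmult_le_compat_r; lra). lra. }
    assert (4 < L / 64 * INR K); [|lra]. unfold x2 in hbig2. lra. }
  destruct (nat_ceil (e4 * INR K)) as [d0 hd0]; [apply Rmult_le_pos; lra|].
  set (d := S d0). assert (hdR : INR d = INR d0 + 1) by apply S_INR.
  assert (hK64 : 64 <= INR K).
  { unfold x2 in hbig2. assert (e2 <= L / 64) by (unfold c2 in he2c'; assert (e4 * L <= 1/8 * L) by (apply Rmult_le_compat_r; lra); lra).
    assert (e2 * INR K <= L / 64 * INR K) by (apply Rmult_le_compat_r; lra).
    assert (8 * L <= L / 64 * INR K) by lra.
    apply (Rmult_le_reg_l (L / 64)); [lra|]. lra. }
  assert (hdk : (2 * d < k)%nat).
  { apply INR_lt. rewrite mult_INR. replace (INR 2) with 2 by (simpl; lra).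
    assert (e4 * INR K <= 1/8 * INR K) by (apply Rmult_le_compat_r; lra). lra. }
  set (f0 := 16 * lambda * INR K / (INR q * INR Q)).
  assert (hqQ : 0 < INR q * INR Q) by (apply Rmult_lt_0_compat; lra).
  assert (hf0 : 0 <= f0) by (apply Rdiv_le_0_compat; [apply Rmult_le_pos; lra|easy]).
  assert (Hf : forall z, (Z.abs z <= Z.of_nat K)%Z -> Rabs (resid lambda alpha E' th' u z) <= f0).
  { intros z hz. eapply Rle_trans; [apply Hures|]. unfold f0, Rdiv.
    apply Rmult_le_compat_r; [left; now apply Rinv_0_lt_compat|].
    apply Rmult_le_compat_l; [lra|]. rewrite INR_IZR_INZ. now apply IZR_le. }
  set (bb := exp (r * INR K) * (2 * G' * exp (- (INR d * L)) + 2 * f0 * G' * G' * INR K)).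
  assert (hG'0 : 0 < G') by (unfold G'; lra).
  assert (Hdeep := deep_box_small lambda alpha E' th' u r G' f0 L K k d).
  destruct (box_polynomial lambda alpha E' k) as [Qp [HQ [HQD HQB]]]; [lra|].
  set (bet := (INR k - 1) / 2 * alpha).
  set (om := th' + bet).
  set (s := exp (- p' * y)).
  assert (hs : 0 < s <= 1).
  { split; [apply exp_pos|]. unfold s. rewrite <- exp_0. apply exp_mono. lra. }
  destruct (resonance_exists alpha p K th' hd ltac:(lra) ltac:(lia)) as [x1 Hx1].
  fold p' y in Hx1. fold s in Hx1.
  set (a0 := (- Z.of_nat (k - 1) + Z.of_nat d)%Z).
  assert (hkR : 1 <= INR k) by (apply (le_INR 1); lia).
  assert (Esum : forall i j, 2 * om + IZR (i + j) * alpha = 2 * th' + IZR (i + j + Z.of_nat (k - 1)) * alpha).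
  { intros i0 j0. unfold om, bet. rewrite (plus_IZR (i0 + j0)), <- INR_IZR_INZ, minus_INR by lia. simpl (INR 1). field. }
  assert (hK16 : forall x, (Z.abs x <= Z.of_nat K)%Z -> 16 * IZR (Z.abs x) <= INR Q).
  { intros x hx. apply Rle_trans with (16 * INR K).
    - apply Rmult_le_compat_l; [lra|]. rewrite INR_IZR_INZ. now apply IZR_le.
    - eapply Rle_trans; [|apply hQ]. rewrite hKexp. apply Rle_trans with (exp 16 * exp y).
      + apply Rmult_le_compat_r; [left; apply exp_pos|apply le_exp_self].
      + rewrite <- exp_plus. apply exp_mono. lra. }
  (* Half of the lower bound for the reflections of the approximant, as the interpolation asks for
     [2 * rho]. *)
  set (rho := / (4 * INR q)).
  assert (hrho : 0 < rho <= 1).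
  { unfold rho. split; [apply Rinv_0_lt_compat; lra|]. rewrite <- Rinv_1. apply Rinv_le_contravar; lra. }
  assert (hzin : forall i, In i (zlist a0 (k - 2 * d)) -> (- Z.of_nat (k - 1) + Z.of_nat d <= i <= - Z.of_nat d)%Z).
  { intros i0 hi0. apply zlist_In in hi0. unfold a0 in hi0. lia. }
  pose proof (interpolation_bound lambda alpha E' k d s ep K om a0 B bb rho (phs + bet) Qp
     (x1 - Z.of_nat (k - 1)) R1) as Hint.
  cbv zeta in Hint.
  assert (HQv : Qp (cos (2 * PI * (phs + bet))) = boxdet lambda alpha E' phs k).
  { rewrite <- HQD. f_equal. unfold bet. ring. }
  rewrite HQv in Hint.
  assert (Hfin := Hint ltac:(lra) ltac:(unfold d; lia) hdk hkK hs).
  clear Hint.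
  assert (Hsb : sine_bounds alpha s ep K) by (intros m x hm; apply hN1; [lia|easy]).
  specialize (Hfin Hsb hrho).
  assert (Hc1 : forall i j, In i (zlist a0 (k - 2 * d)) -> In j (zlist a0 (k - 2 * d)) -> i <> j ->
     s <= msin (IZR (i - j) * alpha)).
  { intros i0 j0 hi0 hj0 hij. apply hzin in hi0, hj0.
    eapply Rle_trans; [|apply (hd K); lia]. unfold s. fold y. apply exp_mono. lra. }
  assert (Hc2 : forall i j, In i (zlist a0 (k - 2 * d)) -> In j (zlist a0 (k - 2 * d)) -> i <> j ->
     (i + j)%Z <> (x1 - Z.of_nat (k - 1))%Z -> s <= msin (2 * om + IZR (i + j) * alpha)).
  { intros i0 j0 hi0 hj0 hij hne. apply hzin in hi0, hj0. rewrite Esum. apply Hx1; lia. }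
  assert (Hc3 : forall i j, In i (zlist a0 (k - 2 * d)) -> In j (zlist a0 (k - 2 * d)) -> i <> j ->
     (i + j)%Z = (x1 - Z.of_nat (k - 1))%Z -> 2 * rho <= msin (2 * om + IZR (i + j) * alpha)).
  { intros i0 j0 hi0 hj0 hij _. apply hzin in hi0, hj0. rewrite Esum.
    eapply Rle_trans; [|apply Hunr, hK16; lia]. unfold rho. right. field. lra. }
  assert (Hc4 : forall a, In a (zlist a0 (k - 2 * d)) -> Rabs (Qp (node alpha om a)) <= bb).
  { intros a ha0. unfold node. rewrite <- HQD.
    replace (om + IZR a * alpha - (INR k - 1) / 2 * alpha) with (th' + IZR a * alpha) by (unfold om, bet; ring).
    apply Hdeep; try easy; try lra; unfold d; lia. }
  specialize (Hfin Hc1 Hc2 Hc3 hB ltac:(unfold R1; lra) HQ HQB Hc4).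
  set (Z1 := exp (8 * ep * INR K) * (2 / (s * s * rho)) * exp (INR (2 * d + 1) * (2 / (B - 1)))) in *.
  set (xd := INR d * L).
  assert (h2d : INR (2 * d + 1) = 2 * INR d + 1).
  { rewrite plus_INR, mult_INR. simpl. lra. }
  assert (hxd1 : 8 * xc <= xd).
  { unfold xd, xc, c2. replace (8 * (e4 * L / 8 * INR K)) with (e4 * INR K * L) by field.
    apply Rmult_le_compat_r; lra. }
  assert (hxd2 : xd <= 8 * xc + 2 * L).
  { unfold xd, xc, c2. replace (8 * (e4 * L / 8 * INR K)) with (e4 * INR K * L) by field.
    rewrite <- Rmult_plus_distr_r. apply Rmult_le_compat_r; lra. }
  assert (hepx : 8 * ep * INR K <= xc / 8).
  { unfold xc. assert (ep * INR K <= c2 / 64 * INR K) by (apply Rmult_le_compat_r; lra). lra. }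
  assert (hdB : INR (2 * d + 1) * (2 / (B - 1)) <= xd / 64 + L / 128).
  { rewrite h2d. apply Rle_trans with ((2 * INR d + 1) * (L / 128)).
    - apply Rmult_le_compat_l; [pose proof (pos_INR d); lra|easy].
    - unfold xd. lra. }
  assert (hZ1 : Z1 <= 8 * INR q * exp (2 * (p' * y) + xc / 8 + (xd / 64 + L / 128))).
  { unfold Z1. replace (2 / (s * s * rho)) with (8 * INR q * exp (2 * (p' * y))).
    - replace (exp (8 * ep * INR K) * (8 * INR q * exp (2 * (p' * y))) * exp (INR (2 * d + 1) * (2 / (B - 1))))
        with (8 * INR q * (exp (2 * (p' * y)) * exp (8 * ep * INR K) * exp (INR (2 * d + 1) * (2 / (B - 1))))) by ring.
      apply Rmult_le_compat_l; [lra|]. rewrite <- !exp_plus. apply exp_mono. lra.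
    - assert (e : s * s = / exp (2 * (p' * y))).
      { unfold s. rewrite <- exp_plus, <- exp_Ropp. f_equal. ring. }
      rewrite e. unfold rho. pose proof (exp_pos (2 * (p' * y))). field. split; lra. }
  assert (hZ1' : 1 <= Z1).
  { unfold Z1.
    assert (a1 : 1 <= exp (8 * ep * INR K)) by (rewrite <- exp_0; apply exp_mono; repeat apply Rmult_le_pos; lra).
    assert (a3 : 1 <= exp (INR (2 * d + 1) * (2 / (B - 1)))).
    { apply exp_ge1, Rmult_le_pos; [apply pos_INR|apply Rdiv_le_0_compat; lra]. }
    assert (a2 : 1 <= 2 / (s * s * rho)).
    { assert (0 < s * s * rho <= 1).
      { apply prod3_unit; lra. }
      now apply one_le_two_div. }
    apply one_le_mult; [apply one_le_mult|]; easy. }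
  set (X := exp (r * INR K)) in *. assert (hX : 0 < X) by apply exp_pos.
  assert (hkk : INR k <= INR K) by now apply le_INR.
  set (b1 := 2 * G' * exp (- xd)). set (b2 := 2 * f0 * G' * G' * INR K).
  assert (hb1 : 0 <= b1) by (unfold b1; apply Rmult_le_pos; [lra|left; apply exp_pos]).
  assert (hb2 : 0 <= b2) by (unfold b2; apply Rmult_le_pos; [apply Rmult_le_pos; [apply Rmult_le_pos|]|]; lra).
  assert (hbb : bb = X * (b1 + b2)) by reflexivity.
  (* The resonance loss, with [q <= 2 exp xc], against the gain [exp (- xd)] of the deep boxes,
     where [xd >= 8 xc]. *)
  assert (hT1a : 2 * INR K * Z1 * b1 <= / 64).
  { apply Rle_trans with (2 * INR K * (8 * (2 * exp xc) * exp (2 * (p' * y) + xc / 8 + (xd / 64 + L / 128))) * b1).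
    - apply Rmult_le_compat_r; [easy|]. apply Rmult_le_compat_l; [lra|].
      eapply Rle_trans; [apply hZ1|]. apply Rmult_le_compat_r; [left; apply exp_pos|]. lra.
    - unfold b1, G', G. rewrite hKexp.
      replace (2 * exp y * (8 * (2 * exp xc) * exp (2 * (p' * y) + xc / 8 + (xd / 64 + L / 128))) * (2 * (2 * exp x2) * exp (- xd)))
        with (128 * (exp y * exp xc * exp (2 * (p' * y) + xc / 8 + (xd / 64 + L / 128)) * exp x2 * exp (- xd))) by ring.
      rewrite <- !exp_plus.
      apply Rle_trans with (exp 128 * exp (-1000)); [apply Rmult_le_compat; try (left; apply exp_pos)|].
      + lra.
      + apply le_exp_self.
      + apply exp_mono. lra.
      + rewrite <- exp_plus. apply Rle_trans with (exp (Ropp 64)); [apply exp_mono; lra|].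
        rewrite exp_Ropp. apply Rinv_le_contravar; [lra|apply le_exp_self]. }
  (* The factor [q] of the resonance loss cancels the one in [f0]; what remains of the residual is
     [1 / Q <= exp (- xc)], which absorbs [G^2]. *)
  assert (hT1b : 2 * INR K * Z1 * b2 <= / 64).
  { apply Rle_trans with (2 * INR K * (8 * INR q * exp (2 * (p' * y) + xc / 8 + (xd / 64 + L / 128))) * b2).
    - apply Rmult_le_compat_r; [easy|]. apply Rmult_le_compat_l; [lra|easy].
    - unfold b2, G', G, f0.
      assert (hQi : / INR Q <= exp (- xc)).
      { rewrite exp_Ropp. apply Rinv_le_contravar; [apply exp_pos|lra]. }
      replace (2 * INR K * (8 * INR q * exp (2 * (p' * y) + xc / 8 + (xd / 64 + L / 128))) *
        (2 * (16 * lambda * INR K / (INR q * INR Q)) * (2 * exp x2) * (2 * exp x2) * INR K))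
        with (2048 * lambda * (INR K * INR K * INR K * exp (2 * (p' * y) + xc / 8 + (xd / 64 + L / 128)) * exp x2 * exp x2) * / INR Q)
        by (field; lra).
      rewrite hKexp, <- !exp_plus.
      apply Rle_trans with (exp 2048 * exp lambda * exp (y + y + y + (2 * (p' * y) + xc / 8 + (xd / 64 + L / 128)) + x2 + x2) * exp (- xc)).
      + apply Rmult_le_compat; [|left; apply Rinv_0_lt_compat; lra| |easy].
        * apply Rmult_le_pos; [lra|left; apply exp_pos].
        * apply Rmult_le_compat_r; [left; apply exp_pos|].
          apply Rmult_le_compat; try lra; apply le_exp_self.
      + rewrite <- !exp_plus. apply Rle_trans with (exp (Ropp 64)).
        * apply exp_mono. lra.
        * rewrite exp_Ropp. apply Rinv_le_contravar; [lra|apply le_exp_self]. }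
  set (T2 := INR (2 * d + 1) * (lambda ^ k * exp (4 * ep * INR K) * (72 * B * B) ^ (2 * d + 1)
               * exp (INR k * (/ (B - 1))) * exp (INR k * (R1 / (2 * B))))) in *.
  (* Only here is [r > L + eps] used in full: the far nodes produce a growth rate of [L] plus a
     fraction of [eps]. *)
  assert (hT2 : T2 <= / 64 * X).
  { unfold T2. rewrite (exp_pow_nat lambda), (exp_pow_nat (72 * B * B)) by lra. fold L W.
    assert (hdK : INR (2 * d + 1) <= INR K).
    { rewrite h2d. assert (e4 * INR K <= 1/8 * INR K) by (apply Rmult_le_compat_r; lra). lra. }
    assert (a1 : INR k * L <= INR K * L) by (apply Rmult_le_compat_r; lra).
    assert (a2 : 4 * ep * INR K <= eps / 16 * INR K) by (apply Rmult_le_compat_r; lra).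
    assert (a3 : INR (2 * d + 1) * W <= eps / 16 * INR K + 5 * W).
    { rewrite h2d. assert (e4 * W * INR K <= eps / 32 * INR K) by (apply Rmult_le_compat_r; lra).
      assert (INR d * W <= (e4 * INR K + 2) * W) by (apply Rmult_le_compat_r; lra). lra. }
    assert (a45 : INR k * (/ (B - 1)) + INR k * (R1 / (2 * B)) <= eps / 8 * INR K).
    { rewrite <- Rmult_plus_distr_l, Rmult_comm. apply Rmult_le_compat; try lra; try apply pos_INR.
      - apply Rplus_le_le_0_compat; [left; apply Rinv_0_lt_compat; lra|apply Rdiv_le_0_compat; lra].
      - eapply Rle_trans; [|apply hBeps]. unfold Rdiv. rewrite Rmult_plus_distr_r, Rmult_1_l.
        apply Rplus_le_compat_l. apply Rmult_le_compat_l; [lra|]. apply Rinv_le_contravar; lra. }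
    apply Rle_trans with (exp y * (exp (INR K * L) * exp (eps / 16 * INR K) * exp (eps / 16 * INR K + 5 * W)
        * exp (INR k * (/ (B - 1))) * exp (INR k * (R1 / (2 * B))))).
    - rewrite <- hKexp. apply Rmult_le_compat; [apply pos_INR| |easy|].
      + repeat apply Rmult_le_pos; left; apply exp_pos.
      + repeat apply Rmult_le_compat_r; try (left; apply exp_pos).
        apply Rmult_le_compat; try (left; apply exp_pos);
          [apply Rmult_le_pos; left; apply exp_pos| |now apply exp_mono].
        apply Rmult_le_compat; try (left; apply exp_pos); now apply exp_mono.
    - rewrite <- !exp_plus. apply Rle_trans with (exp (-64 + r * INR K)).
      + apply exp_mono. assert ((L + eps) * INR K <= r * INR K) by (apply Rmult_le_compat_r; lra). lra.
      + rewrite exp_plus. fold X. apply Rmult_le_compat_r; [lra|].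
        change (exp (-64)) with (exp (Ropp 64)). rewrite exp_Ropp. apply Rinv_le_contravar; [lra|apply le_exp_self]. }
  assert (hT1 : bb + INR k * (bb * (exp (8 * ep * INR K) * (2 / (s * s * rho))) * exp (INR (2 * d + 1) * (2 / (B - 1))))
     <= X * (2 * INR K * Z1 * b1 + 2 * INR K * Z1 * b2)).
  { replace (bb * (exp (8 * ep * INR K) * (2 / (s * s * rho))) * exp (INR (2 * d + 1) * (2 / (B - 1))))
      with (bb * Z1) by (unfold Z1; ring).
    assert (0 <= bb) by (rewrite hbb; apply Rmult_le_pos; lra).
    assert (0 <= bb * Z1) by (apply Rmult_le_pos; lra).
    assert (INR k * (bb * Z1) <= INR K * (bb * Z1)) by (apply Rmult_le_compat_r; lra).
    assert (bb <= INR K * (bb * Z1)).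
    { rewrite <- (Rmult_1_l bb) at 1. apply Rmult_le_compat; try lra. rewrite <- (Rmult_1_r bb) at 1.
      apply Rmult_le_compat_l; lra. }
    replace (X * (2 * INR K * Z1 * b1 + 2 * INR K * Z1 * b2)) with (2 * (INR K * (bb * Z1))) by (rewrite hbb; ring).
    lra. }
  assert (X * (2 * INR K * Z1 * b1 + 2 * INR K * Z1 * b2) <= X * (/ 64 + / 64)) by (apply Rmult_le_compat_l; lra).
  lra.
Qed.

(** At the chosen scale a slope above [ln lambda + eps] is excluded by [no_fast_growth], and
    subadditivity carries the slope over to all lengths. The scale is at most [K1], which does not
    depend on the state, so neither does [C]. *)
Lemma box_growth lambda alpha p eps : 1 < lambda -> dioph_exp alpha p -> 1 <= p -> 0 < eps ->
  exists C, 1 <= C /\ forall E theta psi, bounded_state lambda alpha E theta psi ->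
    forall k phi, Rabs (boxdet lambda alpha E phi k) <= C * exp ((ln lambda + eps) * INR k).
Proof.
  intros hl hd hp heps.
  assert (hL : 0 < ln lambda) by (rewrite <- ln_1; apply ln_increasing; lra).
  destruct (no_fast_growth lambda alpha p eps hl hd hp heps) as [e2 [K0 [he2 Hno]]].
  set (R1 := 4 * lambda + 3).
  assert (hlR : 0 < ln R1) by (rewrite <- ln_1; apply ln_increasing; unfold R1; lra).
  destruct (scale_choice (1 + ln R1) e2 (S K0)) as [K1 HK1]; [lra|easy|lia|].
  exists (exp ((ln lambda + eps) * INR K1)). split.
  { apply exp_ge1, Rmult_le_pos; [lra|apply pos_INR]. }
  intros E theta psi Hst.
  assert (HE := bounded_state_energy lambda alpha E theta psi ltac:(lra) Hst).
  destruct (box_sup lambda alpha E R1) as [B [HB1 [HB2 [HB3 [HB4 [HB5 HB6]]]]]].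
  { rewrite Rabs_right by lra. unfold R1. lra. }
  set (b := fun K => ln (2 * B K)).
  assert (hb0 : forall K, 0 <= b K).
  { intros K. unfold b. rewrite <- ln_1. apply ln_le_compat; [lra|]. specialize (HB3 K). lra. }
  assert (hbe : forall K, exp (b K) = 2 * B K).
  { intros K. unfold b. apply exp_ln. specialize (HB3 K). lra. }
  assert (hbs : forall m n, b (m + n)%nat <= b m + b n).
  { intros m n. unfold b. pose proof (HB3 m). pose proof (HB3 n). pose proof (HB3 (m + n)%nat).
    rewrite <- ln_mult by lra. apply ln_le_compat; [lra|apply HB6]. }
  assert (hbm : forall m n, (m <= n)%nat -> b m <= b n).
  { intros m n h. unfold b. pose proof (HB3 m). apply ln_le_compat; [lra|]. specialize (HB5 m n h). lra. }
  destruct (HK1 b hbs hbm hb0) as [K [hK HKj]].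
  { intros K hK. assert (1 <= INR K) by (apply (le_INR 1); lia).
    unfold b. pose proof (HB3 K). rewrite ln_mult by lra.
    assert (ln (B K) <= INR K * ln R1).
    { rewrite <- (ln_exp (INR K * ln R1)). apply ln_le_compat; [lra|].
      rewrite <- exp_pow_nat by (unfold R1; lra). apply HB4. }
    pose proof ln2_le1. lra. }
  assert (hKr : 1 <= INR K) by (apply (le_INR 1); lia).
  set (r := b K / INR K) in *.
  assert (hrK : r * INR K = b K) by (unfold r; field; lra).
  assert (hr : r <= ln lambda + eps).
  { apply Rnot_lt_le. intros h. apply (Hno K E theta psi r ltac:(lia) Hst h).
    - intros j phi hj. apply Rle_trans with (exp (b j)).
      + rewrite hbe. pose proof (HB1 j j phi (le_n _)). pose proof (HB3 j). lra.
      + apply exp_mono. now apply HKj.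
    - destruct (HB2 K) as [k [phi [hk hkB]]]. exists k, phi. split; [easy|]. rewrite hrK, hbe. lra. }
  intros k phi. apply Rle_trans with (exp (b k)).
  - rewrite hbe. pose proof (HB1 k k phi (le_n _)). pose proof (HB3 k). lra.
  - rewrite <- exp_plus. apply exp_mono.
    eapply Rle_trans; [apply (subadditive_le b hbs hbm hb0 K k); lia|].
    replace ((INR k / INR K + 1) * b K) with ((INR k + INR K) * r) by (rewrite <- hrK; field; lra).
    assert (INR K <= INR K1) by (apply le_INR; lia).
    assert (0 <= r) by (apply Rdiv_le_0_compat; [easy|lra]).
    pose proof (pos_INR k).
    apply Rle_trans with ((INR k + INR K) * (ln lambda + eps)); [apply Rmult_le_compat_l; lra|].
    rewrite <- Rmult_plus_distr_l, Rmult_comm. apply Rmult_le_compat_l; lra.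
Qed.

(** * Exponential decay away from the maximum and its reflection *)

Lemma green_exact lambda alpha E theta psi a i m :
  (forall z, resid lambda alpha E theta psi z = 0) ->
  Rabs (boxdet lambda alpha E (theta + IZR a * alpha) (S (i + m))) * Rabs (psi (a + Z.of_nat i)%Z)
  <= Rabs (boxdet lambda alpha E (theta + IZR (a + Z.of_nat i + 1) * alpha) m) * Rabs (psi (a - 1)%Z)
     + Rabs (boxdet lambda alpha E (theta + IZR a * alpha) i) * Rabs (psi (a + Z.of_nat (i + m) + 1)%Z).
Proof.
  intros H. pose proof (green lambda alpha E theta psi 0 a i m) as h.
  rewrite !Rmult_0_l, !Rplus_0_r in h. apply h. intros j _. rewrite H, Rabs_R0. lra.
Qed.

Lemma exp_lipschitz g t t' z : 0 <= g -> t <= t' + z -> exp (- (g * z)) * exp (- (g * t')) <= exp (- (g * t)).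
Proof.
  intros hg h. rewrite <- exp_plus. apply exp_mono.
  assert (g * t <= g * (t' + z)) by (apply Rmult_le_compat_l; lra). lra.
Qed.

(** The right-hand side [G] is a comparison function: [exp (- g |y - a|) G a <= G y]. Each use of
    the hypothesis at regular sites halves the admissible excess of [|psi|] over [G], starting from
    the trivial bound 1, so the excess vanishes. *)
Lemma decay_profile (psi : Z -> R) (x1 : Z) (g xi : R) (w Wd : Z) : 0 <= g -> 0 <= xi ->
  (forall z, Rabs (psi z) <= 1) ->
  (forall z, (Z.abs (z - x1) <= w)%Z -> Rabs (psi z) <= xi) ->
  (forall y, (w < Z.abs y)%Z -> (w < Z.abs (y - x1))%Z -> (Z.abs y < Wd)%Z ->
     exists a' b', (a' < y < b')%Z /\
       Rabs (psi y) <= / 4 * (exp (- (g * IZR (y - a'))) * Rabs (psi a')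
                              + exp (- (g * IZR (b' - y))) * Rabs (psi b'))) ->
  forall y, Rabs (psi y) <= exp (- (g * IZR (Z.abs y - w)))
     + xi * exp (- (g * IZR (Z.abs (y - x1) - w))) + exp (- (g * IZR (Wd - Z.abs y))).
Proof.
  intros hg hxi Hb Hxi Hreg.
  set (G := fun y => exp (- (g * IZR (Z.abs y - w)))
     + xi * exp (- (g * IZR (Z.abs (y - x1) - w))) + exp (- (g * IZR (Wd - Z.abs y)))).
  assert (hG0 : forall y, 0 <= G y).
  { intros y. unfold G. pose proof (exp_pos (- (g * IZR (Z.abs y - w)))).
    pose proof (exp_pos (- (g * IZR (Wd - Z.abs y)))).
    assert (0 <= xi * exp (- (g * IZR (Z.abs (y - x1) - w)))) by (apply Rmult_le_pos; [easy|left; apply exp_pos]).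
    lra. }
  assert (HGl : forall y a, exp (- (g * IZR (Z.abs (y - a)))) * G a <= G y).
  { intros y a. unfold G. rewrite !Rmult_plus_distr_l.
    assert (h1 : exp (- (g * IZR (Z.abs (y - a)))) * exp (- (g * IZR (Z.abs a - w))) <= exp (- (g * IZR (Z.abs y - w)))).
    { apply exp_lipschitz; [easy|]. rewrite <- plus_IZR. apply IZR_le. lia. }
    assert (h2 : exp (- (g * IZR (Z.abs (y - a)))) * exp (- (g * IZR (Z.abs (a - x1) - w))) <= exp (- (g * IZR (Z.abs (y - x1) - w)))).
    { apply exp_lipschitz; [easy|]. rewrite <- plus_IZR. apply IZR_le. lia. }
    assert (h3 : exp (- (g * IZR (Z.abs (y - a)))) * exp (- (g * IZR (Wd - Z.abs a))) <= exp (- (g * IZR (Wd - Z.abs y)))).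
    { apply exp_lipschitz; [easy|]. rewrite <- plus_IZR. apply IZR_le. lia. }
    apply (Rmult_le_compat_l xi) in h2; [|easy]. lra. }
  assert (Hind : forall N y, Rabs (psi y) <= G y + (/ 2) ^ N).
  { induction N as [|N IH]; intros y.
    - simpl. specialize (hG0 y). specialize (Hb y). lra.
    - assert (hp0 : 0 < (/ 2) ^ S N) by (apply pow_lt; lra).
      assert (hone : forall t, (t <= 0)%Z -> 1 <= exp (- (g * IZR t))).
      { intros t ht. apply exp_ge1. assert (IZR t <= 0) by (apply IZR_le; lia). nra. }
      pose proof (exp_pos (- (g * IZR (Z.abs y - w)))) as q1.
      pose proof (exp_pos (- (g * IZR (Wd - Z.abs y)))) as q3.
      pose proof (exp_pos (- (g * IZR (Z.abs (y - x1) - w)))) as q2.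
      assert (q2' : 0 <= xi * exp (- (g * IZR (Z.abs (y - x1) - w)))) by (apply Rmult_le_pos; lra).
      destruct (Z_lt_dec w (Z.abs y)) as [c1|c1].
      2:{ specialize (hone (Z.abs y - w)%Z ltac:(lia)). specialize (Hb y). unfold G. lra. }
      destruct (Z_lt_dec (Z.abs y) Wd) as [c3|c3].
      2:{ specialize (hone (Wd - Z.abs y)%Z ltac:(lia)). specialize (Hb y). unfold G. lra. }
      destruct (Z_lt_dec w (Z.abs (y - x1))) as [c2|c2].
      2:{ specialize (hone (Z.abs (y - x1) - w)%Z ltac:(lia)). specialize (Hxi y ltac:(lia)). unfold G.
          apply (Rmult_le_compat_l xi) in hone; [|easy]. lra. }
      destruct (Hreg y c1 c2 c3) as [a' [b' [hab hr]]].
      pose proof (IH a') as ia. pose proof (IH b') as ib.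
      pose proof (HGl y a') as ga. pose proof (HGl y b') as gb.
      rewrite Z.abs_eq in ga by lia.
      replace (Z.abs (y - b')) with (b' - y)%Z in gb by lia.
      set (pa := exp (- (g * IZR (y - a')))) in *. set (pb := exp (- (g * IZR (b' - y)))) in *.
      assert (hpa : 0 < pa <= 1).
      { split; [apply exp_pos|]. unfold pa. rewrite <- exp_0. apply exp_mono.
        assert (0 <= IZR (y - a')) by (apply IZR_le; lia). nra. }
      assert (hpb : 0 < pb <= 1).
      { split; [apply exp_pos|]. unfold pb. rewrite <- exp_0. apply exp_mono.
        assert (0 <= IZR (b' - y)) by (apply IZR_le; lia). nra. }
      apply (Rmult_le_compat_l pa) in ia; [|lra]. apply (Rmult_le_compat_l pb) in ib; [|lra].
      assert (hN : 0 < (/ 2) ^ N) by (apply pow_lt; lra).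
      replace ((/ 2) ^ S N) with (/ 2 * (/ 2) ^ N) by (simpl; ring).
      specialize (hG0 y).
      assert (pa * (/ 2) ^ N <= (/ 2) ^ N) by nra. assert (pb * (/ 2) ^ N <= (/ 2) ^ N) by nra.
      lra. }
  intros y. fold (G y). apply Rnot_lt_le. intros hlt.
  assert (hlim : is_lim_seq (fun N => (/ 2) ^ N) 0) by (apply is_lim_seq_geom; rewrite Rabs_right; lra).
  assert (hle : Rbar_le (Rabs (psi y) - G y) 0).
  { apply (is_lim_seq_le (fun _ => Rabs (psi y) - G y) (fun N => (/ 2) ^ N)).
    - intros N. specialize (Hind N y). lra.
    - apply is_lim_seq_const.
    - easy. }
  simpl in hle. lra.
Qed.

Section Decay.

Variables (lambda alpha p : R).
Hypotheses (hl : 1 < lambda) (hd : dioph_exp alpha p) (hp : 1 <= p).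
Let L := ln lambda.

Variables (E theta : R) (psi : Z -> R).
Hypothesis Hst : bounded_state lambda alpha E theta psi.

Variables (C e2 : R).
Hypotheses (hC : 1 <= C) (he2 : 0 < e2)
  (HC : forall k phi, Rabs (boxdet lambda alpha E phi k) <= C * exp ((ln lambda + e2) * INR k)).

Lemma decay_L_pos : 0 < L.
Proof. unfold L. rewrite <- ln_1. apply ln_increasing; lra. Qed.

(** When a determinant is within [exp (- X)] of [exp (L k)], each numerator of Green's formula is
    shorter than the box by the distance to one end, and the growth bound turns this deficit into
    decay at rate [L]. *)
Lemma green_decay i m a X : 0 <= X ->
  exp (L * INR (S (i + m)) - X) <= Rabs (boxdet lambda alpha E (theta + IZR a * alpha) (S (i + m))) ->
  Rabs (psi (a + Z.of_nat i)%Z) <=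
    C * exp (X + e2 * INR (S (i + m))) *
     (exp (- (L * INR (S i))) * Rabs (psi (a - 1)%Z)
      + exp (- (L * INR (S m))) * Rabs (psi (a + Z.of_nat (i + m) + 1)%Z)).
Proof.
  intros hX hD. destruct Hst as [_ [_ Hres]].
  pose proof (green_exact lambda alpha E theta psi a i m Hres) as hg.
  set (k := S (i + m)) in *.
  assert (hk1 : INR k = INR (S i) + INR m) by (unfold k; rewrite <- plus_INR; f_equal).
  assert (hk2 : INR k = INR i + INR (S m)) by (unfold k; rewrite <- plus_INR; f_equal; lia).
  pose proof (HC m (theta + IZR (a + Z.of_nat i + 1) * alpha)) as h1.
  pose proof (HC i (theta + IZR a * alpha)) as h2. fold L in h1, h2.
  set (u := Rabs (psi (a - 1)%Z)) in *. set (v := Rabs (psi (a + Z.of_nat (i + m) + 1)%Z)) in *.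
  assert (hu : 0 <= u) by apply Rabs_pos. assert (hv : 0 <= v) by apply Rabs_pos.
  set (t := Rabs (psi (a + Z.of_nat i)%Z)) in *. assert (ht : 0 <= t) by apply Rabs_pos.
  assert (hlow : exp (L * INR k - X) * t <= C * exp ((L + e2) * INR m) * u + C * exp ((L + e2) * INR i) * v).
  { eapply Rle_trans; [apply Rmult_le_compat_r; [easy|apply hD]|]. eapply Rle_trans; [apply hg|].
    apply Rplus_le_compat; apply Rmult_le_compat_r; easy. }
  apply (Rmult_le_reg_l (exp (L * INR k - X))); [apply exp_pos|].
  eapply Rle_trans; [apply hlow|].
  rewrite Rmult_plus_distr_l, Rmult_plus_distr_l.
  pose proof (pos_INR i). pose proof (pos_INR m). pose proof (pos_INR (S i)). pose proof (pos_INR (S m)).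
  assert (hei : e2 * INR i <= e2 * INR k) by (apply Rmult_le_compat_l; lra).
  assert (hem : e2 * INR m <= e2 * INR k) by (apply Rmult_le_compat_l; lra).
  apply Rplus_le_compat.
  - replace (exp (L * INR k - X) * (C * exp (X + e2 * INR k) * (exp (- (L * INR (S i))) * u)))
      with (C * (exp (L * INR k - X) * exp (X + e2 * INR k) * exp (- (L * INR (S i)))) * u) by ring.
    apply Rmult_le_compat_r; [easy|]. apply Rmult_le_compat_l; [lra|].
    rewrite <- !exp_plus. apply exp_mono. rewrite hk1 in *. lra.
  - replace (exp (L * INR k - X) * (C * exp (X + e2 * INR k) * (exp (- (L * INR (S m))) * v)))
      with (C * (exp (L * INR k - X) * exp (X + e2 * INR k) * exp (- (L * INR (S m)))) * v) by ring.
    apply Rmult_le_compat_r; [easy|]. apply Rmult_le_compat_l; [lra|].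
    rewrite <- !exp_plus. apply exp_mono. rewrite hk2 in *. lra.
Qed.

(* A box with a large determinant around the maximum would make the state small there. *)
Lemma deep_node_absurd (h d : nat) (j : Z) e5 X :
  (1 <= d)%nat -> (Z.abs j <= Z.of_nat h - Z.of_nat d)%Z -> 0 < e5 <= L -> 0 <= X ->
  X + e2 * INR (2 * h + 1) + ln (4 * C) <= e5 * INR d ->
  ~ exp (L * INR (2 * h + 1) - X) <= Rabs (boxdet lambda alpha E (theta + IZR (j - Z.of_nat h) * alpha) (2 * h + 1)).
Proof.
  intros h1d hj0 he5 hX0 Hsmall hD.
  set (i := Z.to_nat (Z.of_nat h - j)). set (m := (2 * h - i)%nat).
  assert (him : (2 * h + 1)%nat = S (i + m)) by (unfold m, i; lia).
  rewrite him in hD.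
  pose proof (green_decay i m (j - Z.of_nat h)%Z X hX0 hD) as hg.
  replace (j - Z.of_nat h + Z.of_nat i)%Z with 0%Z in hg by (unfold i; lia).
  destruct Hst as [Hb [H0 _]]. rewrite H0, Rabs_R1 in hg.
  rewrite <- him in hg.
  assert (hdi : forall q, (d <= q)%nat -> exp (- (L * INR (S q))) <= exp (- (L * INR d))).
  { intros q hq. apply exp_mono. assert (INR d <= INR (S q)) by (apply le_INR; lia).
    assert (L * INR d <= L * INR (S q)) by (apply Rmult_le_compat_l; lra). lra. }
  assert (g1 := hdi i ltac:(unfold i; lia)). assert (g2 := hdi m ltac:(unfold m, i; lia)).
  assert (hC4 : C * exp (X + e2 * INR (2 * h + 1)) * (exp (- (L * INR d))) <= / 4).
  { assert (he5d : e5 * INR d <= L * INR d) by (apply Rmult_le_compat_r; [apply pos_INR|lra]).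
    rewrite Rmult_assoc, <- exp_plus.
    apply Rle_trans with (C * exp (- ln (4 * C))).
    - apply Rmult_le_compat_l; [lra|]. apply exp_mono. lra.
    - rewrite exp_Ropp, exp_ln by lra. right. field. lra. }
  assert (hbr : exp (- (L * INR (S i))) * Rabs (psi (j - Z.of_nat h - 1)%Z)
       + exp (- (L * INR (S m))) * Rabs (psi (j - Z.of_nat h + Z.of_nat (i + m) + 1)%Z) <= 2 * exp (- (L * INR d))).
  { replace (2 * exp (- (L * INR d))) with (exp (- (L * INR d)) * 1 + exp (- (L * INR d)) * 1) by ring.
    apply Rplus_le_compat; apply Rmult_le_compat; try apply Rabs_pos; try (left; apply exp_pos); easy. }
  set (F := C * exp (X + e2 * INR (2 * h + 1))) in *.
  assert (hF : 0 <= F) by (apply Rmult_le_pos; [lra|left; apply exp_pos]).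
  apply (Rmult_le_compat_l F) in hbr; [|easy]. lra.
Qed.

Variables (n : nat) (ep : R).

Lemma lower_form h X rho : 0 < rho <= 1 -> 4 * ep * INR n + ln (4 * INR (h + 1)) - ln rho <= X ->
  forall D, lambda ^ (2 * h + 1) * exp (- (4 * ep) * INR n) * rho / (4 * INR (h + 1)) <= D ->
  exp (L * INR (2 * h + 1) - X) <= D.
Proof.
  intros hrho hX D hD. assert (0 < INR (h + 1)) by (apply lt_0_INR; lia).
  eapply Rle_trans; [|apply hD]. rewrite (exp_pow_nat lambda) by lra. fold L.
  unfold Rdiv. rewrite <- (exp_ln (4 * INR (h + 1))) at 1 by lra. rewrite <- exp_Ropp.
  rewrite <- (exp_ln rho) at 1 by lra.
  rewrite <- !exp_plus. apply exp_mono. lra.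
Qed.

Variable x1 : Z.
Hypotheses (hn : (2 <= n)%nat) (hep : 0 < ep).
Let s := exp (- (2 * p + 1) * ln (INR n)).
Hypotheses (Hsb : sine_bounds alpha s ep n)
  (Hx1 : forall x, (Z.abs x <= Z.of_nat n)%Z -> x <> x1 -> s <= msin (2 * theta + IZR x * alpha)).

Lemma decay_s : 0 < s <= 1.
Proof.
  assert (0 <= ln (INR n)) by (rewrite <- ln_1; apply ln_le_compat; [lra|apply (le_INR 1); lia]).
  split; [apply exp_pos|]. apply exp_le1. nra.
Qed.

Lemma decay_diff i j : i <> j -> (Z.abs (i - j) <= Z.of_nat n)%Z -> s <= msin (IZR (i - j) * alpha).
Proof.
  intros hij hb. eapply Rle_trans; [|apply (hd n); lia]. apply exp_mono.
  assert (0 <= ln (INR n)) by (rewrite <- ln_1; apply ln_le_compat; [lra|apply (le_INR 1); lia]). nra.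
Qed.

(** Nodes are placed in two groups, near 0 and near [y], so that no two distinct ones sum to [x1];
    hence nothing is lost to the resonance. The good node cannot be near 0, so its box surrounds
    [y]. *)
Lemma regular_point (h d : nat) (y : Z) e5 X :
  (1 <= d)%nat -> (3 * d <= h)%nat -> (2 * (Z.abs y + 2 * Z.of_nat h) <= Z.of_nat n)%Z ->
  (6 * Z.of_nat h + 3 < Z.abs y)%Z -> (6 * Z.of_nat h + 3 < Z.abs (y - x1))%Z ->
  0 < e5 <= L -> 4 * ep * INR n + ln (4 * INR (h + 1)) <= X ->
  X + e2 * INR (2 * h + 1) + ln (4 * C) <= e5 * INR d ->
  exists a' b', (a' < y < b')%Z /\
    Rabs (psi y) <= / 4 * (exp (- ((L - e5) * IZR (y - a'))) * Rabs (psi a')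
                           + exp (- ((L - e5) * IZR (b' - y))) * Rabs (psi b')).
Proof.
  intros h1d hdh hyn hy hyx he5 hX Hsmall.
  assert (hL := decay_L_pos).
  assert (HJ : exists b1 m1 b2 m2, (m1 + m2 = 2 * h + 2)%nat /\ (m1 <= n)%nat /\ (m2 <= n)%nat /\
    NoDup (zlist b1 m1 ++ zlist b2 m2) /\
    (forall j, In j (zlist b1 m1 ++ zlist b2 m2) ->
        (Z.abs j <= Z.of_nat h - Z.of_nat d)%Z \/ (Z.abs (j - y) <= Z.of_nat h - Z.of_nat d)%Z) /\
    (forall i j, In i (zlist b1 m1 ++ zlist b2 m2) -> In j (zlist b1 m1 ++ zlist b2 m2) -> i <> j ->
        (i + j)%Z <> x1)).
  { assert (Hgen : forall b1 m1 b2 m2, (forall i, In i (zlist b1 m1) -> ~ In i (zlist b2 m2)) ->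
      NoDup (zlist b1 m1 ++ zlist b2 m2)).
    { intros. apply NoDup_app; try apply zlist_NoDup. easy. }
    (* The larger group, of half-width [h - d], goes around whichever of [y] and 0 has its sums away
       from [x1]. The other has [2 d + 1] nodes on one side of its centre, the side for which sums
       of distinct nodes move away from [x1]. *)
    destruct (Z_le_dec (Z.abs x1) (2 * Z.of_nat h)) as [hx|hx].
    - destruct (Z_le_dec x1 0) as [hs|hs];
      [exists (y - Z.of_nat (h - d))%Z, (2 * (h - d) + 1)%nat, 0%Z, (2 * d + 1)%nat
      |exists (y - Z.of_nat (h - d))%Z, (2 * (h - d) + 1)%nat, (- Z.of_nat (2 * d))%Z, (2 * d + 1)%nat];
      (split; [lia|split; [lia|split; [lia|split;
        [apply Hgen; intros i; rewrite !zlist_In; lia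
        |split; [intros j hj; apply in_app_or in hj; rewrite !zlist_In in hj; lia
        |intros i j hi hj hij; apply in_app_or in hi, hj; rewrite !zlist_In in hi, hj; lia]]]]]).
    - destruct (Z_lt_dec x1 (2 * y)) as [hs|hs];
      [exists (- Z.of_nat (h - d))%Z, (2 * (h - d) + 1)%nat, y, (2 * d + 1)%nat
      |exists (- Z.of_nat (h - d))%Z, (2 * (h - d) + 1)%nat, (y - Z.of_nat (2 * d))%Z, (2 * d + 1)%nat];
      (split; [lia|split; [lia|split; [lia|split;
        [apply Hgen; intros i; rewrite !zlist_In; lia
        |split; [intros j hj; apply in_app_or in hj; rewrite !zlist_In in hj; lia
        |intros i j hi hj hij; apply in_app_or in hi, hj; rewrite !zlist_In in hi, hj; lia]]]]]). }
  destruct HJ as [b1 [m1 [b2 [m2 [hm [hm1 [hm2 [hnd [Hloc Hsum]]]]]]]]].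
  assert (Habs : forall j, In j (zlist b1 m1 ++ zlist b2 m2) -> (2 * Z.abs j <= Z.of_nat n)%Z).
  { intros j hj. destruct (Hloc j hj); lia. }
  destruct (good_node lambda alpha E s ep n b1 m1 b2 m2 h theta x1 (fun _ => 1)) as [j [hj hD]];
    [lra|apply decay_s|easy|easy|easy|easy|easy|intros; lra| | | |].
  { intros i j hi hj hij. apply decay_diff; [easy|]. pose proof (Habs i hi). pose proof (Habs j hj). lia. }
  { intros i j hi hj hij hne. apply Hx1; [|easy]. pose proof (Habs i hi). pose proof (Habs j hj). lia. }
  { intros i j hi hj hij he. now specialize (Hsum i j hi hj hij). }
  apply (lower_form h X 1 ltac:(lra) ltac:(rewrite ln_1; lra)) in hD.
  assert (hnh : 0 <= INR n * ep) by (apply Rmult_le_pos; [apply pos_INR|lra]).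
  assert (hX0 : 0 <= X).
  { assert (0 <= ln (4 * INR (h + 1))).
    { rewrite <- ln_1. apply ln_le_compat; [lra|]. assert (1 <= INR (h + 1)) by (apply (le_INR 1); lia). lra. }
    lra. }
  destruct (Hloc j hj) as [hj0|hjy].
  - exfalso. now apply (deep_node_absurd h d j e5 X).
  - set (i := Z.to_nat (y - (j - Z.of_nat h))). set (m := (2 * h - i)%nat).
    assert (him : (2 * h + 1)%nat = S (i + m)) by (unfold m, i; lia).
    rewrite him in hD.
    pose proof (green_decay i m (j - Z.of_nat h)%Z X hX0 hD) as hg.
    replace (j - Z.of_nat h + Z.of_nat i)%Z with y in hg by (unfold i; lia).
    rewrite <- him in hg.
    exists (j - Z.of_nat h - 1)%Z, (j - Z.of_nat h + Z.of_nat (i + m) + 1)%Z.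
    split; [lia|].
    replace (y - (j - Z.of_nat h - 1))%Z with (Z.of_nat (S i)) by (unfold i; lia).
    replace (j - Z.of_nat h + Z.of_nat (i + m) + 1 - y)%Z with (Z.of_nat (S m)) by (unfold m, i; lia).
    rewrite <- !INR_IZR_INZ.
    eapply Rle_trans; [apply hg|].
    rewrite !Rmult_plus_distr_l.
    assert (Hf : forall q, (d <= q)%nat -> C * exp (X + e2 * INR (2 * h + 1)) * exp (- (L * INR (S q)))
        <= / 4 * exp (- ((L - e5) * INR (S q)))).
    { intros q hq. assert (hqd : e5 * INR d <= e5 * INR (S q)).
      { apply Rmult_le_compat_l; [lra|]. apply le_INR. lia. }
      rewrite Rmult_assoc, <- exp_plus.
      apply Rle_trans with (C * exp (- ln (4 * C) + - ((L - e5) * INR (S q)))).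
      - apply Rmult_le_compat_l; [lra|]. apply exp_mono. lra.
      - rewrite exp_plus, exp_Ropp, exp_ln by lra. right. field. lra. }
    rewrite <- !Rmult_assoc. apply Rplus_le_compat; (apply Rmult_le_compat_r; [apply Rabs_pos|]).
    + apply Hf. unfold i; lia.
    + apply Hf. unfold m, i; lia.
Qed.

End Decay.

(** * The reflected peak *)

Section Peak.

Variables (lambda alpha p : R).
Hypotheses (hl : 1 < lambda) (hd : dioph_exp alpha p) (hp : 1 <= p).
Let L := ln lambda.

Variables (E theta : R) (psi : Z -> R).
Hypothesis Hst : bounded_state lambda alpha E theta psi.

Variables (C e2 : R).
Hypotheses (hC : 1 <= C) (he2 : 0 < e2)
  (HC : forall k phi, Rabs (boxdet lambda alpha E phi k) <= C * exp ((ln lambda + e2) * INR k)).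

Variables (l d : nat) (ep e5 u : R) (x1 : Z).
(** A common range for all index sums, differences and interval lengths met with sites up to
    [6 l]. *)
Let n := (32 * l)%nat.
Let s := exp (- (2 * p + 1) * ln (INR n)).
(** The excluded distance [6 h + 3] of [regular_point] for boxes of half-length [h = 3 d]. *)
Let w := (18 * Z.of_nat d + 3)%Z.
Hypotheses (hd1 : (1 <= d)%nat) (hdl : (18 * d + 3 <= l)%nat) (hep : 0 < ep)
  (Hsb : sine_bounds alpha s ep n)
  (Hx1 : forall x, (Z.abs x <= Z.of_nat n)%Z -> x <> x1 -> s <= msin (2 * theta + IZR x * alpha))
  (he5 : 0 < e5 <= L)
  (Hsmall : 4 * ep * INR n + ln (4 * INR (2 * l + 1)) + e2 * INR (4 * l + 1) + ln (4 * C) <= e5 * INR d).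

Let g := L - e5.
Let X := 4 * ep * INR n + ln (4 * INR (2 * l + 1)).

Lemma peak_X0 : 0 <= X.
Proof.
  assert (0 <= INR n * ep) by (apply Rmult_le_pos; [apply pos_INR|lra]).
  assert (0 <= ln (4 * INR (2 * l + 1))); [|unfold X; lra].
  rewrite <- ln_1. apply ln_le_compat; [lra|].
  assert (1 <= INR (2 * l + 1)) by (apply (le_INR 1); lia). lra.
Qed.

(** All half-lengths in use are at most [2 l], so one inequality at that size pays for every box. *)
Lemma peak_budget h : (h <= 2 * l)%nat ->
  4 * ep * INR n + ln (4 * INR (h + 1)) <= X /\ X + e2 * INR (2 * h + 1) + ln (4 * C) <= e5 * INR d.
Proof.
  intros h0. split.
  - unfold X. apply Rplus_le_compat_l. apply ln_le_compat.
    + assert (1 <= INR (h + 1)) by (apply (le_INR 1); lia). lra.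
    + apply Rmult_le_compat_l; [lra|]. apply le_INR. lia.
  - assert (e2 * INR (2 * h + 1) <= e2 * INR (4 * l + 1)).
    { apply Rmult_le_compat_l; [lra|]. apply le_INR. lia. }
    unfold X. lra.
Qed.

Lemma peak_profile xi : 0 <= xi ->
  (forall z, (Z.abs (z - x1) <= w)%Z -> Rabs (psi z) <= xi) ->
  forall y, Rabs (psi y) <= exp (- (g * IZR (Z.abs y - w)))
     + xi * exp (- (g * IZR (Z.abs (y - x1) - w))) + exp (- (g * IZR (6 * Z.of_nat l - Z.abs y))).
Proof.
  intros hxi Hxi. destruct Hst as [Hb _].
  apply decay_profile; try easy; [unfold g; lra|].
  intros y h1 h2 h3.
  destruct (peak_budget (3 * d) ltac:(lia)) as [b1 b2].
  apply (regular_point lambda alpha p hl hd hp E theta psi Hst C e2 hC he2 HC n ep x1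
    ltac:(unfold n; lia) hep Hsb Hx1 (3 * d) d y e5 X); try easy; unfold n, w in *; lia.
Qed.

Hypotheses (hLd : L * INR d <= u / 4000) (he5l : e5 * INR l <= u / 400) (hu : 4000 <= u).

(* When the reflection centre [x1 / 2] is weakly resonant, the state near [x1] is small: a single box
   around [x1], of length about [2 x1], has a determinant within the resonance factor of maximal. *)
Lemma reflected_peak eta : 0 <= eta -> (0 <= x1 <= 2 * Z.of_nat l)%Z ->
  2 * exp (- (eta * INR l)) <= msin (2 * theta + IZR x1 * alpha) ->
  eta * INR l + u / 4 < L * IZR x1 ->
  forall z, (Z.abs (z - x1) <= w)%Z -> Rabs (psi z) <= 20 * exp (eta * INR l - L * IZR x1 + u / 20).
Proof.
  intros heta hx hres hgap z0 hz0.
  pose proof Hst as [Hb [H0 _]].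
  assert (hL : 0 < L) by (unfold L; rewrite <- ln_1; apply ln_increasing; lra).
  set (el := eta * INR l) in *. assert (hel : 0 <= el) by (apply Rmult_le_pos; [easy|apply pos_INR]).
  assert (hdr : 1 <= INR d) by (apply (le_INR 1); lia).
  assert (hwr : IZR w = 18 * INR d + 3).
  { unfold w. rewrite plus_IZR, mult_IZR, <- INR_IZR_INZ. ring. }
  assert (hLd0 : L <= L * INR d) by (rewrite <- (Rmult_1_r L) at 1; apply Rmult_le_compat_l; lra).
  assert (hLw : L * IZR w <= 21 * (u / 4000)) by (rewrite hwr, Rmult_plus_distr_l; lra).
  assert (hLa : e5 * INR d <= u / 4000).
  { apply Rle_trans with (L * INR d); [apply Rmult_le_compat_r; lra|easy]. }
  assert (hx1r : IZR x1 <= 2 * INR l).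
  { replace (2 * INR l) with (IZR (2 * Z.of_nat l)) by (rewrite mult_IZR, <- INR_IZR_INZ; ring). apply IZR_le; lia. }
  destruct (nat_argmax (fun i => Rabs (psi (x1 - w + Z.of_nat i)%Z)) (Z.to_nat (2 * w + 1)) ltac:(unfold w; lia))
    as [iz [hiz Hmax]].
  set (z := (x1 - w + Z.of_nat iz)%Z) in *.
  assert (hz : (Z.abs (z - x1) <= w)%Z) by (unfold z, w in *; lia).
  set (xi := Rabs (psi z)) in *.
  assert (Hxi : forall z', (Z.abs (z' - x1) <= w)%Z -> Rabs (psi z') <= xi).
  { intros z' hz'. specialize (Hmax (Z.to_nat (z' - (x1 - w))) ltac:(lia)). cbv beta in Hmax.
    replace (x1 - w + Z.of_nat (Z.to_nat (z' - (x1 - w))))%Z with z' in Hmax by lia. easy. }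
  assert (hxi0 : 0 <= xi <= 1) by (split; [apply Rabs_pos|apply Hb]).
  pose proof (peak_profile xi ltac:(lra) Hxi) as Hprof.
  apply Rle_trans with xi; [now apply Hxi|].
  assert (hxw : (20 * w < x1)%Z).
  { apply lt_IZR. rewrite mult_IZR. apply (Rmult_lt_reg_l L); [easy|]. lra. }
  set (h := Z.to_nat x1).
  assert (hh : (h <= 2 * l)%nat) by (unfold h; lia).
  assert (hhx : Z.of_nat h = x1) by (unfold h; lia).
  destruct (peak_budget h hh) as [bud1 bud2].
  assert (hXp := peak_X0).
  (* With [h = x1], the left end is moved in by [d] so that the nodes below [- d - 1] all satisfy
     [|j| <= h - d]: their boxes hold 0 deep inside and are excluded. *)
  set (J := zlist (- (x1 - Z.of_nat d)) (2 * h + 2)).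
  assert (HJin : forall j, In j J -> (- (x1 - Z.of_nat d) <= j <= x1 + Z.of_nat d + 1)%Z).
  { intros j hj. apply zlist_In in hj. lia. }
  assert (EJ : J ++ zlist 0 0 = J) by (simpl; apply app_nil_r).
  set (del := exp (- el)).
  assert (hdel : 0 < del <= 1) by (split; [apply exp_pos|apply exp_le1; lra]).
  (* For [j < - d - 1] the partner [x1 - j] lies to the right of [J], so those nodes are not charged
     for the resonance. *)
  set (rho := fun j : Z => if Z_lt_dec j (- Z.of_nat d - 1) then 1 else del).
  destruct (good_node lambda alpha E s ep n (- (x1 - Z.of_nat d)) (2 * h + 2) 0 0 h theta x1 rho) as [j [hj hD]];
    fold J; rewrite ?EJ; try easy.
  { lra. }
  { apply (decay_s p hp n ltac:(unfold n; lia)). }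
  { unfold n. lia. }
  { unfold n. lia. }
  { apply zlist_NoDup. }
  { lia. }
  { intros j _. unfold rho. destruct (Z_lt_dec j (- Z.of_nat d - 1)); lra. }
  { intros i j hi hj hij. apply HJin in hi, hj.
    apply (decay_diff alpha p hd hp n ltac:(unfold n; lia)); [easy|unfold n; lia]. }
  { intros i j hi hj hij hne. apply HJin in hi, hj. apply Hx1; [unfold n; lia|easy]. }
  { intros i j hi hj hij he. apply HJin in hi, hj. unfold rho.
    destruct (Z_lt_dec j (- Z.of_nat d - 1)) as [c|c]; [lia|]. now rewrite he. }
  fold J in hj. rewrite EJ in hj. assert (hjb := HJin j hj).
  unfold rho in hD. destruct (Z_lt_dec j (- Z.of_nat d - 1)) as [c|c].
  { exfalso.
    apply (lower_form lambda hl n ep h X 1 ltac:(lra) ltac:(rewrite ln_1; lra)) in hD.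
    revert hD. apply (deep_node_absurd lambda alpha E theta psi Hst C e2 hC he2 HC h d j e5 X); try easy. lia. }
  assert (hX' : 4 * ep * INR n + ln (4 * INR (h + 1)) - ln del <= X + el).
  { unfold del. rewrite ln_exp. lra. }
  apply (lower_form lambda hl n ep h (X + el) del hdel hX') in hD. clear hX'.
  fold L in hD.
  assert (HF : C * exp (X + el + e2 * INR (2 * h + 1)) <= exp (el + u / 4000)).
  { apply Rle_trans with (exp (ln C) * exp (X + el + e2 * INR (2 * h + 1))).
    - rewrite exp_ln by lra. lra.
    - rewrite <- exp_plus. apply exp_mono.
      assert (ln C <= ln (4 * C)) by (apply ln_le_compat; lra). lra. }
  set (F := C * exp (X + el + e2 * INR (2 * h + 1))) in *.
  assert (HF0 : 0 <= F) by (apply Rmult_le_pos; [lra|left; apply exp_pos]).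
  (* [- t], and [T] below, are the sites just outside the box [[j - h, j + h]]. *)
  set (t := (x1 - j + 1)%Z).
  set (T := (2 * x1 + 2 - t)%Z).
  assert (ht : (- Z.of_nat d <= t <= 2 * x1 - Z.of_nat d + 1)%Z) by (unfold t; lia).
  assert (ht' : (t <= x1 + Z.of_nat d + 2)%Z) by (unfold t; lia).
  assert (hTr : IZR T = 2 * IZR x1 + 2 - IZR t) by (unfold T; rewrite minus_IZR, plus_IZR, mult_IZR; ring).
  assert (htr : - INR d <= IZR t <= IZR x1 + INR d + 2).
  { rewrite INR_IZR_INZ, <- opp_IZR. split; [apply IZR_le; lia|].
    rewrite <- !plus_IZR. apply IZR_le. lia. }
  assert (hdlr : INR d + 2 <= INR l).
  { replace (INR d + 2) with (INR (d + 2)) by (rewrite plus_INR; simpl; ring). apply le_INR; lia. }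
  assert (hlr : 21 <= INR l) by (replace 21 with (INR 21) by (simpl; lra); apply le_INR; lia).
  assert (he5t : forall q, Rabs q <= 4 * INR l -> - (4 * (u / 400)) <= e5 * q <= 4 * (u / 400)).
  { intros q hq. apply Rabs_le_between in hq.
    assert (e5 * q <= e5 * (4 * INR l)) by (apply Rmult_le_compat_l; lra).
    assert (e5 * (- (4 * INR l)) <= e5 * q) by (apply Rmult_le_compat_l; lra). lra. }
  assert (hgw : g * IZR w <= 21 * (u / 4000)).
  { eapply Rle_trans; [|apply hLw]. apply Rmult_le_compat_r; [rewrite hwr; lra|unfold g; lra]. }
  assert (hg0 : 0 <= g) by (unfold g; lra).
  assert (hgu : g <= u / 4000) by (unfold g; lra).
  assert (Hleft : (0 <= t)%Z -> Rabs (psi (- t)%Z) <= 3 * exp (- (g * IZR t) + 21 * (u / 4000))).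
  { intros ht0. eapply Rle_trans; [apply Hprof|].
    replace (3 * exp (- (g * IZR t) + 21 * (u / 4000)))
      with (exp (- (g * IZR t) + 21 * (u / 4000)) + 1 * exp (- (g * IZR t) + 21 * (u / 4000)) + exp (- (g * IZR t) + 21 * (u / 4000))) by ring.
    assert (Hm : forall A, (t - w <= A)%Z -> exp (- (g * IZR A)) <= exp (- (g * IZR t) + 21 * (u / 4000))).
    { intros A hA. apply exp_mono.
      assert (g * IZR (t - w) <= g * IZR A) by (apply Rmult_le_compat_l; [easy|now apply IZR_le]).
      rewrite minus_IZR in *. lra. }
    apply Rplus_le_compat; [apply Rplus_le_compat|].
    - apply Hm. lia.
    - apply Rmult_le_compat; try lra; [left; apply exp_pos|]. apply Hm. lia.
    - apply Hm. unfold w in *. lia. }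
  (* If the box reached too far to the left of 0, Green's formula at 0 would contradict [psi 0 = 1]:
     the distance to [- t] gives [exp (- L t)], the decay of [psi] there gives nearly the same
     factor again, and only [exp el] opposes them. *)
  assert (htbound : 2 * L * IZR t <= el + u / 40).
  { destruct (Z_le_dec t 0) as [ht0|ht0].
    { assert (L * IZR t <= L * 0) by (apply Rmult_le_compat_l; [lra|now apply IZR_le]). lra. }
    set (i := Z.to_nat (x1 - j)). set (m := (2 * h - i)%nat).
    assert (him : (2 * h + 1)%nat = S (i + m)) by (unfold m, i, t in *; lia).
    rewrite him in hD.
    pose proof (green_decay lambda alpha E theta psi Hst C e2 hC he2 HC i m (j - Z.of_nat h)%Z (X + el)
       ltac:(lra) hD) as hg.
    rewrite <- him in hg. fold L F in hg.
    replace (j - Z.of_nat h + Z.of_nat i)%Z with 0%Z in hg by (unfold i, t in *; lia).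
    replace (j - Z.of_nat h - 1)%Z with (- t)%Z in hg by (unfold t; lia).
    replace (j - Z.of_nat h + Z.of_nat (i + m) + 1)%Z with T in hg by (unfold T, t, m, i in *; lia).
    replace (INR (S i)) with (IZR t) in hg by (rewrite INR_IZR_INZ; f_equal; unfold i, t in *; lia).
    replace (INR (S m)) with (IZR T) in hg by (rewrite INR_IZR_INZ; f_equal; unfold T, m, i, t in *; lia).
    rewrite H0, Rabs_R1 in hg.
    specialize (Hleft ltac:(lia)).
    assert (HT : exp (- (L * IZR T)) * Rabs (psi T) <= exp (- (L * IZR x1) + 60 * (u / 4000))).
    { apply Rle_trans with (exp (- (L * IZR T)) * (3 * exp (- (g * IZR (Z.abs (T - x1))) + 24 * (u / 4000)))).
      - apply Rmult_le_compat_l; [left; apply exp_pos|]. eapply Rle_trans; [apply Hprof|].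
        set (ee := exp (- (g * IZR (Z.abs (T - x1))) + 24 * (u / 4000))).
        replace (3 * ee) with (ee + 1 * ee + ee) by ring.
        assert (Hm : forall A, (Z.abs (T - x1) - w - 3 <= A)%Z -> exp (- (g * IZR A)) <= ee).
        { intros A hA. apply exp_mono.
          assert (g * IZR (Z.abs (T - x1) - w - 3) <= g * IZR A) by (apply Rmult_le_compat_l; [easy|now apply IZR_le]).
          rewrite !minus_IZR in *. lra. }
        apply Rplus_le_compat; [apply Rplus_le_compat|].
        + apply Hm. unfold T in *. lia.
        + apply Rmult_le_compat; try lra; [left; apply exp_pos|]. apply Hm. lia.
        + apply Hm. unfold T, w in *. lia.
      - replace (exp (- (L * IZR T)) * (3 * exp (- (g * IZR (Z.abs (T - x1))) + 24 * (u / 4000))))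
          with (3 * (exp (- (L * IZR T)) * exp (- (g * IZR (Z.abs (T - x1))) + 24 * (u / 4000)))) by ring.
        apply Rle_trans with (exp 3 * (exp (- (L * IZR T)) * exp (- (g * IZR (Z.abs (T - x1))) + 24 * (u / 4000)))).
        + apply Rmult_le_compat_r; [|apply le_exp_self]. apply Rmult_le_pos; left; apply exp_pos.
        + rewrite <- !exp_plus. apply exp_mono.
          assert (q1 : IZR x1 - INR d <= IZR T + IZR (Z.abs (T - x1))).
          { rewrite INR_IZR_INZ, <- minus_IZR, <- plus_IZR. apply IZR_le. unfold T. lia. }
          apply (Rmult_le_compat_l L) in q1; [|lra].
          assert (q2 : IZR (Z.abs (T - x1)) <= 3 * INR l).
          { replace (3 * INR l) with (IZR (3 * Z.of_nat l)) by (rewrite mult_IZR, <- INR_IZR_INZ; ring).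
            apply IZR_le. unfold T in *. lia. }
          assert (q3 : e5 * IZR (Z.abs (T - x1)) <= e5 * (3 * INR l)) by (apply Rmult_le_compat_l; lra).
          unfold g. lra. }
    apply Rnot_lt_le. intros hcon.
    assert (c1 : F * (exp (- (L * IZR t)) * Rabs (psi (- t)%Z)) <= / 4).
    { apply Rle_trans with (exp (el + u / 4000) * (exp (- (L * IZR t)) * (3 * exp (- (g * IZR t) + 21 * (u / 4000))))).
      - apply Rmult_le_compat; [easy| |easy|].
        + apply Rmult_le_pos; [left; apply exp_pos|apply Rabs_pos].
        + apply Rmult_le_compat_l; [left; apply exp_pos|easy].
      - replace (exp (el + u / 4000) * (exp (- (L * IZR t)) * (3 * exp (- (g * IZR t) + 21 * (u / 4000)))))
          with (3 * (exp (el + u / 4000) * exp (- (L * IZR t)) * exp (- (g * IZR t) + 21 * (u / 4000)))) by ring.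
        apply Rle_trans with (exp 3 * exp (Ropp 7)).
        + apply Rmult_le_compat; [lra| |apply le_exp_self|].
          * apply Rmult_le_pos; [apply Rmult_le_pos|]; left; apply exp_pos.
          * rewrite <- !exp_plus. apply exp_mono.
            assert (q2 : e5 * IZR t <= e5 * (3 * INR l)) by (apply Rmult_le_compat_l; lra).
            unfold g. lra.
        + rewrite <- exp_plus. replace (3 + Ropp 7) with (Ropp 4) by lra. rewrite exp_Ropp.
          apply Rinv_le_contravar; [lra|apply le_exp_self]. }
    assert (c2 : F * (exp (- (L * IZR T)) * Rabs (psi T)) <= / 4).
    { apply Rle_trans with (exp (el + u / 4000) * exp (- (L * IZR x1) + 60 * (u / 4000))).
      - apply Rmult_le_compat; try easy. apply Rmult_le_pos; [left; apply exp_pos|apply Rabs_pos].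
      - rewrite <- exp_plus. apply Rle_trans with (exp (Ropp 4)); [apply exp_mono; lra|].
        rewrite exp_Ropp. apply Rinv_le_contravar; [lra|apply le_exp_self]. }
    rewrite Rmult_plus_distr_l in hg. lra. }
  set (i := Z.to_nat (z - (j - Z.of_nat h))). set (m := (2 * h - i)%nat).
  assert (htw : (2 * t + 4 * w < 2 * x1)%Z).
  { apply lt_IZR. rewrite plus_IZR, !mult_IZR. apply (Rmult_lt_reg_l L); [easy|]. lra. }
  assert (hiz' : (Z.of_nat i = z - 1 + t)%Z) by (unfold i, t in *; lia).
  assert (him : (2 * h + 1)%nat = S (i + m)) by (unfold m; lia).
  rewrite him in hD.
  pose proof (green_decay lambda alpha E theta psi Hst C e2 hC he2 HC i m (j - Z.of_nat h)%Z (X + el)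
     ltac:(lra) hD) as hg.
  rewrite <- him in hg. fold L F in hg.
  replace (j - Z.of_nat h + Z.of_nat i)%Z with z in hg by (unfold t in *; lia).
  replace (j - Z.of_nat h - 1)%Z with (- t)%Z in hg by (unfold t; lia).
  replace (j - Z.of_nat h + Z.of_nat (i + m) + 1)%Z with T in hg by (unfold T, t, m in *; lia).
  replace (INR (S i)) with (IZR (z + t)) in hg by (rewrite INR_IZR_INZ; f_equal; lia).
  replace (INR (S m)) with (IZR (T - z)) in hg by (rewrite INR_IZR_INZ; f_equal; unfold T, m; lia).
  fold xi in hg.
  assert (htr2 : 2 * IZR t <= 2 * IZR x1).
  { rewrite <- !mult_IZR. apply IZR_le. unfold w in *. lia. }
  assert (hLt0 : - (u / 4000) <= L * IZR t).
  { assert (L * (- INR d) <= L * IZR t) by (apply Rmult_le_compat_l; lra). lra. }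
  assert (he5r : - (4 * (u / 400)) <= e5 * IZR t <= 4 * (u / 400)) by (apply he5t, Rabs_le; lra).
  assert (HA : exp (- (L * IZR (z + t))) * Rabs (psi (- t)%Z) <= 3 * exp (- (L * IZR x1) + u / 60)).
  { assert (q1 : L * IZR (x1 - w + t) <= L * IZR (z + t)) by (apply Rmult_le_compat_l; [lra|apply IZR_le; lia]).
    rewrite plus_IZR, minus_IZR in q1.
    destruct (Z_le_dec 0 t) as [ht0|ht0].
    - specialize (Hleft ht0).
      apply Rle_trans with (exp (- (L * IZR (z + t))) * (3 * exp (- (g * IZR t) + 21 * (u / 4000)))).
      + apply Rmult_le_compat_l; [left; apply exp_pos|easy].
      + replace (exp (- (L * IZR (z + t))) * (3 * exp (- (g * IZR t) + 21 * (u / 4000))))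
          with (3 * (exp (- (L * IZR (z + t))) * exp (- (g * IZR t) + 21 * (u / 4000)))) by ring.
        apply Rmult_le_compat_l; [lra|]. rewrite <- exp_plus. apply exp_mono.
        assert (0 <= g * IZR t) by (apply Rmult_le_pos; [easy|now apply IZR_le]). lra.
    - apply Rle_trans with (exp (- (L * IZR (z + t))) * 1).
      + apply Rmult_le_compat_l; [left; apply exp_pos|apply Hb].
      + rewrite Rmult_1_r. apply Rle_trans with (1 * exp (- (L * IZR x1) + u / 60)).
        * rewrite Rmult_1_l. apply exp_mono. lra.
        * apply Rmult_le_compat_r; [left; apply exp_pos|lra]. }
  assert (hTz : L * (IZR x1 + 2 - IZR t - IZR w) <= L * IZR (T - z)).
  { apply Rmult_le_compat_l; [lra|].
    replace (IZR x1 + 2 - IZR t - IZR w) with (IZR (x1 + 2 - t - w)) by (rewrite !minus_IZR, plus_IZR; ring).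
    apply IZR_le. unfold T. lia. }
  assert (HB : exp (- (L * IZR (T - z))) * Rabs (psi T)
     <= 2 * exp (- (L * IZR x1) + u / 25) + xi * exp (- (2 * L * (IZR x1 - IZR t)) + u / 30)).
  { apply Rle_trans with (exp (- (L * IZR (T - z))) *
      (exp (- (g * IZR (Z.abs T - w))) + xi * exp (- (g * IZR (Z.abs (T - x1) - w))) + exp (- (g * IZR (6 * Z.of_nat l - Z.abs T))))).
    - apply Rmult_le_compat_l; [left; apply exp_pos|apply Hprof].
    - rewrite !Rmult_plus_distr_l.
      assert (k1 : exp (- (L * IZR (T - z))) * exp (- (g * IZR (Z.abs T - w))) <= exp (- (L * IZR x1) + u / 25)).
      { rewrite <- exp_plus. apply exp_mono.
        assert (q : g * IZR (t - w) <= g * IZR (Z.abs T - w)) by (apply Rmult_le_compat_l; [easy|apply IZR_le; unfold T, w in *; lia]).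
        rewrite minus_IZR in q at 1. replace (g * (IZR t - IZR w)) with (L * IZR t - e5 * IZR t - g * IZR w) in q by (unfold g; ring).
        lra. }
      assert (k3 : exp (- (L * IZR (T - z))) * exp (- (g * IZR (6 * Z.of_nat l - Z.abs T))) <= exp (- (L * IZR x1) + u / 25)).
      { rewrite <- exp_plus. apply exp_mono.
        assert (q : g * IZR (t - 2) <= g * IZR (6 * Z.of_nat l - Z.abs T)) by (apply Rmult_le_compat_l; [easy|apply IZR_le; unfold T, w in *; lia]).
        rewrite minus_IZR in q at 1. replace (g * (IZR t - 2)) with (L * IZR t - e5 * IZR t - 2 * g) in q by (unfold g; ring).
        lra. }
      assert (k2 : exp (- (L * IZR (T - z))) * exp (- (g * IZR (Z.abs (T - x1) - w))) <= exp (- (2 * L * (IZR x1 - IZR t)) + u / 30)).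
      { rewrite <- exp_plus. apply exp_mono.
        replace (Z.abs (T - x1)) with (x1 + 2 - t)%Z by (unfold T, w in *; lia).
        rewrite !minus_IZR, plus_IZR in *.
        replace (g * (IZR x1 + 2 - IZR t - IZR w)) with (L * (IZR x1 - IZR t) - e5 * (IZR x1 - IZR t) + 2 * g - g * IZR w)
          by (unfold g; ring).
        assert (q : - (4 * (u / 400)) <= e5 * (IZR x1 - IZR t) <= 4 * (u / 400)) by (apply he5t, Rabs_le; lra).
        lra. }
      apply (Rmult_le_compat_l xi) in k2; [|lra]. lra. }
  assert (hfin : xi <= exp (el + u / 4000) * (3 * exp (- (L * IZR x1) + u / 60)
      + (2 * exp (- (L * IZR x1) + u / 25) + xi * exp (- (2 * L * (IZR x1 - IZR t)) + u / 30)))).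
  { eapply Rle_trans; [apply hg|]. apply Rmult_le_compat; [easy| |easy|].
    - apply Rplus_le_le_0_compat; apply Rmult_le_pos; try (left; apply exp_pos); apply Rabs_pos.
    - now apply Rplus_le_compat. }
  assert (f1 : exp (el + u / 4000) * exp (- (L * IZR x1) + u / 60) <= exp (el - L * IZR x1 + u / 20)).
  { rewrite <- exp_plus. apply exp_mono. lra. }
  assert (f2 : exp (el + u / 4000) * exp (- (L * IZR x1) + u / 25) <= exp (el - L * IZR x1 + u / 20)).
  { rewrite <- exp_plus. apply exp_mono. lra. }
  (* The estimate of [psi T] involves [xi] itself, through the decay away from [x1]; with a
     coefficient of at most one half it can be absorbed on the left. *)
  assert (f3 : exp (el + u / 4000) * exp (- (2 * L * (IZR x1 - IZR t)) + u / 30) <= / 2).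
  { rewrite <- exp_plus. apply Rle_trans with (exp (Ropp 2)); [apply exp_mono; lra|].
    rewrite exp_Ropp. apply Rinv_le_contravar; [lra|apply le_exp_self]. }
  set (ex := exp (el - L * IZR x1 + u / 20)) in *.
  apply (Rmult_le_compat_l xi) in f3; [|lra].
  assert (0 < ex) by apply exp_pos.
  set (q0 := exp (el + u / 4000)) in *.
  assert (q0 * (3 * exp (- (L * IZR x1) + u / 60)
      + (2 * exp (- (L * IZR x1) + u / 25) + xi * exp (- (2 * L * (IZR x1 - IZR t)) + u / 30)))
     = 3 * (q0 * exp (- (L * IZR x1) + u / 60)) + 2 * (q0 * exp (- (L * IZR x1) + u / 25))
       + xi * (q0 * exp (- (2 * L * (IZR x1 - IZR t)) + u / 30))) by ring.
  lra.
Qed.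

End Peak.

(** * Choice of parameters and decay at a given site *)

Lemma sum3_exp_le a b c t : a <= exp t -> b <= exp t -> c <= exp t -> a + b + c <= exp (t + 3).
Proof.
  intros ha hb hc. rewrite exp_plus. pose proof (exp_pos t).
  assert (exp t * 3 <= exp t * exp 3) by (apply Rmult_le_compat_l; [lra|apply le_exp_self]). lra.
Qed.

(** [d] is about [mu l], so the budget [e5 d] is at least [c l] with [c = e5 mu]. The sine products
    use [c l / 8], the growth bound about [c l / 16], and the logarithms and constants at most
    [c l / 2]. *)
Lemma scale_parameters alpha p L C e5 mu : dioph_exp alpha p -> 1 <= p -> 0 < L -> 1 <= C -> 0 < e5 -> 0 < mu <= / 36 ->
  exists N : nat, forall l, (N <= l)%nat -> exists d : nat, (1 <= d)%nat /\ (18 * d + 3 <= l)%nat /\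
    L * INR d <= 2 * L * mu * INR l /\
    sine_bounds alpha (exp (- (2 * p + 1) * ln (INR (32 * l)))) (e5 * mu / 1024) (32 * l) /\
    4 * (e5 * mu / 1024) * INR (32 * l) + ln (4 * INR (2 * l + 1)) + e5 * mu / 64 * INR (4 * l + 1) + ln (4 * C)
      <= e5 * INR d.
Proof.
  intros hd hp hL hC he5 hmu. set (c := e5 * mu).
  assert (hc : 0 < c) by (apply Rmult_lt_0_compat; lra).
  destruct (sine_product_bounds alpha (2 * p + 1) (c / 1024)) as [N1 HN1];
    [apply (dioph_exp_mono alpha p); [lra|easy]|lra|lra|].
  assert (hln : 0 <= ln 12 + ln (4 * C)).
  { assert (0 <= ln 12) by (rewrite <- ln_1; apply ln_le_compat; lra).
    assert (0 <= ln (4 * C)) by (rewrite <- ln_1; apply ln_le_compat; lra). lra. }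
  destruct (log_le_linear 1 (ln 12 + ln (4 * C)) (c / 2)) as [N2 HN2]; [lra|easy|lra|].
  destruct (nat_ceil (/ mu + 50)) as [N3 HN3].
  { assert (0 < / mu) by (apply Rinv_0_lt_compat; lra). lra. }
  exists (N1 + N2 + N3 + 1)%nat. intros l hl.
  assert (hr1 : 1 <= INR l) by (apply (le_INR 1); lia).
  assert (hr : / mu + 50 <= INR l) by (eapply Rle_trans; [apply HN3|apply le_INR; lia]).
  assert (hmr : 1 <= mu * INR l).
  { replace 1 with (mu * / mu) by (field; lra). apply Rmult_le_compat_l; [lra|].
    lra. }
  destruct (nat_ceil (mu * INR l)) as [d hdd]; [lra|].
  exists d. split; [apply INR_le; simpl; lra|]. split.
  { apply INR_le. rewrite plus_INR, mult_INR. replace (INR 18) with 18 by (simpl; lra).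
    replace (INR 3) with 3 by (simpl; lra).
    assert (mu * INR l <= / 36 * INR l) by (apply Rmult_le_compat_r; lra).
    assert (0 < / mu) by (apply Rinv_0_lt_compat; lra). lra. }
  split.
  { replace (2 * L * mu * INR l) with (L * (2 * (mu * INR l))) by ring. apply Rmult_le_compat_l; lra. }
  split.
  { intros m x hm. apply HN1; [lia|easy]. }
  specialize (HN2 l ltac:(lia)).
  assert (h1 : ln (4 * INR (2 * l + 1)) <= ln 12 + ln (INR l)).
  { rewrite <- ln_mult by lra. apply ln_le_compat.
    - assert (1 <= INR (2 * l + 1)) by (apply (le_INR 1); lia). lra.
    - rewrite plus_INR, mult_INR. simpl. lra. }
  rewrite (mult_INR 32), (plus_INR (4 * l)), (mult_INR 4).
  replace (INR 32) with 32 by (simpl; lra). replace (INR 4) with 4 by (simpl; lra). replace (INR 1) with 1 by easy.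
  assert (h2 : c * INR l <= e5 * INR d).
  { unfold c. rewrite Rmult_assoc. apply Rmult_le_compat_l; lra. }
  assert (h3 : c * 1 <= c * INR l) by (apply Rmult_le_compat_l; lra).
  fold c. lra.
Qed.

Lemma bounded_state_decay lambda alpha eps : 1 < lambda -> diophantine alpha -> 0 < eps < ln lambda ->
  exists N : nat, forall E theta psi (l : nat) (x0 : Z), bounded_state lambda alpha E theta psi ->
    (N <= l)%nat -> (Z.abs x0 <= 2 * Z.of_nat l)%Z ->
    (forall x, (Z.abs x <= 2 * Z.of_nat l)%Z ->
        msin (2 * theta + IZR x0 * alpha) <= msin (2 * theta + IZR x * alpha)) ->
    ((x0 < 0)%Z -> Rabs (psi (Z.of_nat l)) <= exp (- (ln lambda - eps) * INR l)) /\
    (forall eta, 0 <= eta -> (0 <= x0)%Z ->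
        2 * exp (- eta * INR l) <= msin (2 * theta + IZR x0 * alpha) ->
        Rabs (psi (Z.of_nat l)) <= exp (- (ln lambda - eps - eta) * INR l)).
Proof.
  intros hl hdio heps. destruct (diophantine_exp alpha hdio) as [p [hp hd]].
  (* [u = eps l] is the total error allowed. [e5] limits the loss of rate over the length [l] to
     [u / 400], and [mu] limits [L d], which governs the excluded zones, to [u / 4000]. *)
  set (L := ln lambda) in *. set (e5 := eps / 400). set (mu := eps / (8000 * L)).
  assert (hmu : 0 < mu <= / 8000).
  { unfold mu. split; [apply Rdiv_lt_0_compat; lra|].
    apply (Rmult_le_reg_r (8000 * L)); [lra|]. field_simplify; lra. }
  assert (hLmu : 2 * L * mu = eps / 4000) by (unfold mu; field; lra).
  assert (he5 : 0 < e5 <= L) by (unfold e5; lra).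
  assert (hc : 0 < e5 * mu) by (apply Rmult_lt_0_compat; lra).
  destruct (box_growth lambda alpha p (e5 * mu / 64) hl hd hp ltac:(lra)) as [C [hC HC]].
  destruct (scale_parameters alpha p L C e5 mu hd hp ltac:(lra) hC ltac:(lra) ltac:(lra)) as [N0 HN0].
  destruct (nat_ceil (4000 / eps)) as [N1 HN1].
  { apply Rlt_le, Rdiv_lt_0_compat; lra. }
  exists (N0 + N1 + 1)%nat. intros E theta psi l x0 Hst hN hx0 Hmin.
  destruct (HN0 l ltac:(lia)) as [d [hd1 [hdl [hLd [Hsb Hsmall]]]]].
  assert (hr : 1 <= INR l) by (apply (le_INR 1); lia).
  set (r := INR l) in *. set (u := eps * r).
  assert (hu : 4000 <= u).
  { unfold u. replace 4000 with (eps * (4000 / eps)) by (field; lra). apply Rmult_le_compat_l; [lra|].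
    eapply Rle_trans; [apply HN1|]. apply le_INR. lia. }
  replace (2 * L * mu * r) with (u / 4000) in hLd by (rewrite hLmu; unfold u; field).
  assert (he5l : e5 * r <= u / 400) by (unfold e5, u; lra).
  set (s := exp (- (2 * p + 1) * ln (INR (32 * l)))) in *.
  set (g := L - e5).
  set (w := (18 * Z.of_nat d + 3)%Z).
  assert (hw : g * IZR w <= 21 * (u / 4000)).
  { assert (1 <= INR d) by (apply (le_INR 1); lia).
    assert (IZR w <= 21 * INR d).
    { unfold w. rewrite plus_IZR, mult_IZR, <- INR_IZR_INZ. lra. }
    assert (0 <= IZR w) by (apply IZR_le; unfold w; lia).
    apply Rle_trans with (L * (21 * INR d)); [|lra].
    apply Rmult_le_compat; unfold g; lra. }
  assert (hlz : IZR (Z.of_nat l) = r) by (unfold r; now rewrite <- INR_IZR_INZ).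
  assert (hg : 0 <= g) by (unfold g; lra).
  assert (hgr : L * r - u / 400 <= g * r) by (unfold g; lra).
  pose proof (fun x1 Hx1 => peak_profile lambda alpha p hl hd hp E theta psi Hst C (e5 * mu / 64) hC
    ltac:(lra) (fun k phi => HC E theta psi Hst k phi) l d (e5 * mu / 1024) e5 x1 hd1 hdl ltac:(lra) Hsb Hx1
    he5 Hsmall) as Hprof.
  fold s L g w in Hprof.
  assert (Hb : forall z, Rabs (psi z) <= 1) by apply Hst.
  assert (Hm : forall A q, L * r - q <= g * IZR A -> exp (- (g * IZR (A - w))) <= exp (- (L * r) + q + 21 * (u / 4000))).
  { intros A q hA. apply exp_mono. rewrite minus_IZR. lra. }
  assert (Hside : forall A q, (Z.of_nat l <= A)%Z -> 0 <= q ->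
     exp (- (g * IZR (A - w))) <= exp (- (L * r) + (u / 400 + q) + 21 * (u / 4000))).
  { intros A q hA hq. apply Hm. apply IZR_le in hA. rewrite hlz in hA.
    assert (g * r <= g * IZR A) by (apply Rmult_le_compat_l; lra). lra. }
  assert (Hcomb : forall x1 xi q, 0 <= q ->
    (forall x, (Z.abs x <= Z.of_nat (32 * l))%Z -> x <> x1 -> s <= msin (2 * theta + IZR x * alpha)) ->
    0 <= xi -> (forall z, (Z.abs (z - x1) <= w)%Z -> Rabs (psi z) <= xi) ->
    xi * exp (- (g * IZR (Z.abs (Z.of_nat l - x1) - w))) <= exp (- (L * r) + (u / 400 + q) + 21 * (u / 4000)) ->
    Rabs (psi (Z.of_nat l)) <= exp (- (L * r) + u / 100 + q)).
  { intros x1 xi q hq Hx1 hxi Hxi Hmid.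
    eapply Rle_trans; [apply (Hprof x1 Hx1 xi hxi Hxi)|].
    rewrite Z.abs_eq by lia.
    eapply Rle_trans; [apply (sum3_exp_le _ _ _ (- (L * r) + (u / 400 + q) + 21 * (u / 4000)))|].
    - now apply Hside.
    - easy.
    - replace (6 * Z.of_nat l - Z.of_nat l)%Z with ((5 * Z.of_nat l + w) - w)%Z by lia.
      apply Hside; [unfold w; lia|easy].
    - apply exp_mono. lra. }
  destruct (resonance_exists alpha p (32 * l) theta hd ltac:(lra) ltac:(lia)) as [x2 Hx2]. fold s in Hx2.
  (* If the exceptional site [x2] is within [2 l] and differs from [x0], then the sine at [x0] is at
     least [s], and by minimality so is the one at [x2]; hence [x0] can be taken as the exceptional
     site. Otherwise [x2] lies beyond [2 l]. *)
  assert (Hres : (forall x, (Z.abs x <= Z.of_nat (32 * l))%Z -> x <> x0 -> s <= msin (2 * theta + IZR x * alpha))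
     \/ (2 * Z.of_nat l < Z.abs x2)%Z).
  { destruct (Z_le_dec (Z.abs x2) (2 * Z.of_nat l)) as [c|c]; [left|right; lia].
    intros x hx hne. destruct (Z.eq_dec x x2) as [->|c2]; [|now apply Hx2].
    apply Rle_trans with (msin (2 * theta + IZR x0 * alpha)); [|now apply Hmin].
    apply Hx2; [lia|easy]. }
  (* Such an [x1] is at distance at least [l] from the site [l], so the trivial bound 1 for the peak
     is enough. *)
  assert (Hfar : forall x1, (x1 <= 0 \/ 2 * Z.of_nat l <= x1)%Z ->
    (forall x, (Z.abs x <= Z.of_nat (32 * l))%Z -> x <> x1 -> s <= msin (2 * theta + IZR x * alpha)) ->
    Rabs (psi (Z.of_nat l)) <= exp (- (L * r) + u / 100)).
  { intros x1 hx1 Hx1. rewrite <- (Rplus_0_r (_ + u / 100)).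
    apply (Hcomb x1 1 0); [lra|easy|lra|intros; apply Hb|].
    rewrite Rmult_1_l. apply Hside; [lia|lra]. }
  split.
  - intros hneg. apply Rle_trans with (exp (- (L * r) + u / 100)).
    + destruct Hres as [Hx0|hx2]; [apply (Hfar x0); [lia|easy]|apply (Hfar x2); [lia|easy]].
    + apply exp_mono. fold u. unfold u in *. lra.
  - intros eta heta hpos Hsin.
    assert (her : 0 <= eta * r) by (apply Rmult_le_pos; lra).
    apply Rle_trans with (exp (- (L * r) + u / 100 + (eta * r + u / 4)));
      [|apply exp_mono; unfold u in *; lra].
    destruct Hres as [Hx0|hx2].
    2:{ eapply Rle_trans; [apply (Hfar x2); [lia|easy]|]. apply exp_mono. lra. }
    assert (hdist : g * r - g * IZR x0 <= g * IZR (Z.abs (Z.of_nat l - x0))).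
    { rewrite <- Rmult_minus_distr_l. apply Rmult_le_compat_l; [easy|].
      rewrite <- hlz, <- minus_IZR. apply IZR_le. lia. }
    assert (hx0r : 0 <= IZR x0) by (apply IZR_le; lia).
    assert (hgx : g * IZR x0 <= L * IZR x0) by (apply Rmult_le_compat_r; unfold g; lra).
    (* For small [x0] the peak may have size 1: the decay over the distance [l - x0] already gives
       the rate [L - eta] up to the error. Otherwise the peak is at most about [exp (eta l - L x0)],
       and the decay from [x0] to [l] supplies the rest. *)
    destruct (Rle_lt_dec (L * IZR x0) (eta * r + u / 4)) as [c|c].
    + apply (Hcomb x0 1); [lra|easy|lra|intros; apply Hb|].
      rewrite Rmult_1_l. apply Hm. lra.
    + assert (Hpk := reflected_peak lambda alpha p hl hd hp E theta psi Hst C (e5 * mu / 64) hC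
        ltac:(lra) (fun k phi => HC E theta psi Hst k phi) l d (e5 * mu / 1024) e5 u x0 hd1 hdl ltac:(lra) Hsb Hx0
        he5 Hsmall hLd he5l hu eta heta ltac:(lia)).
      fold r in Hpk. rewrite Ropp_mult_distr_l in Hpk. specialize (Hpk Hsin c). fold L w in Hpk.
      apply (Hcomb x0 (20 * exp (eta * r - L * IZR x0 + u / 20))); [lra|easy| |easy|].
      * apply Rmult_le_pos; [lra|left; apply exp_pos].
      * assert (h20 : 20 <= exp 20) by apply le_exp_self.
        apply Rle_trans with (exp 20 * exp (eta * r - L * IZR x0 + u / 20)
           * exp (- (g * IZR (Z.abs (Z.of_nat l - x0) - w)))).
        -- apply Rmult_le_compat_r; [left; apply exp_pos|]. apply Rmult_le_compat_r; [left; apply exp_pos|easy].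
        -- rewrite <- !exp_plus. apply exp_mono. rewrite minus_IZR. lra.
Qed.

(** * Reduction to a real state *)

Lemma nondecreasing_vanishing (J : Z -> R) : (forall m, J (m - 1)%Z <= J m) ->
  is_lim_seq (fun k => J (Z.of_nat k)) 0 -> is_lim_seq (fun k => J (- Z.of_nat k)%Z) 0 -> forall m, J m = 0.
Proof.
  intros Hinc Hp Hm.
  assert (Hmono : forall k m, J m <= J (m + Z.of_nat k)%Z).
  { induction k as [|k IH]; intros m; [rewrite Z.add_0_r; lra|].
    eapply Rle_trans; [apply IH|]. specialize (Hinc (m + Z.of_nat (S k))%Z).
    now replace (m + Z.of_nat (S k) - 1)%Z with (m + Z.of_nat k)%Z in Hinc by lia. }
  assert (Hmono' : forall a b, (a <= b)%Z -> J a <= J b).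
  { intros a b h. specialize (Hmono (Z.to_nat (b - a)) a). now replace (a + Z.of_nat (Z.to_nat (b - a)))%Z with b in Hmono by lia. }
  intros m. apply Rle_antisym.
  - assert (h : Rbar_le (J m) 0); [|exact h].
    apply (is_lim_seq_le_loc (fun _ => J m) (fun k => J (Z.of_nat k))); [|apply is_lim_seq_const|easy].
    exists (Z.to_nat m). intros k hk. apply Hmono'. lia.
  - assert (h : Rbar_le 0 (J m)); [|exact h].
    apply (is_lim_seq_le_loc (fun k => J (- Z.of_nat k)%Z) (fun _ => J m)); [|easy|apply is_lim_seq_const].
    exists (Z.to_nat (- m)). intros k hk. apply Hmono'. lia.
Qed.

Definition vanishing (x : Z -> R) : Prop :=
  is_lim_seq (fun k => x (Z.of_nat k)) 0 /\ is_lim_seq (fun k => x (- Z.of_nat k)%Z) 0.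

Lemma vanishing_mult_shift x y : vanishing x -> vanishing y -> vanishing (fun m => x (m + 1)%Z * y m).
Proof.
  intros [x1 x2] [y1 y2]. split.
  - replace (Finite 0) with (Rbar_mult 0 0) by (simpl; f_equal; ring).
    apply is_lim_seq_mult'; [|easy]. apply is_lim_seq_incr_1 in x1. eapply is_lim_seq_ext; [|apply x1].
    intros k. cbv beta. f_equal. lia.
  - apply is_lim_seq_incr_1. replace (Finite 0) with (Rbar_mult 0 0) by (simpl; f_equal; ring).
    apply is_lim_seq_mult'.
    + eapply is_lim_seq_ext; [|apply x2]. intros k. cbv beta. f_equal. lia.
    + now apply is_lim_seq_incr_1 in y2.
Qed.

Lemma vanishing_minus x y : vanishing x -> vanishing y -> vanishing (fun m => x m - y m).
Proof.
  intros [x1 x2] [y1 y2]. split;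
    (replace (Finite 0) with (Finite (0 - 0)) by (f_equal; ring)); now apply is_lim_seq_minus'.
Qed.

(* The current [Im (phi (m + 1) * conj (phi m))] is monotone, with increments [Im E * |phi m| ^ 2]. *)
Lemma current_zero (x y v : Z -> R) a b : vanishing x -> vanishing y ->
  (forall m, x (m + 1)%Z + x (m - 1)%Z + v m * x m = a * x m - b * y m) ->
  (forall m, y (m + 1)%Z + y (m - 1)%Z + v m * y m = a * y m + b * x m) ->
  forall m, y (m + 1)%Z * x m - x (m + 1)%Z * y m = 0 /\ b * (x m * x m + y m * y m) = 0.
Proof.
  intros hx hy ex ey.
  set (J := fun m => y (m + 1)%Z * x m - x (m + 1)%Z * y m).
  assert (HJ : forall m, J m - J (m - 1)%Z = b * (x m * x m + y m * y m)).
  { intros m. unfold J. replace (m - 1 + 1)%Z with m by lia.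
    specialize (ex m). specialize (ey m).
    replace (y (m + 1)%Z) with (a * y m + b * x m - y (m - 1)%Z - v m * y m) by lra.
    replace (x (m + 1)%Z) with (a * x m - b * y m - x (m - 1)%Z - v m * x m) by lra. ring. }
  assert (hsq : forall m, 0 <= x m * x m + y m * y m).
  { intros m. pose proof (Rle_0_sqr (x m)). pose proof (Rle_0_sqr (y m)). unfold Rsqr in *. lra. }
  assert (HJ0 : forall m, J m = 0).
  { destruct (Rle_lt_dec 0 b) as [hb|hb].
    - apply nondecreasing_vanishing.
      + intros m. specialize (HJ m). assert (0 <= b * (x m * x m + y m * y m)) by (apply Rmult_le_pos; easy). lra.
      + apply (vanishing_minus _ _ (vanishing_mult_shift y x hy hx) (vanishing_mult_shift x y hx hy)).
      + apply (vanishing_minus _ _ (vanishing_mult_shift y x hy hx) (vanishing_mult_shift x y hx hy)).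
    - assert (h : forall m, x (m + 1)%Z * y m - y (m + 1)%Z * x m = 0).
      { apply nondecreasing_vanishing.
        + intros m. specialize (HJ m). unfold J in HJ.
          assert (0 <= - b * (x m * x m + y m * y m)) by (apply Rmult_le_pos; [lra|easy]). lra.
        + apply (vanishing_minus _ _ (vanishing_mult_shift x y hx hy) (vanishing_mult_shift y x hy hx)).
        + apply (vanishing_minus _ _ (vanishing_mult_shift x y hx hy) (vanishing_mult_shift y x hy hx)). }
      intros m. specialize (h m). unfold J. lra. }
  intros m. split; [apply HJ0|]. rewrite <- HJ, !HJ0. ring.
Qed.

(** Two neighbouring values determine a solution. This is applied to the imaginary part of
    [phi m * conj (phi n)]. *)
Lemma recursion_zero (z c : Z -> R) n : (forall m, z (m + 1)%Z + z (m - 1)%Z = c m * z m) ->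
  z n = 0 -> z (n + 1)%Z = 0 -> forall m, z m = 0.
Proof.
  intros H h0 h1.
  assert (Hk : forall k : nat, (z (n + Z.of_nat k)%Z = 0 /\ z (n + Z.of_nat k + 1)%Z = 0) /\
     (z (n - Z.of_nat k)%Z = 0 /\ z (n - Z.of_nat k + 1)%Z = 0)).
  { induction k as [|k [[a1 a2] [b1 b2]]].
    - simpl. now rewrite Z.add_0_r, Z.sub_0_r.
    - split; split.
      + now replace (n + Z.of_nat (S k))%Z with (n + Z.of_nat k + 1)%Z by lia.
      + specialize (H (n + Z.of_nat k + 1)%Z).
        replace (n + Z.of_nat k + 1 - 1)%Z with (n + Z.of_nat k)%Z in H by lia.
        replace (n + Z.of_nat (S k) + 1)%Z with (n + Z.of_nat k + 1 + 1)%Z by lia.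
        rewrite a1, a2 in H. lra.
      + specialize (H (n - Z.of_nat k)%Z). rewrite b1, b2 in H.
        replace (n - Z.of_nat (S k))%Z with (n - Z.of_nat k - 1)%Z by lia. lra.
      + now replace (n - Z.of_nat (S k) + 1)%Z with (n - Z.of_nat k)%Z by lia. }
  intros m. destruct (Z_le_dec n m) as [c1|c1].
  - destruct (Hk (Z.to_nat (m - n))) as [[h _] _]. now replace (n + Z.of_nat (Z.to_nat (m - n)))%Z with m in h by lia.
  - destruct (Hk (Z.to_nat (n - m))) as [_ [h _]]. now replace (n - Z.of_nat (Z.to_nat (n - m)))%Z with m in h by lia.
Qed.

Lemma Cmod_sqr z : Cmod z * Cmod z = fst z * fst z + snd z * snd z.
Proof.
  unfold Cmod. rewrite sqrt_sqrt; [ring|].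
  pose proof (pow2_ge_0 (fst z)). pose proof (pow2_ge_0 (snd z)). lra.
Qed.

Lemma square_summable_vanishing (u : nat -> R) : ex_series (fun k => u k ^ 2) -> is_lim_seq u 0.
Proof.
  intros h. apply ex_series_lim_0 in h.
  apply is_lim_seq_abs_0. apply is_lim_seq_ext with (fun k => sqrt (u k ^ 2)).
  - intros k. now rewrite <- Rsqr_pow2, sqrt_Rsqr_abs.
  - rewrite <- sqrt_0. apply (is_lim_seq_continuous sqrt _ 0); [|easy]. apply continuity_pt_sqrt. lra.
Qed.

Lemma in_l2_vanishing phi (f : C -> R) : (forall z, Rabs (f z) <= Cmod z) -> in_l2 phi ->
  vanishing (fun m => f (phi m)).
Proof.
  intros hf [h1 h2]. apply square_summable_vanishing in h1, h2.
  assert (K : forall u : nat -> C, is_lim_seq (fun k => Cmod (u k)) 0 -> is_lim_seq (fun k => f (u k)) 0).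
  { intros u hu. apply is_lim_seq_abs_0.
    apply (is_lim_seq_le_le (fun _ => 0) _ (fun k => Cmod (u k))); [|apply is_lim_seq_const|easy].
    intros k. split; [apply Rabs_pos|apply hf]. }
  split; [now apply (K (fun k => phi (Z.of_nat k)))|now apply (K (fun k => phi (- Z.of_nat k)%Z))].
Qed.

(** [psi m] is the real part of [phi (n + m) / phi n]. The imaginary part vanishes trivially at
    [m = 0], by the zero current at [m = 1], and then everywhere by the recursion. *)
Lemma eigenfunction_bounded_state lambda alpha theta phi n :
  is_l2_eigenfunction lambda alpha theta phi -> leftmost_max phi n ->
  0 < Cmod (phi n) /\ exists E psi, bounded_state lambda alpha E (theta + IZR n * alpha) psi /\
    forall m, Cmod (phi (n + m)%Z) = Rabs (psi m) * Cmod (phi n).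
Proof.
  intros [hl2 [[m0 hm0] [E HE]]] [Hmax _].
  assert (hpos : 0 < Cmod (phi n)).
  { apply Rlt_le_trans with (Cmod (phi m0)); [now apply Cmod_gt_0|apply Hmax]. }
  split; [easy|].
  set (x := fun m => fst (phi m)). set (y := fun m => snd (phi m)).
  set (v := amo_pot lambda alpha theta).
  assert (ex : forall m, x (m + 1)%Z + x (m - 1)%Z + v m * x m = fst E * x m - snd E * y m).
  { intros m. specialize (HE m). apply (f_equal fst) in HE. unfold amo_apply, x, y in *. simpl in HE. fold v in HE. lra. }
  assert (ey : forall m, y (m + 1)%Z + y (m - 1)%Z + v m * y m = fst E * y m + snd E * x m).
  { intros m. specialize (HE m). apply (f_equal snd) in HE. unfold amo_apply, x, y in *. simpl in HE. fold v in HE. lra. }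
  assert (hfst : forall z : C, Rabs (fst z) <= Cmod z).
  { intros z. eapply Rle_trans; [apply Rmax_l|apply Rmax_Cmod]. }
  assert (hsnd : forall z : C, Rabs (snd z) <= Cmod z).
  { intros z. eapply Rle_trans; [apply Rmax_r|apply Rmax_Cmod]. }
  assert (HJ := current_zero x y v (fst E) (snd E) (in_l2_vanishing phi fst hfst hl2)
    (in_l2_vanishing phi snd hsnd hl2) ex ey).
  set (S := Cmod (phi n) * Cmod (phi n)).
  assert (hS : 0 < S) by (apply Rmult_lt_0_compat; easy).
  assert (hSe : S = x n * x n + y n * y n) by apply Cmod_sqr.
  assert (hE : snd E = 0).
  { destruct (HJ n) as [_ h]. rewrite <- hSe in h. apply Rmult_integral in h. destruct h; lra. }
  rewrite hE in *.
  assert (Hz : forall m, y m * x n - x m * y n = 0).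
  { apply (recursion_zero (fun m => y m * x n - x m * y n) (fun m => fst E - v m) n).
    - intros m. specialize (ex m). specialize (ey m).
      replace (y (m + 1)%Z) with (fst E * y m - y (m - 1)%Z - v m * y m) by lra.
      replace (x (m + 1)%Z) with (fst E * x m - x (m - 1)%Z - v m * x m) by lra. ring.
    - ring.
    - apply HJ. }
  set (psi := fun m => (x (n + m)%Z * x n + y (n + m)%Z * y n) / S).
  assert (Hmod : forall m, Cmod (phi (n + m)%Z) = Rabs (psi m) * Cmod (phi n)).
  { intros m. apply Rsqr_inj; [apply Cmod_ge_0|apply Rmult_le_pos; [apply Rabs_pos|apply Cmod_ge_0]|].
    rewrite Rsqr_mult, <- Rsqr_abs. unfold Rsqr. fold S. rewrite Cmod_sqr. fold (x (n + m)%Z) (y (n + m)%Z).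
    apply (Rmult_eq_reg_r S); [|lra].
    replace (psi m * psi m * S * S) with ((psi m * S) * (psi m * S)) by ring.
    replace (psi m * S) with (x (n + m)%Z * x n + y (n + m)%Z * y n) by (unfold psi; field; lra).
    specialize (Hz (n + m)%Z). rewrite hSe.
    replace ((x (n + m)%Z * x (n + m)%Z + y (n + m)%Z * y (n + m)%Z) * (x n * x n + y n * y n)) with
      ((x (n + m)%Z * x n + y (n + m)%Z * y n) * (x (n + m)%Z * x n + y (n + m)%Z * y n)
       + (y (n + m)%Z * x n - x (n + m)%Z * y n) * (y (n + m)%Z * x n - x (n + m)%Z * y n)) by ring.
    rewrite Hz. ring. }
  exists (fst E), psi. split; [|easy]. split; [|split].
  - intros m. apply (Rmult_le_reg_r (Cmod (phi n))); [easy|]. rewrite <- Hmod, Rmult_1_l. apply Hmax.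
  - unfold psi. rewrite Z.add_0_r, <- hSe. field. lra.
  - intros m. unfold resid, pot, psi. specialize (ex (n + m)%Z). specialize (ey (n + m)%Z).
    unfold v, amo_pot in ex, ey. rewrite plus_IZR in ex, ey.
    replace (n + (m + 1))%Z with (n + m + 1)%Z by lia. replace (n + (m - 1))%Z with (n + m - 1)%Z by lia.
    replace (theta + IZR n * alpha + IZR m * alpha) with (theta + (IZR n + IZR m) * alpha) by ring.
    set (V := 2 * lambda * cos (2 * PI * (theta + (IZR n + IZR m) * alpha))) in *.
    replace (x (n + m + 1)%Z) with (fst E * x (n + m)%Z - x (n + m - 1)%Z - V * x (n + m)%Z) by lra.
    replace (y (n + m + 1)%Z) with (fst E * y (n + m)%Z - y (n + m - 1)%Z - V * y (n + m)%Z) by lra.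
    field. lra.
Qed.

(** Reflection about the maximum reduces a site to its left to one on its right, with [x0] replaced
    by [- x0]. *)
Lemma bounded_state_opp lambda alpha E theta psi : bounded_state lambda alpha E theta psi ->
  bounded_state lambda alpha E (- theta) (fun i => psi (- i)%Z).
Proof.
  intros [h1 [h2 h3]]. split; [|split]; [intros; apply h1|easy|]. intros m. now rewrite resid_opp.
Qed.

Lemma msin_amo_sin alpha theta n x :
  msin (2 * (theta + IZR n * alpha) + IZR x * alpha) = 2 * amo_sin alpha theta n x.
Proof.
  unfold msin, amo_sin. rewrite Rabs_mult, (Rabs_right 2) by lra. do 3 f_equal. ring.
Qed.

Theorem theorem2p1 :
  forall (lambda alpha : R), 1 < lambda -> diophantine alpha ->
  exists eps0 : R, 0 < eps0 /\
  forall eps : R, 0 < eps < eps0 ->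
  exists N : Z,
  forall (theta : R) (phi : Z -> C) (n l x0 : Z),
    is_l2_eigenfunction lambda alpha theta phi ->
    leftmost_max phi n ->
    let l' := Z.abs (l - n) in
    (Z.abs x0 <= 2 * l')%Z ->
    (forall x : Z, (Z.abs x <= 2 * l')%Z ->
        amo_sin alpha theta n x0 <= amo_sin alpha theta n x) ->
    (N <= l')%Z ->
    ( ((l - n) * x0 < 0)%Z ->
        Cmod (phi l) <= exp (- (ln lambda - eps) * IZR l') * Cmod (phi n) ) /\
    ( forall eta : R, 0 < eta < ln lambda - eps ->
        (0 <= (l - n) * x0)%Z ->
        amo_sin alpha theta n x0 >= exp (- eta * IZR l') ->
        Cmod (phi l) <= exp (- (ln lambda - eps - eta) * IZR l') * Cmod (phi n) ).
Proof.
  intros lambda alpha hl hd. exists (ln lambda). split; [rewrite <- ln_1; apply ln_increasing; lra|].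
  intros eps heps. destruct (bounded_state_decay lambda alpha eps hl hd heps) as [N HN].
  (* The [+ 1] forces [l <> n], so that the sign of [(l - n) * x0] determines that of [x0]. *)
  exists (Z.of_nat N + 1)%Z. intros theta phi n l x0 Hphi Hn l' hx0 Hmin hN.
  destruct (eigenfunction_bounded_state lambda alpha theta phi n Hphi Hn) as [hpos [E [psi [Hst Hmod]]]].
  set (th := theta + IZR n * alpha) in *.
  set (k := Z.to_nat l').
  assert (hk : l' = Z.of_nat k) by (unfold k, l'; lia).
  assert (hr : IZR l' = INR k) by (rewrite hk; now rewrite <- INR_IZR_INZ).
  pose proof (Hmod (l - n)%Z) as hml. replace (n + (l - n))%Z with l in hml by lia. rewrite hml, hr.
  assert (Hs : forall x, msin (2 * th + IZR x * alpha) = 2 * amo_sin alpha theta n x) by apply msin_amo_sin.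
  destruct (Z_lt_dec n l) as [c|c].
  - destruct (HN E th psi k x0 Hst ltac:(lia) ltac:(lia)) as [h1 h2].
    { intros x hx. rewrite !Hs. specialize (Hmin x ltac:(lia)). lra. }
    replace (Z.of_nat k) with (l - n)%Z in h1, h2 by lia.
    split.
    + intros hneg. apply Rmult_le_compat_r; [lra|]. apply h1. nia.
    + intros eta heta hge hsin. apply Rmult_le_compat_r; [lra|]. apply h2; [lra|nia|]. rewrite Hs. lra.
  - assert (Hs' : forall x, msin (2 * (- th) + IZR x * alpha) = 2 * amo_sin alpha theta n (- x)).
    { intros x. rewrite <- Hs, <- msin_opp. f_equal. rewrite opp_IZR. ring. }
    destruct (HN E (- th) (fun i => psi (- i)%Z) k (- x0)%Z (bounded_state_opp _ _ _ _ _ Hst) ltac:(lia) ltac:(lia)) as [h1 h2].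
    { intros x hx. rewrite !Hs', Z.opp_involutive. specialize (Hmin (- x)%Z ltac:(lia)). lra. }
    replace (- Z.of_nat k)%Z with (l - n)%Z in h1, h2 by lia.
    split.
    + intros hneg. apply Rmult_le_compat_r; [lra|]. apply h1. nia.
    + intros eta heta hge hsin. apply Rmult_le_compat_r; [lra|]. apply h2; [lra|nia|].
      rewrite Hs', Z.opp_involutive. lra.
Qed.
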